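(* Let $(E,\|\cdot\|)$ be a $\mathcal{T}_{\varepsilon,\lambda}$-complete random normed module over $K$ with base $(\Omega,\mathcal{F},P)$ and let $G$ be a nonempty $\mathcal{T}_{\varepsilon,\lambda}$-closed $L^0$-convex subset of $E$. Then $G$ is convexly compact (as a subset of the linear topological space $(E,\mathcal{T}_{\varepsilon,\lambda})$) if and only if $G$ is $L^0$-convexly compact.
   Context: $(\Omega,\mathcal{F},P)$ is a probability space and $K$ is $\mathbb{R}$ or $\mathbb{C}$. $L^0(\mathcal{F},K)$ is the algebra of ($P$-a.s.) equivalence classes of $K$-valued $\mathcal{F}$-measurable random variables, $L^0(\mathcal{F})=L^0(\mathcal{F},\mathbb{R})$, ordered by the a.s. order, and $L^0_+(\mathcal{F})=\{\xi\in L^0(\mathcal{F}):\xi\ge 0\}$. Random normed module over $K$ with base $(\Omega,\mathcal{F},P)$: a left $L^0(\mathcal{F},K)$-module $E$ with a map $\|\cdot\|:E\to L^0_+(\mathcal{F})$ such that $\|\xi x\|=|\xi|\|x\|$, $\|x+y\|\le\|x\|+\|y\|$, and $\|x\|=0$ implies $x=\theta$ (the null element), for all $\xi\in L^0(\mathcal{F},K)$, $x,y\in E$. Its $(\varepsilon,\lambda)$-topology $\mathcal{T}_{\varepsilon,\lambda}$ is the metrizable linear topology with local base at $\theta$ given by $\{x: P\{\|x\|<\varepsilon\}>1-\lambda\}$, $\varepsilon>0$, $0<\lambda<1$. A subset $D$ of $E$ is $L^0$-convex if $\xi x+(1-\xi)y\in D$ for all $x,y\in D$ and all $\xi\in L^0_+(\mathcal{F})$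 with $0\le\xi\le1$. A closed $L^0$-convex subset $G$ is $L^0$-convexly compact if any family of closed $L^0$-convex subsets of $G$ with the finite intersection property has nonempty intersection. A nonempty convex subset $C$ of a Hausdorff linear topological space is convexly compact if each family of closed convex (in the ordinary sense) subsets of $C$ with the finite intersection property has nonempty intersection. *)

(* Defs.v *)
From HB Require Import structures.
From mathcomp Require Import all_boot all_order all_algebra.
From mathcomp Require Import complex lra.
From mathcomp Require Import all_classical all_reals all_analysis.
From mathcomp Require Import measurable_realfun.

Set Implicit Arguments.
Unset Strict Implicit.
Unset Printing Implicit Defensive.

Import Order.TTheory GRing.Theory Num.Theory.
Import numFieldTopology.Exports numFieldNormedType.Exports.

Local Open Scope classical_set_scope.
Local Open Scope ring_scope.
Local Open Scope complex_scope.
Local Open Scope quotient_scope.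

(* The two choices of K: R itself and R[i]. The scalars carry the topology of
   their norm and the Borel sigma-algebra of that topology. *)
Variant scalar_field := RealScalars | ComplexScalars.

Definition scalars (R : realType) (k : scalar_field) : Type :=
  match k with RealScalars => R | ComplexScalars => R[i] end.

HB.instance Definition _ (R : realType) (k : scalar_field) :
    Num.NumField (scalars R k) :=
  match k return Num.NumField.axioms_ (scalars R k) with
  | RealScalars => Num.NumField.on R
  | ComplexScalars => Num.NumField.on R[i]
  end.
HB.instance Definition _ (R : realType) (k : scalar_field) :=
  PseudoPointedMetric.copy (scalars R k) (scalars R k)^o.
HB.instance Definition _ (R : realType) (k : scalar_field) :=
  @isMeasurable.Build (sigma_display (@open (scalars R k))) (scalars R k)
   <<s open >> (@sigma_algebra0 _ setT _) (@sigma_algebraC _ _)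
  (@sigma_algebra_bigcup _ setT _).

Section scalar_theory.
Context {R : realType}.

Definition re (k : scalar_field) : scalars R k -> R :=
  match k with RealScalars => id | ComplexScalars => @complex.Re R end.
Definition im (k : scalar_field) : scalars R k -> R :=
  match k with RealScalars => fun=> 0 | ComplexScalars => @complex.Im R end.
Definition ofreal (k : scalar_field) : R -> scalars R k :=
  match k with RealScalars => id | ComplexScalars => fun r => r%:C end.
Definition absr (k : scalar_field) : scalars R k -> R :=
  match k with RealScalars => fun x => `|x| | ComplexScalars => @Normc.normc R end.

Lemma scalar_eqP k (x y : scalars R k) : re x = re y -> im x = im y -> x = y.
Proof. by case: k x y => //= -[a b] [c d] /= -> ->. Qed.

Lemma reD k (x y : scalars R k) : re (x + y) = re x + re y.
Proof. by case: k x y => //= -[a b] [c d]. Qed.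

Lemma imD k (x y : scalars R k) : im (x + y) = im x + im y.
Proof. by case: k x y => //= [x y|[a b] [c d]//]; rewrite addr0. Qed.

Lemma reN k (x : scalars R k) : re (- x) = - re x.
Proof. by case: k x => //= -[a b]. Qed.

Lemma imN k (x : scalars R k) : im (- x) = - im x.
Proof. by case: k x => //= [x|[a b]//]; rewrite oppr0. Qed.

Lemma reM k (x y : scalars R k) : re (x * y) = re x * re y - im x * im y.
Proof. by case: k x y => //= [x y|[a b] [c d]//]; rewrite mulr0 subr0. Qed.

Lemma imM k (x y : scalars R k) : im (x * y) = re x * im y + im x * re y.
Proof. by case: k x y => //= [x y|[a b] [c d]//]; rewrite mulr0 mul0r addr0. Qed.

Lemma re_ofreal k (r : R) : re (ofreal k r) = r.
Proof. by case: k. Qed.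

Lemma im_ofreal k (r : R) : im (ofreal k r) = 0.
Proof. by case: k. Qed.

Lemma absrE k (x : scalars R k) : absr x = Num.sqrt (re x ^+ 2 + im x ^+ 2).
Proof.
case: k x => [x|[a b]]//=; rewrite expr0n/= addr0 sqrtr_sqr//.
Qed.

Lemma normr_absr k (x : scalars R k) : `|x| = ofreal k (absr x).
Proof. by case: k x => [x|[a b]]. Qed.

Lemma ofreal0 k : ofreal k (0 : R) = 0.
Proof. by case: k. Qed.

Lemma ofreal1 k : ofreal k (1 : R) = 1.
Proof. by case: k. Qed.

Lemma ltr_ofreal k (r s : R) : (ofreal k r < ofreal k s) = (r < s).
Proof. by case: k => //=; rewrite ltcR. Qed.

Lemma absr_triangle k (x y : scalars R k) : absr (x + y) <= absr x + absr y.
Proof.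
case: k x y => [x y|x y]; first exact: ler_normD.
exact: le_normcD.
Qed.

Lemma ge0_ofreal k (z : scalars R k) : 0 <= z -> z = ofreal k (re z).
Proof.
move=> z0; apply: scalar_eqP; rewrite ?re_ofreal ?im_ofreal//.
by case: k z z0 => // -[a b]; rewrite lecE/= => /andP[/eqP].
Qed.

End scalar_theory.
Arguments re {R k} x.
Arguments im {R k} x.
Arguments ofreal {R} k r.
Arguments absr {R k} x.

Section scalar_measurability.
Context {R : realType}.

Lemma absr_le k (x : scalars R k) : absr x <= `|re x| + `|im x|.
Proof.
rewrite absrE -[leRHS]ger0_norm ?addr_ge0// -sqrtr_sqr ler_wsqrtr//.
rewrite sqrrD !real_normK ?num_real// lerD2r lerDl mulrn_wge0// mulr_ge0//.
Qed.

Lemma re_le_absr k (x : scalars R k) : `|re x| <= absr x.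
Proof. by rewrite absrE -sqrtr_sqr ler_wsqrtr// lerDl sqr_ge0. Qed.

Lemma im_le_absr k (x : scalars R k) : `|im x| <= absr x.
Proof. by rewrite absrE -sqrtr_sqr ler_wsqrtr// lerDr sqr_ge0. Qed.

Lemma scalars_openP k (U : set (scalars R k)) :
  open U <-> forall x, U x ->
    exists2 e : R, 0 < e & forall y, absr (x - y) < e -> U y.
Proof.
rewrite openE; split=> [oU x /oU|oU x /oU[e e0 eU]].
- rewrite /interior => /nbhs_ballP[e /= e0 eU].
  exists (re e).
    by rewrite -(ltr_ofreal k) ofreal0 -ge0_ofreal// ltW.
  move=> y xy; apply: eU; rewrite /ball/= normr_absr.
  by rewrite (ge0_ofreal (ltW e0)) ltr_ofreal.
- apply/nbhs_ballP; exists (ofreal k e) => /=.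
    by rewrite -(ofreal0 k) ltr_ofreal.
  by move=> y; rewrite /ball/= normr_absr ltr_ofreal; exact: eU.
Qed.

Lemma measurable_re k : measurable_fun setT (re : scalars R k -> R).
Proof.
apply: (measurability _ (RGenOpens.measurableE R)) => _ [_ [a [b ->]] <-].
rewrite setTI; apply: sub_sigma_algebra; apply/scalars_openP => x /=.
rewrite in_itv/= => /andP[ax xb].
exists (Num.min (re x - a) (b - re x)); first by rewrite lt_min !subr_gt0 ax xb.
move=> y; rewrite lt_min => /andP[xya xyb].
have := re_le_absr (x - y); rewrite reD reN => /[dup] /le_lt_trans/(_ xya).
rewrite ltr_norml => /andP[_ h1] /le_lt_trans/(_ xyb).
by rewrite ltr_norml in_itv/= => /andP[h2 _]; apply/andP; split; lra.
Qed.

Lemma measurable_im k : measurable_fun setT (im : scalars R k -> R).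
Proof.
apply: (measurability _ (RGenOpens.measurableE R)) => _ [_ [a [b ->]] <-].
rewrite setTI; apply: sub_sigma_algebra; apply/scalars_openP => x /=.
rewrite in_itv/= => /andP[ax xb].
exists (Num.min (im x - a) (b - im x)); first by rewrite lt_min !subr_gt0 ax xb.
move=> y; rewrite lt_min => /andP[xya xyb].
have := im_le_absr (x - y); rewrite imD imN => /[dup] /le_lt_trans/(_ xya).
rewrite ltr_norml => /andP[_ h1] /le_lt_trans/(_ xyb).
by rewrite ltr_norml in_itv/= => /andP[h2 _]; apply/andP; split; lra.
Qed.

Lemma measurable_fun_scalarsP d (T : measurableType d) k (f : T -> scalars R k) :
  measurable_fun setT f <->
  measurable_fun setT (re \o f) /\ measurable_fun setT (im \o f).
Proof.
split=> [mf|[mre mim]].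
  by split; apply: measurableT_comp => //; [exact: measurable_re|exact: measurable_im].
apply: (@measurability _ _ T (scalars R k) setT f open) => // _ [U oU <-].
rewrite setTI.
pose v (n : nat) : R := n.+1%:R^-1.
pose rect (q : rat * rat * nat) : set (scalars R k) :=
  [set z | `]ratr q.1.1 - v q.2, ratr q.1.1 + v q.2[%classic (re z) /\
           `]ratr q.1.2 - v q.2, ratr q.1.2 + v q.2[%classic (im z)].
have -> : f @^-1` U = \bigcup_(q in [set q | rect q `<=` U]) f @^-1` (rect q).
  apply/seteqP; split=> [t /= Uft|t [q /= qU]]; last exact: qU.
  have [e e0 eU] := (scalars_openP U).1 oU _ Uft.
  have [n ne] : exists n : nat, v n < e / 4 :> R.
    have := near_infty_natSinv_lt (PosNum (divr_gt0 e0 (ltr0n R 4))).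
    by case=> N _ /(_ N (leqnn _))/= NE; exists N.
  have n0 : 0 < v n :> R by rewrite /v invr_gt0.
  have hre : re (f t) - v n < re (f t) + v n by lra.
  have [p] := rat_in_itvoo hre.
  rewrite in_itv/= => /andP[p1 p2].
  have him : im (f t) - v n < im (f t) + v n by lra.
  have [q] := rat_in_itvoo him.
  rewrite in_itv/= => /andP[q1 q2].
  exists (p, q, n) => /=; last first.
    by rewrite /rect /= !in_itv/=; split; apply/andP; split; lra.
  move=> z; rewrite /rect /= !in_itv/= => -[/andP[z1 z2] /andP[z3 z4]].
  apply: eU; apply: le_lt_trans (absr_le _) _; rewrite reD reN imD imN.
  have -> : e = e / 4 * 2 + e / 4 * 2 by lra.
  by apply: ltrD; rewrite ltr_norml; apply/andP; split; lra.
rewrite bigcup_mkcond; apply: countable_bigcupT_measurable.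
  exact: countableP.
move=> [[p q] n]; case: ifP => // _.
rewrite [X in measurable X](_ : _ = ((re \o f) @^-1` 
    `]ratr p - v n, ratr p + v n[%classic) `&` ((im \o f) @^-1`
    `]ratr q - v n, ratr q + v n[%classic))//.
apply: measurableI; rewrite -[X in measurable X]setTI.
- by apply: mre => //; exact: measurable_itv.
- by apply: mim => //; exact: measurable_itv.
Qed.

Section operations.
Context d (T : measurableType d) (k : scalar_field).
Implicit Types f g : T -> scalars R k.

Lemma measurable_scalarsD f g :
  measurable_fun setT f -> measurable_fun setT g ->
  measurable_fun setT (fun t => f t + g t).
Proof.
move=> /measurable_fun_scalarsP[f1 f2] /measurable_fun_scalarsP[g1 g2].
apply/measurable_fun_scalarsP; split.
  rewrite (_ : _ \o _ = (re \o f) \+ (re \o g)); first exact: measurable_funD.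
  by apply/funext => t /=; rewrite reD.
rewrite (_ : _ \o _ = (im \o f) \+ (im \o g)); first exact: measurable_funD.
by apply/funext => t /=; rewrite imD.
Qed.

Lemma measurable_scalarsN f :
  measurable_fun setT f -> measurable_fun setT (fun t => - f t).
Proof.
move=> /measurable_fun_scalarsP[f1 f2].
apply/measurable_fun_scalarsP; split.
  rewrite (_ : _ \o _ = \- (re \o f)); first exact: measurableT_comp.
  by apply/funext => t /=; rewrite reN.
rewrite (_ : _ \o _ = \- (im \o f)); first exact: measurableT_comp.
by apply/funext => t /=; rewrite imN.
Qed.

Lemma measurable_scalarsM f g :
  measurable_fun setT f -> measurable_fun setT g ->
  measurable_fun setT (fun t => f t * g t).
Proof.
move=> /measurable_fun_scalarsP[f1 f2] /measurable_fun_scalarsP[g1 g2].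
apply/measurable_fun_scalarsP; split.
  rewrite (_ : _ \o _ = ((re \o f) \* (re \o g)) \- ((im \o f) \* (im \o g))).
    by apply: measurable_funB; exact: measurable_funM.
  by apply/funext => t /=; rewrite reM.
rewrite (_ : _ \o _ = ((re \o f) \* (im \o g)) \+ ((im \o f) \* (re \o g))).
  by apply: measurable_funD; exact: measurable_funM.
by apply/funext => t /=; rewrite imM.
Qed.

Lemma measurable_ofreal (f : T -> R) :
  measurable_fun setT f -> measurable_fun setT (fun t => ofreal k (f t)).
Proof.
move=> mf; apply/measurable_fun_scalarsP; split.
  by rewrite (_ : _ \o _ = f)//; apply/funext => t /=; rewrite re_ofreal.
rewrite (_ : _ \o _ = cst 0); first exact: measurable_cst.
by apply/funext => t /=; rewrite im_ofreal.
Qed.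

Lemma measurable_absr f :
  measurable_fun setT f -> measurable_fun setT (fun t => absr (f t)).
Proof.
move=> /measurable_fun_scalarsP[f1 f2].
rewrite (_ : (fun t => _) =
  Num.sqrt \o ((fun t => (re (f t)) ^+ 2) \+ (fun t => (im (f t)) ^+ 2))).
  apply: measurableT_comp.
    by apply: continuous_measurable_fun; exact: sqrt_continuous.
  by apply: measurable_funD; exact: measurable_funX.
by apply/funext => t /=; rewrite absrE.
Qed.

End operations.
End scalar_measurability.

(* P-a.s. equality classes of measurable functions; the coercion L0_fun picks a
   representative, so pointwise facts about it hold P-a.s. only. *)
Definition L0 d (T : measurableType d) (R : realType) (P : probability T R)
    (k : scalar_field) : Type :=
  {mfun_ P, T >-> scalars R k}.

Section L0_theory.
Context d (T : measurableType d) (R : realType) (P : probability T R).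
Context (k : scalar_field).

HB.instance Definition _ := Choice.on (L0 P k).

Definition L0_fun (x : L0 P k) : T -> scalars R k :=
  repr (x : {mfun_ P, T >-> scalars R k}).

Definition L0_class (f : T -> scalars R k) (mf : measurable_fun setT f) :
    L0 P k :=
  \pi_({mfun_ P, T >-> scalars R k}) (mfun_Sub (mem_set mf)).

Lemma measurable_L0_fun (x : L0 P k) : measurable_fun setT (L0_fun x).
Proof. exact: measurable_funPT. Qed.

Lemma L0_classE f mf : \forall t \ae P, L0_fun (@L0_class f mf) t = f t.
Proof.
pose g : {mfun T >-> scalars R k} := mfun_Sub (mem_set mf).
have /eqmodP/asboolP : repr (\pi_({mfun_ P, T >-> scalars R k}) g) = g
    %[mod {mfun_ P, T >-> scalars R k}].
  by rewrite reprK.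
by apply: filterS => t /(_ Logic.I).
Qed.

Lemma L0_eqP (x y : L0 P k) :
  x = y <-> \forall t \ae P, L0_fun x t = L0_fun y t.
Proof.
split=> [->|xy]; first exact: aeW.
rewrite -[x](@reprK _ {mfun_ P, T >-> scalars R k}) -[y](@reprK _ {mfun_ P, T >-> scalars R k}).
by apply/eqmodP/asboolP; apply: filterS xy.
Qed.

End L0_theory.
Coercion L0_fun : L0 >-> Funclass.

Section L0_ring.
Context d (T : measurableType d) (R : realType) (P : probability T R).
Context (k : scalar_field).
Implicit Types x y z : L0 P k.

Definition L0_cst (a : scalars R k) : L0 P k := L0_class P (measurable_cst a).
Definition L0_add x y : L0 P k :=
  L0_class P (measurable_scalarsD (measurable_L0_fun x) (measurable_L0_fun y)).
Definition L0_opp x : L0 P k :=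
  L0_class P (measurable_scalarsN (measurable_L0_fun x)).
Definition L0_mul x y : L0 P k :=
  L0_class P (measurable_scalarsM (measurable_L0_fun x) (measurable_L0_fun y)).

Lemma L0_addE x y : \forall t \ae P, L0_add x y t = x t + y t.
Proof. exact: L0_classE. Qed.
Lemma L0_oppE x : \forall t \ae P, L0_opp x t = - x t.
Proof. exact: L0_classE. Qed.
Lemma L0_mulE x y : \forall t \ae P, L0_mul x y t = x t * y t.
Proof. exact: L0_classE. Qed.
Lemma L0_cstE a : \forall t \ae P, L0_cst a t = a.
Proof. exact: L0_classE. Qed.



Let addA : associative L0_add.
Proof.
move=> x y z; apply/L0_eqP; near=> t.
by do ![rewrite (near (L0_addE _ _) t)//]; rewrite addrA.
Unshelve. all: by end_near. Qed.

Let addC : commutative L0_add.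
Proof.
move=> x y; apply/L0_eqP; near=> t.
by do ![rewrite (near (L0_addE _ _) t)//]; rewrite addrC.
Unshelve. all: by end_near. Qed.

Let add0 : left_id (L0_cst 0) L0_add.
Proof.
move=> x; apply/L0_eqP; near=> t.
by rewrite (near (L0_addE _ _) t)// (near (L0_cstE _) t)// add0r.
Unshelve. all: by end_near. Qed.

Let addN : left_inverse (L0_cst 0) L0_opp L0_add.
Proof.
move=> x; apply/L0_eqP; near=> t.
by rewrite (near (L0_addE _ _) t)// (near (L0_oppE _) t)// (near (L0_cstE _) t)// addNr.
Unshelve. all: by end_near. Qed.

HB.instance Definition _ := GRing.isZmodule.Build (L0 P k) addA addC add0 addN.

Let mulA : associative L0_mul.
Proof.
move=> x y z; apply/L0_eqP; near=> t.
by do ![rewrite (near (L0_mulE _ _) t)//]; rewrite mulrA.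
Unshelve. all: by end_near. Qed.

Let mulC : commutative L0_mul.
Proof.
move=> x y; apply/L0_eqP; near=> t.
by do ![rewrite (near (L0_mulE _ _) t)//]; rewrite mulrC.
Unshelve. all: by end_near. Qed.

Let mul1 : left_id (L0_cst 1) L0_mul.
Proof.
move=> x; apply/L0_eqP; near=> t.
by rewrite (near (L0_mulE _ _) t)// (near (L0_cstE _) t)// mul1r.
Unshelve. all: by end_near. Qed.

Let mulD : left_distributive L0_mul L0_add.
Proof.
move=> x y z; apply/L0_eqP; near=> t.
rewrite (near (L0_mulE _ _) t)// (near (L0_addE _ _) t)// (near (L0_addE _ _) t)//.
by do ![rewrite (near (L0_mulE _ _) t)//]; rewrite mulrDl.
Unshelve. all: by end_near. Qed.

Let one_neq0 : L0_cst 1 != L0_cst 0.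
Proof.
apply/eqP => /L0_eqP h.
have : P.-negligible [set: T].
  apply: negligibleS (negligibleU h (negligibleU (L0_cstE 1) (L0_cstE 0))).
  move=> t _ /=; case: (pselect (L0_cst 1 t = 1)) => [h1|h1]; last by right; left.
  case: (pselect (L0_cst 0 t = 0)) => [h0|h0]; last by right; right.
  by left => /=; rewrite h1 h0 => /eqP; rewrite oner_eq0.
move=> /(negligibleP P measurableT).
have := @probability_setT _ _ _ P => /= -> /eqP.
by rewrite onee_eq0.
Qed.

HB.instance Definition _ := GRing.Zmodule_isComNzRing.Build (L0 P k)
  mulA mulC mul1 mulD one_neq0.

Lemma L0DE x y : \forall t \ae P, (x + y : L0 P k) t = x t + y t.
Proof. exact: L0_addE. Qed.
Lemma L0NE x : \forall t \ae P, (- x : L0 P k) t = - x t.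
Proof. exact: L0_oppE. Qed.
Lemma L0BE x y : \forall t \ae P, (x - y : L0 P k) t = x t - y t.
Proof.
near=> t; by rewrite (near (L0DE _ _) t)// (near (L0NE _) t).
Unshelve. all: by end_near. Qed.
Lemma L0ME x y : \forall t \ae P, (x * y : L0 P k) t = x t * y t.
Proof. exact: L0_mulE. Qed.
Lemma L00E : \forall t \ae P, (0 : L0 P k) t = 0.
Proof. exact: L0_cstE. Qed.
Lemma L01E : \forall t \ae P, (1 : L0 P k) t = 1.
Proof. exact: L0_cstE. Qed.

End L0_ring.

Section L0_order.
Context d (T : measurableType d) (R : realType) (P : probability T R).

Definition L0_le (x y : L0 P RealScalars) : Prop :=
  \forall t \ae P, (x t : R) <= y t.

Context (k : scalar_field).

Lemma measurable_scalars_real (f : T -> R) :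
  measurable_fun setT f ->
  measurable_fun setT (f : T -> scalars R RealScalars).
Proof. exact: (@measurable_ofreal _ _ _ RealScalars). Qed.

Lemma measurable_L0_real (x : L0 P RealScalars) :
  measurable_fun setT (x : T -> R).
Proof. by have /measurable_fun_scalarsP[] := measurable_L0_fun x. Qed.

Definition L0_abs (x : L0 P k) : L0 P RealScalars :=
  L0_class P (measurable_scalars_real (measurable_absr (measurable_L0_fun x))).

Definition L0_ofreal (x : L0 P RealScalars) : L0 P k :=
  L0_class P (measurable_ofreal (k := k) (measurable_L0_real x)).

Lemma L0_absE x : \forall t \ae P, L0_abs x t = absr (x t).
Proof. exact: L0_classE. Qed.

Lemma L0_ofrealE x : \forall t \ae P, L0_ofreal x t = ofreal k (x t).
Proof. exact: L0_classE. Qed.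

End L0_order.

(* rnorm_ge0 says that rnorm takes its values in L0_+. *)
HB.mixin Record isRandomNormed d (T : measurableType d) (R : realType)
    (P : probability T R) (k : scalar_field) E of GRing.Lmodule (L0 P k) E := {
  rnorm : E -> L0 P RealScalars ;
  rnorm_ge0 : forall x, L0_le 0 (rnorm x) ;
  rnormZ : forall (xi : L0 P k) x, rnorm (xi *: x) = L0_abs xi * rnorm x ;
  ler_rnormD : forall x y, L0_le (rnorm (x + y)) (rnorm x + rnorm y) ;
  rnorm0_eq0 : forall x, rnorm x = 0 -> x = 0
}.

#[short(type="rnModType")]
HB.structure Definition RandomNormedModule d (T : measurableType d)
    (R : realType) (P : probability T R) (k : scalar_field) :=
  {E of GRing.Lmodule (L0 P k) E & isRandomNormed d T R P k E}.

Section rnorm_theory.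
Context d (T : measurableType d) (R : realType) (P : probability T R).
Context (k : scalar_field) (E : rnModType P k).
Implicit Types x y z : E.

(* The basic neighbourhoods of 0 of the (epsilon, lambda)-topology. *)
Definition el_ball (eps lam : R) : set E :=
  [set x | ((1 - lam)%:E < P [set t | ((rnorm x t : R) < eps)%R])%E].

Definition rnorm_tail (eps : R) x : set T := [set t | eps <= (rnorm x t : R)].

Lemma measurable_rnorm_tail eps x : measurable (rnorm_tail eps x).
Proof.
rewrite -[X in measurable X]setTI (_ : rnorm_tail eps x = (rnorm x : T -> R) @^-1` `[eps, +oo[%classic).
  by apply: measurable_L0_real => //; exact: measurable_itv.
by apply/funext => t /=; rewrite in_itv/= andbT.
Qed.

Lemma el_ballP eps lam x : el_ball eps lam x <-> (P (rnorm_tail eps x) < lam%:E)%E.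
Proof.
rewrite /el_ball/= (_ : [set _ | _] = ~` rnorm_tail eps x).
  rewrite probability_setC; last exact: measurable_rnorm_tail.
  have /fin_numPlt : P (rnorm_tail eps x) \is a fin_num.
    by apply: fin_num_measure; exact: measurable_rnorm_tail.
  case: (P (rnorm_tail eps x)) => [r _| |]//=.
  by rewrite -EFinB !lte_fin ltrD2l ltrN2.
by apply/funext => t; apply/propext; rewrite /rnorm_tail/= ltNge; split => /negP.
Qed.

Lemma ae_le_prob (A B : set T) : measurable A -> measurable B ->
  (\forall t \ae P, A t -> B t) -> (P A <= P B)%E.
Proof.
move=> mA mB [N [mN N0 AB]].
apply: (@le_trans _ _ (P (B `|` N))).
  apply: le_measure; rewrite ?inE//; first exact: measurableU.
  move=> t At; case: (pselect (B t)); first by left.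
  by move=> nB; right; apply: AB => /= /(_ At).
apply: (le_trans (measureU2 _ mB mN)).
have hN : P N = 0%E by exact: N0.
by rewrite [X in (X <= _)%E](_ : _ = (P B + P N)%E)// hN adde0.
Qed.

Lemma rnorm_tail_add eps1 eps2 x y z :
  L0_le (rnorm x) (rnorm y + rnorm z) ->
  (P (rnorm_tail (eps1 + eps2) x) <= P (rnorm_tail eps1 y) + P (rnorm_tail eps2 z))%E.
Proof.
move=> xyz; have my := measurable_rnorm_tail eps1 y; have mz := measurable_rnorm_tail eps2 z.
apply: le_trans (measureU2 _ my mz); apply: ae_le_prob => //.
- exact: measurable_rnorm_tail.
- exact: measurableU.
near=> t; rewrite /rnorm_tail/= => h.
have : (rnorm x t : R) <= (rnorm y + rnorm z : L0 P RealScalars) t by near: t; exact: xyz.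
rewrite (near (L0DE (rnorm y) _) t)// => h'.
have [h1|h1] := leP eps1 (rnorm y t : R); [by left|right; rewrite /=].
by have := le_trans h h'; rewrite leNgt => /negP h2; rewrite leNgt; apply/negP => h3; apply: h2; exact: ltrD.
Unshelve. all: by end_near. Qed.

Lemma rnorm0 : rnorm (0 : E) = 0.
Proof.
rewrite -[X in rnorm X](scale0r (0 : E)) rnormZ; apply/L0_eqP; near=> t.
rewrite (near (L0ME _ _) t)// (near (L0_absE _) t)// !(near (L00E P _) t)//.
by rewrite (_ : absr _ = 0) ?mul0r// absrE; case: (k) => /=; rewrite expr0n/= addr0 sqrtr0.
Unshelve. all: by end_near. Qed.

Lemma rnormZ_cst (a : scalars R k) x :
  \forall t \ae P, (rnorm (L0_cst P a *: x) t : R) = absr a * (rnorm x t : R).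
Proof.
rewrite rnormZ; near=> t.
by rewrite (near (L0ME _ _) t)// (near (L0_absE _) t)// (near (L0_cstE P a) t).
Unshelve. all: by end_near. Qed.

Lemma rnormN x : rnorm (- x) = rnorm x.
Proof.
rewrite -scaleN1r rnormZ; apply/L0_eqP; near=> t.
rewrite (near (L0ME _ _) t)// (near (L0_absE _) t)// (near (L0NE _) t)//.
rewrite (near (L01E P _) t)//.
rewrite (_ : absr _ = 1) ?mul1r// absrE reN imN -(ofreal1 k) re_ofreal im_ofreal.
by rewrite oppr0 expr0n/= addr0 sqrrN expr1n sqrtr1.
Unshelve. all: by end_near. Qed.

Lemma rnorm_tail_cvg0 x (lam : R) : 0 < lam ->
  exists n : nat, (P (rnorm_tail n.+1%:R x) < lam%:E)%E.
Proof.
move=> lam0.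
have mF i : measurable (rnorm_tail i.+1%:R x) by exact: measurable_rnorm_tail.
have : P \o (fun i => rnorm_tail i.+1%:R x) @ \oo --> P (\bigcap_i rnorm_tail i.+1%:R x).
  apply: nonincreasing_cvg_mu => //.
  - by apply: le_lt_trans (probability_le1 _ _) _ => //; rewrite ltry.
  - exact: bigcapT_measurable.
  - move=> m n mn; apply/subsetPset => t; rewrite /rnorm_tail/=; apply: le_trans.
    by rewrite ler_nat.
rewrite (_ : \bigcap_i _ = set0) ?measure0; last first.
  apply/seteqP; split=> // t h.
  have := h (Num.truncn (rnorm x t : R)) Logic.I; rewrite /rnorm_tail/= leNgt => /negP; apply.
  exact: truncnS_gt.
move=> h.
have : \forall n \near \oo, (P (rnorm_tail n.+1%:R x) < lam%:E)%E.
  apply: (h [set y | (y < lam%:E)%E]); apply: open_nbhs_nbhs; split => /=.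
    exact: open_ereal_lt_ereal.
  by rewrite lte_fin.
by case=> n _ /(_ n (leqnn n)); exists n.
Qed.

End rnorm_theory.


Section L0_cst_morph.
Context d (T : measurableType d) (R : realType) (P : probability T R).
Context (k : scalar_field).

Lemma L0_cstD (a b : scalars R k) : L0_cst P (a + b) = L0_cst P a + L0_cst P b.
Proof.
apply/L0_eqP; near=> t; rewrite (near (L0DE _ _) t)//.
by do ![rewrite (near (L0_cstE _ _) t)//].
Unshelve. all: by end_near. Qed.

Lemma L0_cstM (a b : scalars R k) : L0_cst P (a * b) = L0_cst P a * L0_cst P b.
Proof.
apply/L0_eqP; near=> t; rewrite (near (L0ME _ _) t)//.
by do ![rewrite (near (L0_cstE _ _) t)//].
Unshelve. all: by end_near. Qed.

End L0_cst_morph.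

(* E has a single canonical module structure, over L0 P k; the alias el_space E
   carries the K-vector space obtained by letting the constants of L0 P k act,
   together with the (epsilon, lambda)-topology and its uniformity. *)
Definition el_space d (T : measurableType d) (R : realType)
  (P : probability T R) (k : scalar_field) (E : rnModType P k) : Type := E.

Section el_topology.
Context d (T : measurableType d) (R : realType) (P : probability T R).
Context (k : scalar_field) (E : rnModType P k).

HB.instance Definition _ := GRing.Zmodule.on (el_space E).

Definition el_scale (a : scalars R k) (x : el_space E) : el_space E :=
  L0_cst P a *: (x : E).

Let scaleA a b v : el_scale a (el_scale b v) = el_scale (a * b) v.
Proof. by rewrite /el_scale scalerA L0_cstM. Qed.
Let scale1 : left_id 1 el_scale.
Proof. by move=> x; rewrite /el_scale [L0_cst P 1](_ : _ = 1)// scale1r. Qed.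
Let scaleDr : right_distributive el_scale +%R.
Proof. by move=> a x y; rewrite /el_scale scalerDr. Qed.
Let scaleDl v : {morph el_scale^~ v : a b / a + b}.
Proof. by move=> a b; rewrite /el_scale L0_cstD scalerDl. Qed.

HB.instance Definition _ := GRing.Zmodule_isLmodule.Build (scalars R k)
  (el_space E) scaleA scale1 scaleDr scaleDl.

Definition el_entourage : set_system (el_space E * el_space E) :=
  [set A | exists eps lam : R, [/\ 0 < eps, 0 < lam, lam < 1 &
    forall x y : E, el_ball eps lam (x - y) -> A (x, y)]].

Lemma el_ball_le (eps lam eps' lam' : R) (x : E) :
  eps <= eps' -> lam <= lam' -> el_ball eps lam x -> el_ball eps' lam' x.
Proof.
move=> ee ll /el_ballP h; apply/el_ballP.
apply: (@le_lt_trans _ _ (P (rnorm_tail eps x))); last first.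
  by apply: lt_le_trans h _; rewrite lee_fin.
apply: le_measure; rewrite ?inE; do ?exact: measurable_rnorm_tail.
by move=> t; rewrite /rnorm_tail/=; exact: le_trans.
Qed.

Lemma el_ball0 (eps lam : R) : 0 < eps -> 0 < lam -> el_ball eps lam (0 : E).
Proof.
move=> e0 l0; apply/el_ballP; rewrite /rnorm_tail rnorm0.
apply: (@le_lt_trans _ _ 0%E); last by rewrite lte_fin.
rewrite -(measure0 P); apply: ae_le_prob => //.
  by have := measurable_rnorm_tail eps (0 : E); rewrite /rnorm_tail rnorm0.
near=> t; rewrite /= (near (L00E P RealScalars) t)// => h.
by have := lt_le_trans e0 h; rewrite ltxx.
Unshelve. all: by end_near. Qed.

Lemma el_ballN (eps lam : R) (x : E) : el_ball eps lam (- x) = el_ball eps lam x.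
Proof. by rewrite /el_ball/= rnormN. Qed.

Lemma el_ballD (eps1 eps2 lam1 lam2 : R) (x y : E) :
  el_ball eps1 lam1 x -> el_ball eps2 lam2 y ->
  el_ball (eps1 + eps2) (lam1 + lam2) (x + y).
Proof.
move=> /el_ballP hx /el_ballP hy; apply/el_ballP.
apply: le_lt_trans (rnorm_tail_add eps1 eps2 (ler_rnormD x y)) _.
by rewrite EFinD; exact: lteD.
Qed.

Lemma el_entourageP (A : set (el_space E * el_space E)) (eps lam : R) :
  0 < eps -> 0 < lam ->
  (forall x y : E, el_ball eps lam (x - y) -> A (x, y)) -> el_entourage A.
Proof.
move=> e0 l0 h; exists eps, (Num.min lam 2^-1); split => //.
- by rewrite lt_min l0/= invr_gt0.
- by rewrite gt_min orbC invf_lt1 ?ltr1n.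
by move=> x y xy; apply/h; apply: el_ball_le xy => //; rewrite ge_min lexx.
Qed.

Let el_entourage_filter : Filter el_entourage.
Proof.
split.
- by exists 1, 2^-1; split=> //; rewrite ?invr_gt0// invf_lt1 ?ltr1n.
- move=> A B [e1 [l1 [e10 l10 _ h1]]] [e2 [l2 [e20 l20 _ h2]]].
  apply: (@el_entourageP _ (Num.min e1 e2) (Num.min l1 l2)).
  + by rewrite lt_min e10.
  + by rewrite lt_min l10.
  + move=> x y xy; split.
      by apply: h1; apply: el_ball_le xy; rewrite ge_min lexx.
    by apply: h2; apply: el_ball_le xy; rewrite ge_min lexx orbT.
- move=> A B AB [e1 [l1 [e10 l10 l11 h1]]]; exists e1, l1; split => // x y xy.
  exact/AB/h1.
Qed.

Let el_entourage_diagonal A : el_entourage A -> diagonal `<=` A.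
Proof.
move=> [e1 [l1 [e10 l10 _ h1]]] [x y]/=; rewrite /diagonal/= => ->.
by apply: h1; rewrite subrr; exact: el_ball0.
Qed.

Let el_entourage_inv A : el_entourage A -> el_entourage A^-1%relation.
Proof.
move=> [e1 [l1 [e10 l10 l11 h1]]]; exists e1, l1; split => // x y xy.
by apply: h1; rewrite -opprB el_ballN.
Qed.

Let el_entourage_split A : el_entourage A ->
  exists2 B, el_entourage B & (B \; B)%relation `<=` A.
Proof.
move=> [e1 [l1 [e10 l10 _ h1]]].
exists [set xy | el_ball (e1 / 2) (l1 / 2) ((xy.1 : E) - xy.2)].
  by apply: (@el_entourageP _ (e1 / 2) (l1 / 2)) => //; rewrite divr_gt0.
move=> [x y] [z /= xz zy]; apply: h1.
rewrite [e1]splitr [l1]splitr -(subrK z x) -addrA; exact: el_ballD.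
Qed.

HB.instance Definition _ := isUniform.Build (el_space E)
  el_entourage_filter el_entourage_diagonal el_entourage_inv el_entourage_split.

Lemma el_nbhsP (x : el_space E) (A : set (el_space E)) :
  nbhs x A <-> exists eps lam : R, [/\ 0 < eps, 0 < lam, lam < 1 &
    forall y : E, el_ball eps lam (y - (x : E)) -> A y].
Proof.
rewrite -nbhs_entourageE; split.
- move=> [B [e [l [e0 l0 l1 h]]] BA]; exists e, l; split=> // y yx.
  by apply: BA; apply/xsectionP; apply: h; rewrite -opprB el_ballN.
- move=> [e [l [e0 l0 l1 h]]].
  exists [set xy | el_ball e l ((xy.1 : E) - xy.2)]; first by exists e, l.
  by move=> y /xsectionP/= xy; apply: h; rewrite -opprB el_ballN.
Qed.

Lemma el_nbhs_ball (x : el_space E) (eps lam : R) : 0 < eps -> 0 < lam ->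
  nbhs x [set y : el_space E | el_ball eps lam ((y : E) - x)].
Proof.
move=> e0 l0; apply/el_nbhsP; exists eps, (Num.min lam 2^-1); split => //.
- by rewrite lt_min l0/= invr_gt0.
- by rewrite gt_min orbC invf_lt1 ?ltr1n.
by move=> y; apply: el_ball_le => //; rewrite ge_min lexx.
Qed.

Let el_add_continuous :
  continuous (fun x : el_space E * el_space E => x.1 + x.2).
Proof.
move=> [x y] A /el_nbhsP[e [l [e0 l0 l1 h]]].
exists ([set z : el_space E | el_ball (e / 2) (l / 2) ((z : E) - x)],
        [set z : el_space E | el_ball (e / 2) (l / 2) ((z : E) - y)]).
  by split; apply: el_nbhs_ball; rewrite divr_gt0.
move=> [x' y'] [/= hx hy]; apply: h => /=.
rewrite opprD addrACA [e]splitr [l]splitr; exact: el_ballD.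
Qed.

HB.instance Definition _ :=
  PreTopologicalNmodule_isTopologicalNmodule.Build (el_space E)
    el_add_continuous.

Lemma el_ball_scale (a : scalars R k) (M eps lam : R) (x : E) :
  0 < M -> absr a <= M -> el_ball (eps / M) lam x ->
  el_ball eps lam (L0_cst P a *: x).
Proof.
move=> M0 aM /el_ballP h; apply/el_ballP; apply: le_lt_trans h.
apply: ae_le_prob; do ?exact: measurable_rnorm_tail.
near=> t; rewrite /rnorm_tail/=.
have -> : (rnorm (L0_cst P a *: x) t : R) = absr a * (rnorm x t : R).
  by near: t; exact: rnormZ_cst.
have r0 : 0 <= (rnorm x t : R).
  have <- : (0 : L0 P RealScalars) t = 0 by near: t; exact: L00E.
  by near: t; exact: rnorm_ge0.
move=> h1; rewrite ler_pdivrMr// mulrC; apply: le_trans h1 _.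
exact: ler_wpM2r.
Unshelve. all: by end_near. Qed.

Let el_scale_continuous :
  continuous (fun z : (scalars R k)^o * el_space E => z.1 *: z.2).
Proof.
move=> [a x] A /el_nbhsP[e [l [e0 l0 l1 h]]].
have l20 : 0 < l / 2 by rewrite divr_gt0.
have [n hn] := rnorm_tail_cvg0 (x : E) l20.
have n0 : 0 < n.+1%:R :> R by rewrite ltr0n.
pose M := absr a + 1.
pose r := Num.min 1 (e / 2 / n.+1%:R).
have a0 : 0 <= absr a by rewrite absrE sqrtr_ge0.
have M0 : 0 < M by rewrite /M; lra.
have r0 : 0 < r by rewrite lt_min ltr01 !divr_gt0.
exists ([set b : scalars R k | absr (b - a) < r],
        [set y : el_space E | el_ball (e / 2 / M) (l / 2) ((y : E) - x)]).
  split => /=; last by apply: el_nbhs_ball; rewrite ?divr_gt0.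
  apply/nbhs_ballP; exists (ofreal k r); first by rewrite /= -(ofreal0 k) ltr_ofreal.
  by move=> b; rewrite /ball/= distrC normr_absr ltr_ofreal.
move=> [b y] [/= hb hy]; apply: h.
have -> : ((b *: y : el_space E) : E) - (a *: x : el_space E)  =
    L0_cst P b *: ((y : E) - (x : E)) + L0_cst P (b - a) *: (x : E).
  rewrite scalerBr [in RHS](_ : L0_cst P (b - a) = L0_cst P b - L0_cst P a).
    by rewrite scalerBl addrA subrK.
  by apply/eqP; rewrite eq_sym subr_eq -L0_cstD subrK.
rewrite [e]splitr [l]splitr; apply: el_ballD.
  apply: el_ball_scale hy => //; rewrite /M.
  have := absr_triangle (b - a) a; rewrite subrK => /le_trans; apply.
  by rewrite addrC lerD2l; apply: ltW; apply: lt_le_trans hb _; rewrite ge_min lexx.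
apply: (@el_ball_scale _ (e / 2 / n.+1%:R)) => //.
- by rewrite !divr_gt0.
- by apply: ltW; apply: lt_le_trans hb _; rewrite ge_min lexx orbT.
rewrite invf_div mulrCA divff ?mulr1; last by rewrite mulf_neq0// ?gt_eqF// invr_eq0.
exact/el_ballP.
Qed.

HB.instance Definition _ :=
  TopologicalNmodule_isTopologicalLmodule.Build (scalars R k) (el_space E)
    el_scale_continuous.

Lemma el_hausdorff : hausdorff_space (el_space E).
Proof.
move=> x y xy.
have h (eps lam : R) : 0 < eps -> 0 < lam -> el_ball eps lam ((x : E) - y).
  move=> e0 l0; have e20 : 0 < eps / 2 by rewrite divr_gt0.
  have l20 : 0 < lam / 2 by rewrite divr_gt0.
  have [z [/= xz yz]] := xy _ _ (el_nbhs_ball x e20 l20) (el_nbhs_ball y e20 l20).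
  rewrite [eps]splitr [lam]splitr -(subrK (z : E) x) -addrA; apply: el_ballD => //.
  by rewrite -opprB el_ballN.
have {}h (n : nat) : P.-negligible (rnorm_tail n.+1%:R^-1 ((x : E) - y)).
  apply/negligibleP; first exact: measurable_rnorm_tail.
  apply/eqP; rewrite eq_le measure_ge0 andbT; apply/lee_addgt0Pr => lam l0.
  by rewrite add0e; apply/ltW/el_ballP/h => //; rewrite invr_gt0.
apply/eqP; rewrite -subr_eq0; apply/eqP; apply: (@rnorm0_eq0 _ _ _ _ _ E).
apply/L0_eqP.
have hN : P.-negligible (\bigcup_n rnorm_tail n.+1%:R^-1 ((x : E) - y)).
  exact: negligible_bigcup.
have hN' : \forall t \ae P, ~ (\bigcup_n rnorm_tail n.+1%:R^-1 ((x : E) - y)) t.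
  by apply: negligibleS hN => t /= /contrapT.
near=> t.
have r0 : 0 <= (rnorm ((x : E) - y) t : R).
  have <- : (0 : L0 P RealScalars) t = 0 by near: t; exact: L00E.
  by near: t; exact: rnorm_ge0.
rewrite (near (L00E P RealScalars) t)//; apply/eqP; rewrite eq_le r0 andbT.
rewrite leNgt; apply/negP => r1.
have : ~ (\bigcup_n rnorm_tail n.+1%:R^-1 ((x : E) - y)) t by near: t.
apply; have := near_infty_natSinv_lt (PosNum r1).
case=> N _ /(_ N (leqnn _))/= NE; exists N => //; exact: ltW.
Unshelve. all: by end_near. Qed.

End el_topology.


Definition uniform_complete (U : uniformType) : Prop :=
  forall F : set_system U, ProperFilter F -> cauchy F -> exists x : U, F --> x.

(* The notion is meant for Hausdorff spaces; el_space E is one by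
   el_hausdorff. Members of the families are closed in the whole space. *)
Definition convexly_compact (K : numFieldType) (V : topologicalLmodType K)
    (C : set V) : Prop :=
  [/\ C !=set0, convex_set (C : set (convex_lmodType V)) &
    forall (I : choiceType) (D : set I) (f : I -> set V),
      (forall i, D i -> [/\ closed (f i),
        convex_set (f i : set (convex_lmodType V)) & f i `<=` C]) ->
      finI D f -> \bigcap_(i in D) f i !=set0].

Section L0_convexity.
Context d (T : measurableType d) (R : realType) (P : probability T R).
Context (k : scalar_field) (E : rnModType P k).

Definition el_complete : Prop := uniform_complete (el_space E).

Definition el_closed (G : set E) : Prop := closed (G : set (el_space E)).

Definition L0_convex (G : set E) : Prop :=
  forall (x y : E) (xi : L0 P RealScalars), G x -> G y ->
    L0_le 0 xi -> L0_le xi 1 ->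
    G (L0_ofreal k xi *: x + (1 - L0_ofreal k xi) *: y).

Definition L0_convexly_compact (G : set E) : Prop :=
  [/\ el_closed G, L0_convex G &
    forall (I : choiceType) (D : set I) (f : I -> set E),
      (forall i, D i -> [/\ el_closed (f i), L0_convex (f i) & f i `<=` G]) ->
      finI D f -> \bigcap_(i in D) f i !=set0].

End L0_convexity.

Arguments el_complete {d T R P k} E.

(* Main.v *)
Require Import Defs.
From HB Require Import structures.
From mathcomp Require Import all_boot all_order all_algebra.
From mathcomp Require Import lra ring.
From mathcomp Require Import all_classical all_reals all_analysis.
From mathcomp Require Import measurable_realfun.

(* A closed L0-convex set is convex in the ordinary sense, so convex compactness
   trivially implies L0-convex compactness. For the converse, let G be
   L0-convexly compact.

   G is a.s. bounded. Suppose 0 is in G and G is unbounded on every non-null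
   part of B. Then some x in G stays far, on B, from - G / 2: otherwise
   x = b1 - y1 / 2 = b1 - b2 / 2 + y2 / 4 = ... with uniformly bounded b's, and
   by completeness G would be bounded. Iterating, one finds S_n, a sum of x_i / 3^i
   (i <= n), such that the decreasing sets S_n + 3^-n (G / 2) leave every ball;
   a common point is impossible. So, for some weight w > 0, E[w |y|] is a norm
   which on G induces the (epsilon, lambda)-topology.

   Let U be an ultrafilter containing a family of closed convex subsets of G with
   the finite intersection property. To a linear functional f dominated by this
   norm attach nu_f(A) = lim_U f(1_A y). The set H_f of the z in G with
   f(1_A z) = nu_f(A) for all events A is closed and L0-convex. For finitely many
   f's, a Hilbert space argument gives y_n in G with f(1_A y_n) -> nu_f(A), the
   error being at most th_n(A) for a superadditive set function th_n whose total
   mass tends to 0; the points of G whose errors are at most th_n form closed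
   L0-convex sets, which therefore have a common point, and it lies in the
   chosen H_f's. Hence all the H_f's have a common point x. If x were not in a
   member C of the family, Hahn-Banach would give f with f >= f(x) + delta on C,
   contradicting f(x) = nu_f(Omega) = lim_U f. *)

Set Implicit Arguments.
Unset Strict Implicit.
Unset Printing Implicit Defensive.
Import Order.TTheory GRing.Theory Num.Theory.
Import numFieldTopology.Exports numFieldNormedType.Exports.
Local Open Scope classical_set_scope.
Local Open Scope ring_scope.

(** * Events, real scalars and indicators in L0 *)

Section prob.
Context d (T : measurableType d) (R : realType) (P : probability T R).
Implicit Types A B : set T.

Definition pr (A : set T) : R := fine (P A).

Lemma prE A : measurable A -> P A = (pr A)%:E.
Proof. by move=> mA; rewrite /pr fineK// fin_num_measure. Qed.

Lemma pr_ge0 A : 0 <= pr A.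
Proof. exact/fine_ge0. Qed.

Lemma pr_setT : pr setT = 1.
Proof. by rewrite /pr probability_setT. Qed.

Lemma pr_set0 : pr set0 = 0.
Proof. by rewrite /pr measure0. Qed.

Lemma pr_split A B : measurable A -> measurable B ->
  pr A = pr (A `&` B) + pr (A `\` B).
Proof.
move=> mA mB; apply: EFin_inj; rewrite EFinD -!prE//.
- by rewrite addeC; exact: measureDI.
- exact: measurableD.
- exact: measurableI.
Qed.

Lemma pr_ae_le A B : measurable A -> measurable B ->
  (\forall t \ae P, A t -> B t) -> pr A <= pr B.
Proof. by move=> mA mB AB; rewrite -lee_fin -!prE//; exact: ae_le_prob. Qed.

Lemma pr_le A B : measurable A -> measurable B -> A `<=` B -> pr A <= pr B.
Proof. by move=> mA mB AB; apply: pr_ae_le => //; apply: aeW => t; exact: AB. Qed.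

Lemma pr_le1 A : measurable A -> pr A <= 1.
Proof. by move=> mA; rewrite -pr_setT; apply: pr_le. Qed.

Lemma prU_le A B : measurable A -> measurable B ->
  pr (A `|` B) <= pr A + pr B.
Proof.
move=> mA mB; rewrite -lee_fin EFinD -!prE//; last exact: measurableU.
exact: measureU2.
Qed.

Lemma pr_cvg0 (F : nat -> set T) : (forall n, measurable (F n)) ->
  (forall m n, (m <= n)%N -> F n `<=` F m) -> pr (\bigcap_n F n) = 0 ->
  forall e, 0 < e -> exists n, pr (F n) < e.
Proof.
move=> mF dF F0 e e0.
have mI : measurable (\bigcap_n F n) by exact: bigcapT_measurable.
have : P \o F @ \oo --> P (\bigcap_n F n).
  apply: nonincreasing_cvg_mu => //.
  - by apply: le_lt_trans (probability_le1 _ _) _ => //; rewrite ltry.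
  - by move=> m n mn; apply/subsetPset; exact: dF.
rewrite prE// F0 => h.
have : \forall n \near \oo, (P (F n) < e%:E)%E.
  apply: (h [set y | (y < e%:E)%E]); apply: open_nbhs_nbhs; split => /=.
    exact: open_ereal_lt_ereal.
  by rewrite lte_fin.
by case=> n _ /(_ n (leqnn n)); rewrite /= prE// lte_fin; exists n.
Qed.

Lemma pr_ae0 A : measurable A -> pr A = 0 -> \forall t \ae P, ~ A t.
Proof.
move=> mA A0; exists A; split => //; first by rewrite prE// A0.
by move=> t /= /contrapT.
Qed.

Lemma ae_pr0 A : measurable A -> (\forall t \ae P, ~ A t) -> pr A = 0.
Proof.
move=> mA A0; apply/eqP; rewrite eq_le pr_ge0 andbT -pr_set0.
by apply: pr_ae_le.
Qed.

End prob.

Section L0_lift.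
Context d (T : measurableType d) (R : realType) (P : probability T R).
Context (k : scalar_field).
Implicit Types f g : T -> R.

(** The value 0 at a nonmeasurable [f] makes this total, so that [f] can be rewritten inside
    [L0_lift k f] without carrying a measurability proof. *)
Definition L0_lift f : L0 P k :=
  if pselect (measurable_fun setT f) is left mf
  then L0_class P (measurable_ofreal (k := k) mf) else 0.

Lemma L0_liftE f : measurable_fun setT f ->
  \forall t \ae P, L0_lift f t = ofreal k (f t).
Proof. by move=> mf; rewrite /L0_lift; case: pselect => // ?; exact: L0_classE. Qed.

Lemma ofrealD (a b : R) : ofreal k (a + b) = ofreal k a + ofreal k b.
Proof. by apply: scalar_eqP; rewrite ?(reD, imD, re_ofreal, im_ofreal)// addr0. Qed.

Lemma ofrealM (a b : R) : ofreal k (a * b) = ofreal k a * ofreal k b.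
Proof.
apply: scalar_eqP; rewrite ?(reM, imM, re_ofreal, im_ofreal).
  by rewrite mulr0 subr0.
by rewrite mulr0 mul0r addr0.
Qed.

Lemma absr_ofreal (a : R) : absr (ofreal k a) = `|a|.
Proof. by rewrite absrE re_ofreal im_ofreal expr0n/= addr0 sqrtr_sqr. Qed.

Lemma L0_liftD f g : measurable_fun setT f -> measurable_fun setT g ->
  L0_lift (fun t => f t + g t) = L0_lift f + L0_lift g.
Proof.
move=> mf mg; apply/L0_eqP; have mfg := measurable_funD mf mg.
apply: filterS2 (filterI (L0_liftE mf) (L0_liftE mg))
  (filterI (L0_liftE mfg) (L0DE (L0_lift f) (L0_lift g))) => t [hf hg] [-> ->].
by rewrite hf hg ofrealD.
Qed.

Lemma L0_liftM f g : measurable_fun setT f -> measurable_fun setT g ->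
  L0_lift (fun t => f t * g t) = L0_lift f * L0_lift g.
Proof.
move=> mf mg; apply/L0_eqP; have mfg := measurable_funM mf mg.
apply: filterS2 (filterI (L0_liftE mf) (L0_liftE mg))
  (filterI (L0_liftE mfg) (L0ME (L0_lift f) (L0_lift g))) => t [hf hg] [-> ->].
by rewrite hf hg ofrealM.
Qed.

Lemma L0_lift_ae f g : measurable_fun setT f -> measurable_fun setT g ->
  (\forall t \ae P, f t = g t) -> L0_lift f = L0_lift g.
Proof.
move=> mf mg; move: (L0_liftE mf) (L0_liftE mg) => hf hg h; apply/L0_eqP.
by move: hf hg h; apply: filterS3 => t -> -> ->.
Qed.

Lemma L0_ofreal_lift (xi : L0 P RealScalars) :
  L0_ofreal k xi = L0_lift (xi : T -> R).
Proof.
apply/L0_eqP; move: (L0_liftE (measurable_L0_real xi)) (L0_ofrealE k xi).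
by apply: filterS2 => t -> ->.
Qed.

Definition L0_real (c : R) : L0 P k := L0_cst P (ofreal k c).

Lemma L0_real_lift c : L0_real c = L0_lift (cst c).
Proof.
apply/L0_eqP; move: (L0_cstE P (ofreal k c)) (L0_liftE (measurable_cst c)).
by apply: filterS2 => t -> ->.
Qed.

Lemma L0_realD a b : L0_real (a + b) = L0_real a + L0_real b.
Proof. by rewrite /L0_real ofrealD L0_cstD. Qed.
Lemma L0_realM a b : L0_real (a * b) = L0_real a * L0_real b.
Proof. by rewrite /L0_real ofrealM L0_cstM. Qed.
Lemma L0_real1 : L0_real 1 = 1.
Proof. by rewrite /L0_real ofreal1. Qed.
Lemma L0_real0 : L0_real 0 = 0.
Proof. by rewrite /L0_real ofreal0. Qed.
Lemma L0_realN a : L0_real (- a) = - L0_real a.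
Proof. by apply/eqP; rewrite -addr_eq0 -L0_realD addNr L0_real0. Qed.
Lemma L0_realB a b : L0_real (a - b) = L0_real a - L0_real b.
Proof. by rewrite L0_realD L0_realN. Qed.

Definition L0_ind (A : set T) : L0 P k := L0_lift (\1_A).

Lemma L0_indT : L0_ind setT = 1.
Proof. by rewrite -L0_real1 L0_real_lift /L0_ind indicT. Qed.

Lemma L0_ind0 : L0_ind set0 = 0.
Proof. by rewrite -L0_real0 L0_real_lift /L0_ind indic0. Qed.

Lemma L0_indI A B : measurable A -> measurable B -> L0_ind (A `&` B) = L0_ind A * L0_ind B.
Proof. by move=> mA mB; rewrite /L0_ind indicI L0_liftM. Qed.

Lemma L0_ind_split A B : measurable A -> measurable B ->
  L0_ind A = L0_ind (A `&` B) + L0_ind (A `\` B).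
Proof.
move=> mA mB; rewrite /L0_ind -L0_liftD; last 2 first.
- by apply: measurable_indic; exact: measurableI.
- by apply: measurable_indic; exact: measurableD.
congr L0_lift; apply/funext => t; rewrite !indicE in_setI in_setD.
by case: (t \in A); case: (t \in B); rewrite /= ?addr0 ?add0r.
Qed.

Lemma L0_indC A : measurable A -> L0_ind (~` A) = 1 - L0_ind A.
Proof.
by move=> mA; rewrite -L0_indT (L0_ind_split measurableT mA) setTI setTD addrAC subrr add0r.
Qed.

End L0_lift.
Arguments L0_real {d T R P} k c.
Arguments L0_ind {d T R P} k A.
Arguments L0_lift {d T R P} k f.

(** * Almost sure properties of the random norm *)

Section rn.
Context d (T : measurableType d) (R : realType) (P : probability T R).
Context (k : scalar_field) (E : rnModType P k).
Implicit Types (x y z : E) (G : set E).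

(** Typing the representative as [T -> R] instead of [T -> scalars R RealScalars] gives access to
    the order and measurability lemmas for real functions. *)
Definition rn (x : E) : T -> R := rnorm x.

Lemma measurable_rn x : measurable_fun setT (rn x).
Proof. exact: measurable_L0_real. Qed.

Lemma rn_ge0 x : \forall t \ae P, 0 <= rn x t.
Proof.
move: (rnorm_ge0 x) (L00E P RealScalars).
by apply: filterS2 => t + h; rewrite h.
Qed.

Lemma ler_rnD x y : \forall t \ae P, rn (x + y) t <= rn x t + rn y t.
Proof.
move: (ler_rnormD x y) (L0DE (rnorm x) (rnorm y)).
by apply: filterS2 => t + h; rewrite h.
Qed.

Lemma rn_lift f x : measurable_fun setT f ->
  \forall t \ae P, rn (L0_lift k f *: x) t = `|f t| * rn x t.
Proof.
move=> mf; rewrite /rn rnormZ.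
move: (L0ME (L0_abs (L0_lift k f : L0 P k)) (rnorm x)) (L0_absE (L0_lift k f : L0 P k))
  (L0_liftE P k mf).
by apply: filterS3 => t -> -> ->; rewrite absr_ofreal.
Qed.

Lemma rn_rr c x : \forall t \ae P, rn (L0_real k c *: x) t = `|c| * rn x t.
Proof. by rewrite L0_real_lift; exact: rn_lift. Qed.

Lemma rn_ind A x : measurable A ->
  \forall t \ae P, rn (L0_ind k A *: x) t = \1_A t * rn x t.
Proof.
move=> mA; move: (rn_lift x (measurable_indic (R := R) mA)).
by apply: filterS => t ->; rewrite ger0_norm.
Qed.

Lemma rnN x : rn (- x) = rn x.
Proof. by rewrite /rn rnormN. Qed.

Lemma rnB_sym x y : rn (x - y) = rn (y - x).
Proof. by rewrite -opprB rnN. Qed.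

Lemma rn0 : \forall t \ae P, rn 0 t = 0.
Proof. by move: (L00E P RealScalars); apply: filterS => t; rewrite /rn rnorm0. Qed.

Lemma rn_eq0 x : (\forall t \ae P, rn x t <= 0) -> x = 0.
Proof.
move=> h; apply: (@rnorm0_eq0 _ _ _ _ _ E); apply/L0_eqP.
move: h (rn_ge0 x) (L00E P RealScalars); apply: filterS3 => t h1 h2 ->.
by apply/eqP; rewrite eq_le h1.
Qed.

Lemma el_ballE eps lam x : el_ball eps lam x <-> pr P (rnorm_tail eps x) < lam.
Proof. by rewrite el_ballP prE ?lte_fin//; exact: measurable_rnorm_tail. Qed.

Lemma el_ball_ae eps lam (A : set T) x : measurable A -> pr P A < lam ->
  (\forall t \ae P, ~ A t -> rn x t < eps) -> el_ball eps lam x.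
Proof.
move=> mA Al h; apply/el_ballE; apply: le_lt_trans Al.
apply: pr_ae_le => //; first exact: measurable_rnorm_tail.
apply: filterS h => t h; rewrite /rnorm_tail/= => e; apply: contrapT => /h.
by rewrite ltNge e.
Qed.

Lemma el_closedP G : el_closed G <-> forall x,
  (forall eps lam : R, 0 < eps -> 0 < lam ->
     exists2 y, G y & el_ball eps lam (y - x)) -> G x.
Proof.
split=> cG x h.
  apply: cG => B /el_nbhsP[e [l [e0 l0 l1 hB]]].
  by have [y Gy yx] := h _ _ e0 l0; exists y; split => //; exact: hB.
apply: cG => e l e0 l0.
have [y [Gy /= yx]] := h _ (el_nbhs_ball x e0 l0).
by exists y.
Qed.

Definition rconvex G := forall x y (c : R), 0 <= c -> c <= 1 -> G x -> G y ->
  G (L0_real k c *: x + L0_real k (1 - c) *: y).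

(** The case of L0-convexity in which the coefficient is an indicator. For closed sets, this and
    [rconvex] give back all of L0-convexity, see [closed_gluing_L0_convex]. *)
Definition gluing G := forall x y A, measurable A -> G x -> G y ->
  G (L0_ind k A *: x + L0_ind k (~` A) *: y).

Lemma L0_convex_lift G x y (f : T -> R) : L0_convex G -> measurable_fun setT f ->
  (forall t, 0 <= f t <= 1) -> G x -> G y ->
  G (L0_lift k f *: x + (1 - L0_lift k f) *: y).
Proof.
move=> cG mf f01 Gx Gy.
pose xi : L0 P RealScalars := L0_lift RealScalars f.
have xiE : \forall t \ae P, xi t = f t :> R.
  by apply: filterS (L0_liftE P RealScalars mf) => t.
have -> : L0_lift k f = L0_ofreal k xi.
  apply/L0_eqP; move: (L0_ofrealE k xi) xiE (L0_liftE P k mf).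
  by apply: filterS3 => t -> -> ->.
apply: cG => //.
  move: xiE (L00E P RealScalars).
  by apply: filterS2 => t -> ->; have /andP[] := f01 t.
move: xiE (L01E P RealScalars).
by apply: filterS2 => t -> ->; have /andP[] := f01 t.
Qed.

Lemma L0_convex_rconvex G : L0_convex G -> rconvex G.
Proof.
move=> cG x y c c0 c1 Gx Gy; rewrite L0_realB L0_real1 L0_real_lift.
by apply: L0_convex_lift => // t; rewrite c0.
Qed.

Lemma L0_convex_gluing G : L0_convex G -> gluing G.
Proof.
move=> cG x y A mA Gx Gy; rewrite L0_indC//.
by apply: L0_convex_lift => // t; rewrite indicE; case: (_ \in _); rewrite /= lexx ler01.
Qed.

End rn.

(** * Ordinary convexity, gluing and L0-convexity *)

Section convexity.
Context d (T : measurableType d) (R : realType) (P : probability T R).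
Context (k : scalar_field) (E : rnModType P k).
Implicit Types (x y z : E) (G : set E).

Lemma combB (a b : L0 P k) x y :
  (a *: x + (1 - a) *: y) - (b *: x + (1 - b) *: y) = (a - b) *: (x - y).
Proof.
rewrite !scalerBl !scale1r scalerBr scalerBr !opprD !opprK.
rewrite [LHS](AC ((1*2)*(1*2)) (((1*3)*(4*6))*(2*5))) /= subrr addr0.
by [].
Qed.

(* Binary expansion of f: f = (1_{f >= 1/2} + f') / 2 with f' in [0, 1] again, where
   indicators are handled by gluing and the halves by convexity. *)
Lemma dyadic_mix G x y (n : nat) (f : T -> R) : rconvex G -> gluing G ->
  G x -> G y -> measurable_fun setT f -> (forall t, 0 <= f t <= 1) ->
  exists g : T -> R, [/\ measurable_fun setT g,
    forall t, `|g t - f t| <= 2^-1 ^+ n &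
    G (L0_lift k g *: x + (1 - L0_lift k g) *: y)].
Proof.
move=> cG gG Gx Gy; elim: n f => [f mf f01|n ih f mf f01].
  (* At n = 0 the tolerance is 1, so the mixture may be [x] itself. *)
  exists (cst 1); split => //.
    by move=> t /=; have /andP[] := f01 t; rewrite expr0 ler_norml; lra.
  by rewrite -L0_real_lift L0_real1 subrr scale1r scale0r addr0.
pose B := f @^-1` `[2^-1, +oo[%classic.
have mB : measurable B by rewrite -[B]setTI; exact: mf.
have Bt t : (\1_B t : R) = (2^-1 <= f t)%R%:R.
  rewrite indicE; congr (nat_of_bool _)%:R; apply/idP/idP => [/set_mem|h].
    by rewrite /B/= in_itv/= andbT.
  by apply/mem_set; rewrite /B/= in_itv/= andbT.
have [] := ih (fun t => 2 * f t - \1_B t).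
- by apply: measurable_funB => //; exact: measurable_funM.
- move=> t; rewrite Bt; have /andP[h1 h2] := f01 t.
  by case: (lerP 2^-1 (f t)) => h /=; apply/andP; split; lra.
move=> g [mg gf Gg].
have mBi : measurable_fun setT (\1_B : T -> R) by exact: measurable_indic.
have mBg : measurable_fun setT (fun t => \1_B t + g t) by exact: measurable_funD.
exists (fun t => 2^-1 * (\1_B t + g t)); split.
- exact: measurable_funM.
- move=> t; have := gf t.
  rewrite exprS !ler_norml => /andP[h1 h2].
  by apply/andP; split; lra.
- rewrite L0_liftM// -L0_real_lift L0_liftD// -/(L0_ind k B).
  have := cG _ _ 2^-1 _ _ (gG x y B mB Gx Gy) Gg.
  rewrite [X in L0_real k X *: (L0_lift _ _ *: _ + _)](_ : _ = 2^-1); last by lra.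
  have h2 : 0 <= 2^-1 :> R by lra.
  have h3 : 2^-1 <= 1 :> R by lra.
  move=> /(_ h2 h3); congr G.
  rewrite -scalerDr L0_indC//.
  rewrite [in LHS]addrACA -!scalerDl scalerDr !scalerA; congr (_ + _ *: _).
  rewrite addrACA -opprD mulrDr mulrN; congr (_ - _).
  by rewrite mulrDr mulr1 -L0_realD -[RHS](L0_real1 P k); congr L0_real; lra.
Qed.

(** The mixtures of [dyadic_mix] have coefficients uniformly close to [xi], and |x - y| is bounded
    off an event of small probability; hence they converge to the mixture with coefficient [xi]. *)
Lemma closed_gluing_L0_convex G : el_closed G -> rconvex G -> gluing G ->
  L0_convex G.
Proof.
move=> clG cG gG x y xi Gx Gy xi0 xi1.
(* [xi] lies in [0, 1] only a.e.; clipping a representative gives the bounds at every point, as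
   [dyadic_mix] requires. *)
pose f t := Num.min 1 (Num.max 0 (xi t : R)).
have mf : measurable_fun setT f.
  apply: measurable_minr => //; apply: measurable_maxr => //.
  exact: measurable_L0_real.
have f01 t : 0 <= f t <= 1.
  by rewrite /f le_min ler01 le_max lexx ge_min lexx.
rewrite L0_ofreal_lift (@L0_lift_ae _ _ _ P k _ f)//; last 2 first.
- exact: measurable_L0_real.
- apply: filterS2 (filterI xi0 xi1) (filterI (L00E P RealScalars) (L01E P RealScalars)).
  by move=> t [+ +] [h0 h1]; rewrite h0 h1 /f => h2 h3; rewrite max_r// min_r.
apply: (el_closedP G).1 clG _ _ => e l e0 l0.
have [N hN] := rnorm_tail_cvg0 (x - y) l0.
have [n hn] : exists n, 2^-1 ^+ n * N.+1%:R < e :> R.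
  have : (fun n => 2^-1 ^+ n : R) @ \oo --> (0 : R).
    by apply: cvg_expr; rewrite ger0_norm; lra.
  move=> /cvgrPdist_lt/(_ (e / N.+1%:R)); rewrite divr_gt0// => /(_ isT)[n _ hn].
  exists n; rewrite -ltr_pdivlMr//.
  by have := hn n (leqnn n); rewrite /= sub0r normrN ger0_norm// exprn_ge0//; lra.
have [g [mg gf Gg]] := dyadic_mix n cG gG Gx Gy mf f01.
exists (L0_lift k g *: x + (1 - L0_lift k g) *: y) => //.
have -> : (L0_lift k g *: x + (1 - L0_lift k g) *: y) - (L0_lift k f *: x + (1 - L0_lift k f) *: y) =
    L0_lift k (fun t => g t - f t) *: (x - y).
  rewrite combB; congr (_ *: _).
  rewrite [RHS](_ : _ = L0_lift k (fun t => g t + (- 1) * f t)); last first.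
    by congr L0_lift; apply/funext => t; rewrite mulN1r.
  rewrite L0_liftD//; last exact: measurable_funM.
  by rewrite L0_liftM// -L0_real_lift L0_realN L0_real1 mulN1r.
apply: (@el_ball_ae _ _ _ _ _ _ e l (rnorm_tail N.+1%:R (x - y))).
- exact: measurable_rnorm_tail.
- by rewrite -lte_fin -prE//; exact: measurable_rnorm_tail.
apply: filterS2 (rn_lift (x - y) (measurable_funB mg mf)) (rn_ge0 (x - y)).
move=> t -> h0 /negP; rewrite -ltNge => h.
apply: le_lt_trans hn; apply: ler_pM => //; [exact: gf|exact: ltW].
Qed.

Lemma closed_affine_preimage G (c : R) a : el_closed G ->
  el_closed [set z | G (L0_real k c *: (z - a))].
Proof.
move=> cG; apply/el_closedP => x h; apply: (el_closedP G).1 cG _ _ => e l e0 l0.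
have M0 : 0 < `|c| + 1 by rewrite ltr_wpDl.
have [y Gy yx] := h (e / (`|c| + 1)) l (divr_gt0 e0 M0) l0.
exists (L0_real k c *: (y - a)) => //.
rewrite -scalerBr opprB addrA subrK; apply: el_ball_scale yx => //.
by rewrite absr_ofreal lerDl.
Qed.

Lemma L0_convex_affine_preimage G (c : R) a : L0_convex G ->
  L0_convex [set z | G (L0_real k c *: (z - a))].
Proof.
move=> cG x y xi Gx Gy x0 x1 /=.
set b := L0_ofreal k xi.
suff -> : L0_real k c *: (b *: x + (1 - b) *: y - a) =
    b *: (L0_real k c *: (x - a)) + (1 - b) *: (L0_real k c *: (y - a)) by exact: cG.
rewrite !scalerA ![_ * L0_real k c]mulrC -!scalerA -scalerDr; congr (_ *: _).
rewrite !scalerBr addrACA -opprD; congr (_ - _).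
by rewrite -scalerDl addrC subrK scale1r.
Qed.

Lemma le_ofreal (u v : R) : (ofreal k u <= ofreal k v) = (u <= v).
Proof.
rewrite !le_eqVlt ltr_ofreal; congr (_ || _).
by apply/eqP/eqP => [/(congr1 re)|->//]; rewrite !re_ofreal.
Qed.

Lemma L0_cst_onem (a : scalars R k) : L0_cst P (1 - a) = 1 - L0_cst P a.
Proof. by apply/eqP; rewrite eq_sym subr_eq -L0_cstD subrK. Qed.

(** Also when K is complex, a coefficient of [convex_set] lies between 0 and 1 and is therefore
    real, by [ge0_ofreal]. *)
Lemma rconvex_convex_set G : rconvex G ->
  convex_set (G : set (convex_lmodType (el_space E))).
Proof.
move=> cG; move=> x y l /set_mem Gx /set_mem Gy; apply/mem_set.
have l0 : 0 <= l%:num by exact: ge0.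
have l1 : l%:num <= 1 by exact: le1.
have := cG x y (re l%:num) _ _ Gx Gy; rewrite L0_realB L0_real1 /L0_real -ge0_ofreal//.
have e1 : 1 = ofreal k 1 :> scalars R k by rewrite ofreal1.
have h0 : 0 <= re l%:num.
  by move: (l0); rewrite {1}(ge0_ofreal l0) -(ofreal0 k) le_ofreal.
have h1 : re l%:num <= 1.
  by move: (l1); rewrite {1}(ge0_ofreal l0) e1 le_ofreal.
by move=> /(_ h0 h1); rewrite -L0_cst_onem.
Qed.

Lemma convex_set_rconvex G :
  convex_set (G : set (convex_lmodType (el_space E))) -> rconvex G.
Proof.
move=> cG x y c c0 c1 Gx Gy.
have h0 : 0 <= ofreal k c by rewrite -(ofreal0 k) le_ofreal.
have h1 : ofreal k c <= 1 by rewrite -(ofreal1 k) le_ofreal.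
have := cG x y (Itv01 h0 h1) (mem_set Gx) (mem_set Gy).
move=> /set_mem; rewrite L0_realB L0_real1 -L0_cst_onem; exact.
Qed.


Lemma el_complete_cvg (u : nat -> E) : el_complete E ->
  (forall e l : R, 0 < e -> 0 < l -> exists N, forall m n, (N <= m)%N -> (N <= n)%N ->
     el_ball e l (u m - u n)) ->
  exists x, forall e l : R, 0 < e -> 0 < l ->
    exists N, forall n, (N <= n)%N -> el_ball e l (u n - x).
Proof.
move=> cE hu.
have [] := cE (fmap (u : nat -> el_space E) \oo) _.
  move=> A [e [l [e0 l0 _ hA]]]; have [N hN] := hu _ _ e0 l0.
  exists (u @` [set n | (N <= n)%N], u @` [set n | (N <= n)%N]) => /=.
    by split; exists N => // n /= Nn; exists n.
  by move=> [_ _] /= [[m Nm <-] [n Nn <-]]; apply: hA; exact: hN.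
move=> x ux; exists x => e l e0 l0.
by have [N _ hN] := ux _ (el_nbhs_ball x e0 l0); exists N => n /hN.
Qed.

End convexity.

(** * Boundedness of L0-convexly compact sets *)

Section exhaustion.
Context d (T : measurableType d) (R : realType) (P : probability T R).

(** Each event g + 1/(n+1) <= f has probability at most every l > 0, hence is null, and so is their
    union. *)
Lemma ae_le_eps (f g : T -> R) : measurable_fun setT f -> measurable_fun setT g ->
  (forall e l, 0 < e -> 0 < l -> exists2 A, measurable A & pr P A <= l /\
    \forall t \ae P, ~ A t -> f t < g t + e) ->
  \forall t \ae P, f t <= g t.
Proof.
move=> mf mg h.
pose B n := [set t | g t + n.+1%:R^-1 <= f t].
have mB n : measurable (B n).
  rewrite -[B n]setTI; apply: measurable_fun_le => //.
  exact: measurable_funD.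
have B0 n : pr P (B n) = 0.
  apply/eqP; rewrite eq_le pr_ge0 andbT; apply/ler_addgt0Pr => l l0; rewrite add0r.
  have [|A mA [Al hA]] := h n.+1%:R^-1 l _ l0; first by rewrite invr_gt0.
  apply: le_trans Al; apply: pr_ae_le => //; apply: filterS hA => t hA Bt.
  by apply: contrapT => /hA; rewrite ltNge => /negP; apply.
have hB : \forall t \ae P, forall n, ~ B n t.
  by apply/ae_foralln => n; exact: pr_ae0.
apply: filterS hB => t hB; rewrite leNgt; apply/negP => gf.
have := near_infty_natSinv_lt (PosNum (eqbRL (subr_gt0 _ _) gf)).
case=> N _ /(_ N (leqnn N)) /= hN.
by apply: (hB N); rewrite /B /= -lerBrDl; exact: ltW.
Qed.

(** The [S n] are increasing unions of members of [F] whose probabilities tend to the supremum over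
    [F]. As the union of [S n] with a further member is again in [F], that member can add only a
    vanishing amount. *)
Lemma exhaustion (F : set (set T)) : F set0 ->
  (forall A, F A -> measurable A) -> (forall A B, F A -> F B -> F (A `|` B)) ->
  exists S : nat -> set T, [/\ forall n, F (S n),
    forall n, S n `<=` S n.+1 &
    forall A, F A -> pr P (A `\` \bigcup_n S n) = 0].
Proof.
move=> F0 mF FU.
have hs : has_sup [set pr P A | A in F].
  split; first by exists (pr P set0), set0.
  by exists 1 => _ [A /mF mA <-]; exact: pr_le1.
have /choice[A hA] (n : nat) : exists A, F A /\ sup [set pr P A | A in F] - n.+1%:R^-1 < pr P A.
  have [|_ [A FA <-] h] := @sup_adherent _ _ n.+1%:R^-1 _ hs; first by rewrite invr_gt0.
  by exists A.
pose S := fix S n := if n is m.+1 then S m `|` A m.+1 else A 0%N.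
have FS n : F (S n) by elim: n => [|n ih] /=; [exact: (hA _).1|apply: FU => //; exact: (hA _).1].
have AS n : A n `<=` S n by case: n => //= n t; right.
exists S; split => //; first by move=> n t; left.
move=> B FB; have mB := mF _ FB.
have mU : measurable (\bigcup_n S n) by apply: bigcupT_measurable => n; exact: mF.
apply/eqP; rewrite eq_le pr_ge0 andbT; apply/ler_addgt0Pr => e e0; rewrite add0r.
have [n hn] : exists n : nat, n.+1%:R^-1 < e :> R.
  by have [N _ /(_ N (leqnn N))] := near_infty_natSinv_lt (PosNum e0); exists N.
have mS := mF _ (FS n); have mA := mF _ (hA n).1.
have h1 : pr P (B `\` \bigcup_n S n) <= pr P (B `\` S n).
  apply: pr_le; [exact: measurableD|exact: measurableD|].
  by move=> t [Bt nU]; split => // Snt; apply: nU; exists n.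
have h2 : pr P (B `|` S n) <= sup [set pr P A | A in F].
  by apply: ub_le_sup; [exact: hs.2|exists (B `|` S n) => //; exact: FU].
have := pr_split P (measurableU _ _ mB mS) mS.
have -> : (B `|` S n) `&` S n = S n.
  by apply/seteqP; split => [t []//|t St]; split => //; right.
have -> : (B `|` S n) `\` S n = B `\` S n by rewrite setDUl setDv setU0.
have := pr_le P mA mS (@AS n); have := (hA n).2.
move: h1 h2 hn; set c := sup _; set i := n.+1%:R^-1.
lra.
Qed.

Lemma pr_bigcup_approx (S : nat -> set T) e : (forall n, measurable (S n)) ->
  (forall n, S n `<=` S n.+1) -> 0 < e ->
  exists n, pr P (\bigcup_n S n `\` S n) < e.
Proof.
move=> mS incS e0.
have mU : measurable (\bigcup_n S n) by exact: bigcupT_measurable.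
apply: (@pr_cvg0 _ _ _ P (fun n => \bigcup_n S n `\` S n)) => //.
- by move=> n; exact: measurableD.
- move=> m n mn t [Ut Snt]; split => // Smt; apply: Snt.
  by elim: n mn => [|n ih]; [rewrite leqn0 => /eqP <-|rewrite leq_eqVlt => /predU1P[<-//|/ih/incS]].
- rewrite (_ : bigcap _ _ = set0) ?pr_set0//; apply/seteqP; split => // t h.
  by have [[n _ Snt] _] := h 0%N Logic.I; have [] := h n Logic.I.
Qed.

End exhaustion.

Section compact.
Context d (T : measurableType d) (R : realType) (P : probability T R).
Context (k : scalar_field) (E : rnModType P k).
Implicit Types (x y z : E) (G : set E).

Lemma rn_comb a x y (xi : L0 P RealScalars) : L0_le 0 xi -> L0_le xi 1 ->
  \forall t \ae P, 0 <= (xi t : R) <= 1 /\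
    rn (L0_ofreal k xi *: x + (1 - L0_ofreal k xi) *: y - a) t <=
    (xi t : R) * rn (x - a) t + (1 - (xi t : R)) * rn (y - a) t.
Proof.
move=> x0 x1; rewrite L0_ofreal_lift.
set b := L0_lift k _.
have mxi := measurable_L0_real xi.
have mxi1 : measurable_fun setT (fun t => 1 - (xi t : R)) by exact: measurable_funB.
have e1 : b *: x + (1 - b) *: y - a = b *: (x - a) + (1 - b) *: (y - a).
  by rewrite !scalerBr addrACA -opprD -scalerDl [b + _]addrC subrK scale1r.
have e2 : 1 - b = L0_lift k (fun t => 1 - (xi t : R)).
  rewrite [RHS](_ : _ = L0_lift k (fun t => cst 1 t + (- 1) * (xi t : R))); last first.
    by congr L0_lift; apply/funext => t; rewrite mulN1r.
  by rewrite L0_liftD//; [rewrite L0_liftM// -!L0_real_lift L0_realN L0_real1 mulN1r|exact: measurable_funM].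
rewrite e1 e2.
apply: filterS3 (ler_rnD (b *: (x - a)) (L0_lift k (fun t => 1 - (xi t : R)) *: (y - a)))
  (filterI (rn_lift (x - a) mxi) (rn_lift (y - a) mxi1))
  (filterI (filterI x0 x1) (filterI (L00E P RealScalars) (L01E P RealScalars))).
move=> t h3 [h4 h5] [[h6 h7] [h8 h9]].
move: h6 h7 h3; rewrite h8 h9 h4 h5 => h6 h7.
by rewrite !ger0_norm ?subr_ge0// => h; rewrite h6.
Qed.

Lemma el_closedI (A B : set E) : el_closed A -> el_closed B -> el_closed (A `&` B).
Proof. exact: closedI. Qed.

Lemma L0_convexI (A B : set E) : L0_convex A -> L0_convex B -> L0_convex (A `&` B).
Proof.
by move=> cA cB x y xi [Ax Bx] [Ay By] x0 x1; split; [exact: cA|exact: cB].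
Qed.

Lemma L0cc_nested G (D : nat -> set E) : L0_convexly_compact G ->
  (forall n, [/\ el_closed (D n), L0_convex (D n) & D n `<=` G]) ->
  (forall n, D n !=set0) -> (forall n, D n.+1 `<=` D n) ->
  exists x, forall n, D n x.
Proof.
move=> [_ _ ccG] hD D0 decD.
have [|x Dx] := ccG nat setT D (fun n _ => hD n); last by exists x => n; exact: Dx.
(* The sets decrease, so the one of largest index lies in all the others. *)
move=> J _; pose m := (\max_(i <- finmap.enum_fset J) i)%N.
have [x Dx] := D0 m; exists x => i /= iJ.
have : (i <= m)%N by exact: leq_bigmax_seq.
elim: m Dx => [|n ih] Dx; first by rewrite leqn0 => /eqP ->.
by rewrite leq_eqVlt => /predU1P[->//|]; apply: ih; exact: decD.
Qed.

(* The sets used here are the {z in G : b(z) <= - n |v|}, where b is the Busemann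
   function b(z) = lim_M |z - M v| - M |v| of the ray; as b >= - |.|, they have no
   common point unless v = 0. *)
Lemma L0cc_no_ray G v : L0_convexly_compact G ->
  (forall n : nat, G (L0_real k n%:R *: v)) -> v = 0.
Proof.
move=> ccG Gv.
pose b (M n : nat) (e : R) z t := rn (z - L0_real k M%:R *: v) t <= (M%:R - n%:R) * rn v t + e.
(* By the triangle inequality, |z - M v| - M |v| is nonincreasing in M. *)
have b_le (M N n : nat) e z : (M <= N)%N -> \forall t \ae P, b M n e z t -> b N n e z t.
  move=> MN.
  apply: filterS2 (ler_rnD (z - L0_real k M%:R *: v) (L0_real k (M%:R - N%:R) *: v))
    (rn_rr (M%:R - N%:R) v) => t h1 h2.
  move: h1; rewrite h2 L0_realB scalerBl addrA subrK distrC ger0_norm ?subr_ge0 ?ler_nat//.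
  by rewrite /b; lra.
(* The condition b(z) <= - n |v|, in the form of convergence in probability: a single [M] serves up
   to [e] and off an event of probability [l]. In this form it passes to limits in the topology. *)
pose D n := G `&` [set z | forall e l : R, 0 < e -> 0 < l -> exists M A,
   [/\ measurable A, pr P A <= l & \forall t \ae P, ~ A t -> b M n e z t]].
have [| | |x Dx] := @L0cc_nested G D ccG.
- move=> n; split.
  + apply: el_closedI; first by case: ccG.
    apply/el_closedP => x hx e l e0 l0.
    have e20 : 0 < e / 2 by rewrite divr_gt0.
    have l20 : 0 < l / 2 by rewrite divr_gt0.
    have [y hy /el_ballE yx] := hx _ _ e20 l20.
    have [M [A [mA Al hA]]] := hy _ _ e20 l20.
    have mt := measurable_rnorm_tail (e / 2) (y - x).
    exists M, (A `|` rnorm_tail (e / 2) (y - x)); split.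
    * exact: measurableU.
    * by apply: le_trans (prU_le P mA mt) _; rewrite [leRHS]splitr lerD// ltW.
    * apply: filterS2 hA (ler_rnD (x - y) (y - L0_real k M%:R *: v)) => t h1.
      rewrite addrA subrK rnB_sym => h2 /not_orP[/h1 + /negP].
      by rewrite /b -ltNge -/(rn _ _) => h3 h4; lra.
  + apply: L0_convexI; first by case: ccG.
    move=> x y xi hx hy x0 x1 e l e0 l0.
    have l20 : 0 < l / 2 by rewrite divr_gt0.
    have [M [A [mA Al hA]]] := hx _ _ e0 l20.
    have [N [B [mB Bl hB]]] := hy _ _ e0 l20.
    exists (maxn M N), (A `|` B); split.
    * exact: measurableU.
    * by apply: le_trans (prU_le P mA mB) _; rewrite [leRHS]splitr lerD.
    * apply: filterS3 (filterI hA hB) (rn_comb (L0_real k (maxn M N)%:R *: v) x y x0 x1)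
       (filterI (b_le M _ n e x (leq_maxl M N)) (b_le N _ n e y (leq_maxr M N))).
      move=> t [h1 h2] [/andP[h3 h4] h5] [h6 h7] /not_orP[/h1/h6 h8 /h2/h7 h9].
      apply: le_trans h5 _; move: h8 h9; rewrite /b.
      set c := (_ * rn v t + e); set p := rn (x - _) t; set q := rn (y - _) t => h8 h9.
      have h10 : 0 <= 1 - (xi t : R) by rewrite subr_ge0.
      have := ler_wpM2l h3 h8; have := ler_wpM2l h10 h9.
      lra.
  + by move=> z [].
- move=> n; exists (L0_real k n%:R *: v); split => // e l e0 l0; exists n, set0; split => //.
    by rewrite pr_set0 ltW.
  apply: filterS (rn0 E) => t h0 _; rewrite /b !subrr mul0r add0r h0; exact: ltW.
- move=> n z [Gz hz]; split => // e l e0 l0; have [M [A [mA Al hA]]] := hz _ _ e0 l0.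
  exists M, A; split => //; apply: filterS2 hA (rn_ge0 v) => t hA v0 /hA.
  rewrite /b => /le_trans; apply.
  by rewrite lerD2r ler_wpM2r// lerD2l lerN2 ler_nat.
have hx n : \forall t \ae P, n%:R * rn v t <= rn x t.
  apply: ae_le_eps; [|exact: measurable_rn|].
    by apply: measurable_funM => //; exact: measurable_rn.
  move=> e l e0 l0; have e20 : 0 < e / 2 by rewrite divr_gt0.
  have [_ /(_ _ _ e20 l0)[M [A [mA Al hA]]]] := Dx n.
  exists A => //; split => //.
  apply: filterS3 hA (ler_rnD x (L0_real k M%:R *: v - x)) (rn_rr M%:R v) => t h1.
  rewrite [X in rn X _ <= _ -> _]addrC subrK rnB_sym => h2 h3 /h1.
  by move: h2; rewrite h3 /b ger0_norm//; lra.
apply: rn_eq0.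
have {}hx : \forall t \ae P, forall n : nat, n%:R * rn v t <= rn x t.
  exact/ae_foralln.
apply: filterS hx => t h; rewrite leNgt; apply/negP => v0.
have := h (Num.truncn (rn x t / rn v t)).+1.
by rewrite -ler_pdivlMr// leNgt truncnS_gt.
Qed.

Lemma L0_ind_idem (A : set T) : measurable A -> L0_ind k A * L0_ind k A = L0_ind k A :> L0 P k.
Proof. by move=> mA; rewrite -L0_indI// setIid. Qed.

Lemma L0_indIC (A : set T) : measurable A -> L0_ind k A * L0_ind k (~` A) = 0 :> L0 P k.
Proof. by move=> mA; rewrite -L0_indI ?setICr ?L0_ind0//; exact: measurableC. Qed.

Lemma rn_local (A : set T) x y : measurable A -> L0_ind k A *: x = L0_ind k A *: y ->
  \forall t \ae P, A t -> rn x t = rn y t.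
Proof.
move=> mA xy; apply: filterS2 (rn_ind x mA) (rn_ind y mA) => t.
by rewrite xy => -> + At; rewrite indicE mem_set// !mul1r.
Qed.

Lemma rn_glue (A : set T) x y z : measurable A -> \forall t \ae P,
  (A t -> rn (L0_ind k A *: x + L0_ind k (~` A) *: y + z) t = rn (x + z) t) /\
  (~ A t -> rn (L0_ind k A *: x + L0_ind k (~` A) *: y + z) t = rn (y + z) t).
Proof.
move=> mA; have mC := measurableC mA.
have h1 : L0_ind k A *: (L0_ind k A *: x + L0_ind k (~` A) *: y + z) = L0_ind k A *: (x + z).
  by rewrite !scalerDr !scalerA L0_ind_idem// L0_indIC// scale0r addr0.
have h2 : L0_ind k (~` A) *: (L0_ind k A *: x + L0_ind k (~` A) *: y + z) = L0_ind k (~` A) *: (y + z).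
  by rewrite !scalerDr !scalerA L0_ind_idem// mulrC L0_indIC// scale0r add0r.
by apply: filterS2 (rn_local mA h1) (rn_local mC h2).
Qed.

Lemma pow2_lt (C e : R) : 0 <= C -> 0 < e -> exists n, C * 2^-1 ^+ n < e.
Proof.
move=> C0 e0.
have : (fun n => 2^-1 ^+ n : R) @ \oo --> (0 : R).
  by apply: cvg_expr; rewrite ger0_norm; lra.
have C1 : 0 < C + 1 by rewrite ltr_wpDl.
move=> /cvgrPdist_lt/(_ (e / (C + 1))); rewrite divr_gt0// => /(_ isT)[n _ hn].
exists n; have := hn n (leqnn n); rewrite /= sub0r normrN ger0_norm// ?exprn_ge0//.
rewrite ltr_pdivlMr// mulrC; apply: le_lt_trans.
by rewrite ler_wpM2r ?exprn_ge0// lerDl.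
Qed.

Lemma rconvex_scale G c x : rconvex G -> G 0 -> 0 <= c <= 1 -> G x -> G (L0_real k c *: x).
Proof.
move=> cG G0 /andP[c0 c1] Gx; have := cG _ _ _ c0 c1 Gx G0.
by rewrite scaler0 addr0.
Qed.

Lemma gluing_ind G (A : set T) x : gluing G -> G 0 -> measurable A -> G x -> G (L0_ind k A *: x).
Proof.
by move=> gG G0 mA Gx; have := gG _ _ _ mA Gx G0; rewrite scaler0 addr0.
Qed.

(* Iterating the hypothesis, y = b_1 - b_2 / 2 + b_3 / 4 - ... on A with b_i < M; the
   difference between y and the sum of the series lies in 2^-n G for all n. *)
Lemma absorbing_bound G (A : set T) (M : R) : el_complete E -> L0_convexly_compact G ->
  G 0 -> measurable A -> 0 <= M ->
  (forall x e, G x -> 0 < e -> exists2 y, G y &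
     pr P (A `&` [set t | M <= rn (x + L0_real k 2^-1 *: y) t]) <= e) ->
  forall y, G y -> \forall t \ae P, A t -> rn y t <= 2 * M.
Proof.
move=> cE ccG G0 mA M0 hG y Gy.
have [clG cG _] := ccG.
suff : \forall t \ae P, rn (L0_ind k A *: y) t <= cst (2 * M) t.
  apply: filterS2 (rn_ind y mA) => t -> + At.
  by rewrite indicE mem_set// mul1r.
apply: ae_le_eps => //; first exact: measurable_rn.
move=> e l e0 l0.
have l20 : 0 < l / 2 by rewrite divr_gt0.
have p2 n : 0 < 2^-1 ^+ n :> R by rewrite exprn_gt0// invr_gt0.
(* The first component is the step number: it makes the exceptional probabilities summable, with
   total at most l / 2. *)
have /choice[phi hphi] (p : nat * E) : exists z, G p.2 -> G z /\
    pr P (A `&` [set t | M <= rn (p.2 + L0_real k 2^-1 *: z) t]) <= l / 2 * 2^-1 ^+ p.1.+1.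
  have [Gp|nGp] := pselect (G p.2); last by exists 0.
  by have [z Gz hz] := hG _ _ Gp (mulr_gt0 l20 (p2 p.1.+1)); exists z.
pose kap := fix kap n := if n is m.+1 then phi (m, kap m) else y.
have Gkap n : G (kap n) by elim: n => //= n ih; exact: (hphi (n, kap n) ih).1.
pose B n := A `&` [set t | M <= rn (kap n + L0_real k 2^-1 *: kap n.+1) t].
have mB n : measurable (B n).
  apply: measurableI => //; rewrite -[X in measurable X]setTI.
  by apply: measurable_fun_le => //; exact: measurable_rn.
have prB n : pr P (B n) <= l / 2 * 2^-1 ^+ n.+1 by exact: (hphi (n, kap n) (Gkap n)).2.
(* These are the partial sums of the series: the increment at n is (-1/2)^n times kap n + kap (n+1)
   / 2 on [A], and off [B n] the latter is below [M] there. *)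
pose z n := L0_ind k A *: (y - L0_real k ((- 2^-1) ^+ n) *: kap n).
have step n : \forall t \ae P, ~ B n t -> rn (z n.+1 - z n) t <= M * 2^-1 ^+ n.
  have -> : z n.+1 - z n =
      L0_ind k A *: (L0_real k ((- 2^-1) ^+ n) *: (kap n + L0_real k 2^-1 *: kap n.+1)).
    rewrite /z -scalerBr; congr (_ *: _).
    rewrite opprB addrC addrA subrK.
    rewrite exprSr mulrN L0_realN L0_realM scaleNr opprK -scalerA -scalerDr.
    by [].
  apply: filterS3 (rn_ind (L0_real k ((- 2^-1) ^+ n) *: (kap n + L0_real k 2^-1 *: kap n.+1)) mA)
    (rn_rr ((- 2^-1) ^+ n) (kap n + L0_real k 2^-1 *: kap n.+1))
    (rn_ge0 (kap n + L0_real k 2^-1 *: kap n.+1)) => t -> ->.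
  set r := rn _ _ => r0 nB.
  rewrite normrX normrN ger0_norm; last lra.
  have [At|nAt] := pselect (A t); last first.
    by rewrite indicE memNset// mul0r mulr_ge0// ltW.
  rewrite indicE mem_set// mul1r mulrC ler_wpM2r ?ltW//.
  by rewrite ltNge; apply/negP => h; apply: nB.
pose V n := fix V m := if m is j.+1 then V j `|` B (n + j)%N else set0.
have mV n m : measurable (V n m) by elim: m => //= m ih; exact: measurableU.
have prV n m : pr P (V n m) <= l / 2 * (2^-1 ^+ n - 2^-1 ^+ (n + m)).
  elim: m => [|m ih] /=; first by rewrite pr_set0 addn0 subrr mulr0.
  apply: le_trans (prU_le P (mV _ _) (mB _)) _.
  apply: le_trans (lerD ih (prB _)) _.
  by rewrite addnS exprS; lra.
have zV n m : \forall t \ae P, ~ V n m t ->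
    rn (z (n + m)%N - z n) t <= 2 * M * (2^-1 ^+ n - 2^-1 ^+ (n + m)).
  elim: m => [|m ih] /=.
    by apply: filterS (rn0 E) => t h _; rewrite addn0 !subrr mulr0 h.
  apply: filterS3 ih (step (n + m)%N)
    (ler_rnD (z (n + m).+1 - z (n + m)%N) (z (n + m)%N - z n)) => t h1 h2 h3.
  move=> /not_orP[/h1 h4 /h2 h5]; rewrite addnS; move: h3; rewrite addrA subrK exprS.
  by lra.
have zV' n m e' : 2 * M * 2^-1 ^+ n < e' -> \forall t \ae P, ~ V n m t ->
    rn (z (n + m)%N - z n) t < e'.
  move=> h; apply: filterS (zV n m) => t h1 /h1 h2; apply: le_lt_trans h2 _.
  apply: le_lt_trans h; rewrite ler_wpM2l ?mulr_ge0// gerDl oppr_le0.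
  by rewrite ltW.
have [b zb] : exists b, forall e l : R, 0 < e -> 0 < l ->
    exists N, forall n, (N <= n)%N -> el_ball e l (z n - b).
  apply: el_complete_cvg => // e' l' e0' l0'.
  have e20' : 0 < e' / 2 by rewrite divr_gt0.
  have l20' : 0 < l' / 2 by rewrite divr_gt0.
  have [n1 hn1] := pow2_lt (mulr_ge0 (ler0n R 2) M0) e20'.
  have [n2 hn2] := pow2_lt (ltW l20) l20'.
  have pm n m : (n <= m)%N -> 2^-1 ^+ m <= 2^-1 ^+ n :> R.
    by move=> nm; rewrite ler_wiXn2l//; lra.
  pose N := maxn n1 n2; exists N.
  have hN m : (N <= m)%N -> el_ball (e' / 2) (l' / 2) (z m - z N).
    move=> Nm; have eqm : m = (N + (m - N))%N by rewrite subnKC.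
    apply: (@el_ball_ae _ _ _ _ _ _ _ _ (V N (m - N)%N)) => //.
      apply: le_lt_trans (prV _ _) _; apply: le_lt_trans hn2.
      apply: (ler_wpM2l (ltW l20)); apply: le_trans (pm _ _ (leq_maxr n1 n2)).
      by rewrite gerDl oppr_le0 ltW.
    rewrite [in X in rn X]eqm; apply: zV'.
    apply: le_lt_trans hn1; rewrite ler_wpM2l ?mulr_ge0//.
    by apply: pm; exact: leq_maxl.
  move=> m m' Nm Nm'; rewrite [e']splitr [l']splitr.
  rewrite -(subrKA (z N)); apply: el_ballD; first exact: hN.
  by rewrite -opprB el_ballN; exact: hN.
(* This difference is the limit of the remainders (-1/2)^m 1_A kap m. All its multiples by integers
   j lie in [G], so it vanishes by [L0cc_no_ray]. *)
have : L0_ind k A *: y - b = 0.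
  apply: (L0cc_no_ray ccG) => j; apply: (el_closedP _).1 clG _ _ => e' l' e0' l0'.
  have j1 : 0 < `|j%:R| + 1 :> R by rewrite ltr_wpDl.
  have [N hN] := zb _ _ (divr_gt0 e0' j1) l0'.
  have [n hn] := pow2_lt (ler0n R j) ltr01.
  (* An even index makes (-1/2)^m positive, so that j (-1/2)^m is in [0, 1] and the multiple of
     [kap m] stays in [G]. *)
  pose m := (2 * maxn N n)%N.
  have Nm : (N <= m)%N by rewrite (leq_trans (leq_maxl N n))// leq_pmull.
  have nm : (n <= m)%N by rewrite (leq_trans (leq_maxr N n))// leq_pmull.
  have sm : (- 2^-1) ^+ m = 2^-1 ^+ m :> R by rewrite /m !exprM sqrrN.
  exists (L0_real k j%:R *: (L0_ind k A *: (L0_real k ((- 2^-1) ^+ m) *: kap m))).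
    have -> : L0_real k j%:R *: (L0_ind k A *: (L0_real k ((- 2^-1) ^+ m) *: kap m)) =
        L0_ind k A *: (L0_real k (j%:R * (- 2^-1) ^+ m) *: kap m).
      by rewrite !scalerA L0_realM mulrA [L0_real k j%:R * _]mulrC.
    apply: gluing_ind => //; first exact: L0_convex_gluing.
    apply: rconvex_scale => //; first exact: L0_convex_rconvex.
    rewrite sm mulr_ge0 ?(ltW (p2 m))//=; apply/ltW; apply: le_lt_trans hn.
    by rewrite ler_wpM2l// ler_wiXn2l//; lra.
  have -> : L0_real k j%:R *: (L0_ind k A *: (L0_real k ((- 2^-1) ^+ m) *: kap m)) -
      L0_real k j%:R *: (L0_ind k A *: y - b) = L0_real k j%:R *: (b - z m).
    rewrite -scalerBr; congr (_ *: _); rewrite /z scalerBr !opprB.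
    by rewrite addrCA.
  apply: (@el_ball_scale _ _ _ _ _ _ _ (`|j%:R| + 1)) => //.
    by rewrite absr_ofreal lerDl.
  by rewrite -opprB el_ballN; exact: hN.
move=> /eqP; rewrite subr_eq0 => /eqP ->.
(* It remains to bound [b]: |b| <= |b - z N| + |z N - z 0|, where z 0 = 0 and the last term is at
   most 2 M off [V 0 N]. *)
have [N hN] := zb _ _ e0 l20.
have mt := measurable_rnorm_tail e (z N - b).
exists (V 0%N N `|` rnorm_tail e (z N - b)); first exact: measurableU.
split.
  apply: le_trans (prU_le P (mV _ _) mt) _; rewrite [leRHS]splitr lerD//; last first.
    exact/ltW/el_ballE/hN.
  apply: le_trans (prV _ _) _; rewrite add0n expr0 -[leRHS]mulr1.
  apply: (ler_wpM2l (ltW l20)); rewrite lerBlDr lerDl; exact: ltW.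
have z0 : z 0%N = 0 by rewrite /z expr0 L0_real1 scale1r subrr scaler0.
apply: filterS2 (zV 0%N N) (ler_rnD (b - z N) (z N - z 0%N)) => t h1.
rewrite addrA subrK z0 subr0 rnB_sym => h2 /not_orP[/h1 + /negP].
rewrite -ltNge -/(rn _ _) add0n expr0 z0 subr0 => h3 h4 /=.
have := mulr_ge0 M0 (ltW (p2 N)).
rewrite subr0 in h2; lra.
Qed.

Definition bounded_on G (A : set T) :=
  measurable A /\ exists M : R, forall y, G y -> \forall t \ae P, A t -> rn y t <= M.

Lemma measurable_sublevel x (M : R) : measurable [set t | rn x t < M].
Proof.
have := measurableC (measurable_rnorm_tail M x); congr measurable.
by apply/seteqP; split => t; rewrite /rnorm_tail /= ltNge => /negP.
Qed.

(* The exceptional set A0, on which every x in G is M-close to - G / 2, is one on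
   which G is bounded, by absorbing_bound. *)
Lemma unbounded_escape G (B : set T) (M e : R) : el_complete E ->
  L0_convexly_compact G -> G 0 -> measurable B ->
  (forall A, bounded_on G A -> A `<=` B -> pr P A = 0) -> 0 <= M -> 0 < e ->
  exists2 x, G x & forall y, G y ->
    pr P (B `&` [set t | rn (x + L0_real k 2^-1 *: y) t < M]) <= e.
Proof.
move=> cE ccG G0 mB hB M0 e0; have [clG cG _] := ccG.
have gG := L0_convex_gluing cG.
have msub x := measurable_sublevel x M.
(* The events in [B] on which a single [x] escapes from - G / 2. Gluing the witnesses makes the
   family stable under unions, so it can be exhausted. *)
pose F := [set A | measurable A /\ A `<=` B /\ exists2 x, G x & forall y, G y ->
  \forall t \ae P, A t -> M <= rn (x + L0_real k 2^-1 *: y) t].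
have F0 : F set0 by split => //; split => //; exists 0 => // y _; apply: aeW.
have mF A : F A -> measurable A by case.
have FU A1 A2 : F A1 -> F A2 -> F (A1 `|` A2).
  move=> [mA1 [A1B [x1 Gx1 h1]]] [mA2 [A2B [x2 Gx2 h2]]].
  split; first exact: measurableU.
  split; first by move=> t [/A1B|/A2B].
  exists (L0_ind k A1 *: x1 + L0_ind k (~` A1) *: x2); first exact: gG.
  move=> y Gy; apply: filterS3 (h1 y Gy) (h2 y Gy) (rn_glue x1 x2 (L0_real k 2^-1 *: y) mA1).
  move=> t h3 h4 [h5 h6] [At|At]; first by rewrite h5// h3.
  have [A1t|nA1t] := pselect (A1 t); first by rewrite h5// h3.
  by rewrite h6// h4.
have [S [FS incS hS]] := exhaustion P F0 mF FU.
have mS n : measurable (S n) by exact: mF.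
have mU : measurable (\bigcup_n S n) by exact: bigcupT_measurable.
pose A0 := B `\` \bigcup_n S n.
have mA0 : measurable A0 by exact: measurableD.
have [n hn] := pr_bigcup_approx P mS incS e0.
suff A00 : pr P A0 = 0.
  have [_ [SB [x Gx hx]]] := FS n; exists x => // y Gy.
  have mUS : measurable (\bigcup_n S n `\` S n) by exact: measurableD.
  apply: le_trans (ltW hn); rewrite -[leRHS]add0r -A00.
  apply: le_trans (prU_le P mA0 mUS).
  apply: pr_ae_le; [exact: measurableI|exact: measurableU|].
  apply: filterS (hx y Gy) => t h1 [Bt /= h2].
  have [Ut|nUt] := pselect ((\bigcup_n S n) t); last by left.
  by right; split => // /h1; rewrite leNgt h2.
apply: hB; last by move=> t [].
split => //; exists (2 * M); apply: absorbing_bound => // x e1 Gx e10.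
(* The events in [A0] on which a single [y] brings x + y / 2 below [M]. On the part of [A0] missed
   by their exhaustion [x] escapes, so that part belongs to [F]; being disjoint from the union of
   the [S n], it is null. *)
pose F' := [set A | measurable A /\ A `<=` A0 /\ exists2 y, G y &
  \forall t \ae P, A t -> rn (x + L0_real k 2^-1 *: y) t < M].
have F'0 : F' set0 by split => //; split => //; exists 0 => //; apply: aeW.
have mF' A : F' A -> measurable A by case.
have F'U A1 A2 : F' A1 -> F' A2 -> F' (A1 `|` A2).
  move=> [mA1 [A1B [y1 Gy1 h1]]] [mA2 [A2B [y2 Gy2 h2]]].
  split; first exact: measurableU.
  split; first by move=> t [/A1B|/A2B].
  exists (L0_ind k A1 *: y1 + L0_ind k (~` A1) *: y2); first exact: gG.
  have eqy : x + L0_real k 2^-1 *: (L0_ind k A1 *: y1 + L0_ind k (~` A1) *: y2) =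
     L0_ind k A1 *: (L0_real k 2^-1 *: y1) + L0_ind k (~` A1) *: (L0_real k 2^-1 *: y2) + x.
    rewrite addrC scalerDr !scalerA; congr (_ *: _ + _ *: _ + _); exact: mulrC.
  rewrite eqy.
  apply: filterS3 h1 h2 (rn_glue (L0_real k 2^-1 *: y1) (L0_real k 2^-1 *: y2) x mA1).
  move=> t; rewrite ![_ + x]addrC => h3 h4 [h5 h6] [At|At]; first by rewrite h5// h3.
  have [A1t|nA1t] := pselect (A1 t); first by rewrite h5// h3.
  by rewrite h6// h4.
have [S' [FS' incS' hS']] := exhaustion P F'0 mF' F'U.
have mS' j : measurable (S' j) by exact: mF'.
have mU' : measurable (\bigcup_n S' n) by exact: bigcupT_measurable.
have mAU : measurable (A0 `\` \bigcup_n S' n) by exact: measurableD.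
have AU0 : pr P (A0 `\` \bigcup_n S' n) = 0.
  have <- : (A0 `\` \bigcup_n S' n) `\` \bigcup_n S n = A0 `\` \bigcup_n S' n.
    by apply/seteqP; split => [t []//|t [[Bt nSt] nS't]].
  apply: hS; split => //; split; first by move=> t [[]].
  exists x => // y Gy.
  have : F' (A0 `&` [set t | rn (x + L0_real k 2^-1 *: y) t < M]).
    split; first exact: measurableI.
    by split; [move=> t []|exists y => //; apply: aeW => t []].
  move=> /hS'/pr_ae0 h.
  have {}h : \forall t \ae P,
      ~ ((A0 `&` [set t | rn (x + L0_real k 2^-1 *: y) t < M]) `\` \bigcup_n S' n) t.
    by apply: h; apply: measurableD => //; exact: measurableI.
  by apply: filterS h => t h [At nSt]; rewrite leNgt; apply/negP => xM; apply: h.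
have [m hm] := pr_bigcup_approx P mS' incS' e10.
have [_ [_ [y Gy hy]]] := FS' m; exists y => //.
have mUS : measurable (\bigcup_n S' n `\` S' m) by exact: measurableD.
apply: le_trans (ltW hm); rewrite -[leRHS]add0r -AU0.
apply: le_trans (prU_le P mAU mUS).
apply: pr_ae_le; [|exact: measurableU|].
  apply: measurableI => //; rewrite -[X in measurable X]setTI.
  by apply: measurable_fun_le => //; exact: measurable_rn.
apply: filterS hy => t h1 [Bt /= h2].
have [Ut|nUt] := pselect ((\bigcup_n S' n) t); last by left.
by right; split => // /h1; rewrite ltNge h2.
Qed.

Lemma L0cc_bounded_exhaustion G : el_complete E -> L0_convexly_compact G -> G 0 ->
  exists S : nat -> set T, [/\ forall n, bounded_on G (S n),
    forall n, S n `<=` S n.+1 & pr P (\bigcup_n S n) = 1].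
Proof.
move=> cE ccG G0; have [clG cG _] := ccG.
have [|||S [bS incS hS]] := exhaustion P (F := bounded_on G) _ _ _.
- by split => //; exists 0 => y _; apply: aeW.
- by move=> A [].
- move=> A B [mA [M hM]] [mB [N hN]]; split; first exact: measurableU.
  exists (Num.max M N) => y Gy; apply: filterS2 (hM y Gy) (hN y Gy) => t h1 h2.
  by rewrite le_max => -[/h1 ->//|/h2 ->]; rewrite orbT.
exists S; split => //.
have mS n : measurable (S n) by case: (bS n).
have mU : measurable (\bigcup_n S n) by exact: bigcupT_measurable.
pose B := ~` \bigcup_n S n; have mB : measurable B by exact: measurableC.
suff B0 : pr P B = 0.
  by have := pr_split P measurableT mU; rewrite setTI setTD B0 addr0 pr_setT.
have hB A : bounded_on G A -> A `<=` B -> pr P A = 0.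
  move=> bA AB; have := hS _ bA; congr (pr P _ = 0); apply/seteqP; split => [t []//|t At].
  by split => //; exact: AB.
apply: contrapT => /eqP B0.
have {B0} b0 : 0 < pr P B by rewrite lt_neqAle eq_sym B0 pr_ge0.
set b := pr P B in b0; have b40 : 0 < b / 4 by rewrite divr_gt0.
have i3 n : 0 < 3^-1 ^+ n :> R by rewrite exprn_gt0// invr_gt0.
(* The next term is chosen so large that, whatever [y] in [G] follows, the norm reaches n except
   with probability b / 2 in [B]. The bound used in [unbounded_escape] also has to absorb the norm
   of the previous sum. *)
have /choice[phi hphi] (p : nat * E) : exists x, G x /\ forall y, G y ->
    pr P (B `&` [set t | rn (p.2 + L0_real k (3^-1 ^+ p.1.+1) *: (x + L0_real k 2^-1 *: y)) t < p.1%:R])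
      <= b / 2.
  case: p => n a /=.
  have [N hN] := rnorm_tail_cvg0 a b40.
  have {}hN : pr P (rnorm_tail N.+1%:R a) < b / 4.
    by rewrite -lte_fin -prE//; exact: measurable_rnorm_tail.
  have M0 : 0 <= (n%:R + N.+1%:R) / 3^-1 ^+ n.+1 :> R.
    by rewrite divr_ge0 ?addr_ge0// ltW.
  have [x Gx hx] := unbounded_escape cE ccG G0 mB hB M0 b40.
  exists x; split => // y Gy; have := hx _ Gy.
  set w := x + _; have ms := measurable_sublevel w ((n%:R + N.+1%:R) / 3^-1 ^+ n.+1).
  move=> h; have mt := measurable_rnorm_tail N.+1%:R a.
  apply: (@le_trans _ _ (b / 4 + b / 4)); last by lra.
  apply: le_trans (lerD h (ltW hN)); apply: le_trans (prU_le P _ mt); last exact: measurableI.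
  apply: pr_ae_le.
  + by apply: measurableI => //; exact: measurable_sublevel.
  + by apply: measurableU => //; exact: measurableI.
  apply: filterS2 (rn_rr (3^-1 ^+ n.+1) w) (ler_rnD (a + L0_real k (3^-1 ^+ n.+1) *: w) (- a)).
  move=> t; rewrite [a + _]addrC addrK rnN => -> h1 [Bt /= h2].
  have [h3|h3] := lerP N.+1%:R (rn a t); [by right|left].
  split => //=; rewrite ltr_pdivlMr// mulrC -[X in X * _]ger0_norm ?ltW//.
  by lra.
pose s := fix s n := if n is m.+1
  then s m + L0_real k (3^-1 ^+ m.+1) *: phi (m, s m) else (0 : E).
have Gphi n : G (phi (n, s n)) by exact: (hphi _).1.
pose D n := [set z | G (L0_real k (2 * 3 ^+ n) *: (z - s n))].
have i30 n : 0 <= 3^-1 ^+ n :> R by exact: ltW.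
have e3 n : (3 ^+ n.+1) * (3^-1 ^+ n.+1) = 1 :> R.
  by rewrite -exprMn divff ?expr1n// pnatr_eq0.
have e3' n : (2 * 3 ^+ n) * (3^-1 ^+ n.+1) = 2 / 3 :> R.
  by have := e3 n; rewrite exprS; lra.
have D0G : D 0%N `<=` G.
  move=> z; rewrite /D/= subr0 expr0 mulr1 => Gz.
  have := @rconvex_scale G 2^-1 _ (L0_convex_rconvex cG) G0 _ Gz.
  by rewrite scalerA -L0_realM mulVf ?pnatr_eq0// L0_real1 scale1r; apply; lra.
(* One has s + 3^-(n+1) (f + g / 2) = s + 3^-n (2/3 f + 1/3 g) / 2: the ratio 3 turns the bracket
   into a convex combination of points of [G]. *)
have decD n : D n.+1 `<=` D n.
  move=> z; rewrite /D/=; set a := s n; set f := phi _ => Gz.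
  have := @L0_convex_rconvex _ _ _ _ _ _ _ cG _ _ 3^-1 _ _ Gz (Gphi n).
  have h0 : 0 <= 3^-1 :> R by rewrite invr_ge0.
  have h1 : 3^-1 <= 1 :> R by rewrite invf_le1// ler1n.
  move=> /(_ h0 h1); congr G.
  rewrite scalerA -L0_realM opprD addrA scalerBr scalerA -L0_realM.
  have -> : 3^-1 * (2 * 3 ^+ n.+1) = 2 * 3 ^+ n :> R.
    by rewrite exprS; field.
  rewrite e3' -/f.
  have -> : 1 - 3^-1 = 2 / 3 :> R by lra.
  by rewrite subrK.
have [||x Dx] := @L0cc_nested G D ccG _ _ decD.
- move=> n; split; [exact: closed_affine_preimage|exact: L0_convex_affine_preimage|].
  by elim: n => [//|n ih]; apply: subset_trans ih; exact: decD.
- by move=> n; exists (s n); rewrite /D/= subrr scaler0.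
have [N hN] := rnorm_tail_cvg0 x b40.
have mt := measurable_rnorm_tail N.+1%:R x.
have {}hN : pr P (rnorm_tail N.+1%:R x) < b / 4 by rewrite -lte_fin -prE.
(* This writes [x] in the form controlled by [phi] at step N+1: |x| < N+1 has probability at most b
   / 2 in [B]. But it fails with probability below b / 4, and b > b / 2 + b / 4. *)
have Gx := Dx N.+2.
have := (hphi (N.+1, s N.+1)).2 _ Gx; rewrite /= -/(s N.+1).
rewrite [X in rn X](_ : _ = x); last first.
  rewrite -/(phi (N.+1, s N.+1)); set a := s N.+1; set f := phi _.
  rewrite [L0_real k 2^-1 *: _]scalerA -L0_realM mulrA mulVf ?pnatr_eq0// mul1r.
  rewrite scalerDr scalerA -L0_realM mulrC e3 L0_real1 scale1r addrA.
  by rewrite addrC subrK.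
move=> h; have : b <= b / 2 + b / 4.
  apply: le_trans (lerD h (ltW hN)).
  have msB : measurable (B `&` [set t | rn x t < N.+1%:R]).
    by apply: measurableI => //; exact: measurable_sublevel.
  apply: le_trans (prU_le P msB mt); apply: pr_le => //; first exact: measurableU.
  by move=> t Bt; have [h3|h3] := lerP N.+1%:R (rn x t); [right|left].
lra.
Qed.

(** Serves to move a point of [G] to 0, as the boundedness argument needs 0 in the set. *)
Lemma L0cc_translate G a : L0_convexly_compact G ->
  L0_convexly_compact [set z | G (z + a)].
Proof.
have trE (H : set E) c : [set z | H (z + c)] = [set z | H (L0_real k 1 *: (z - (- c)))].
  by apply/seteqP; split => z /=; rewrite L0_real1 scale1r opprK.
move=> [clG cG ccG]; split.
- by rewrite trE; exact: closed_affine_preimage.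
- by rewrite trE; exact: L0_convex_affine_preimage.
- move=> I D f hf fin.
  have [||x hx] := ccG I D (fun i => [set z | f i (z - a)]).
  + move=> i Di; have [h1 h2 h3] := hf i Di; split.
    * by rewrite trE; exact: closed_affine_preimage.
    * by rewrite trE; exact: L0_convex_affine_preimage.
    * by move=> z /= /h3 /=; rewrite subrK.
  + move=> J JD; have [x hx] := fin J JD; exists (x + a) => i iJ /=.
    by rewrite addrK; exact: hx.
  + by exists (x - a) => i Di; exact: hx.
Qed.

(** The weight is the supremum of 1_(S n) / m n, where m n >= 1 bounds [G] on [S n]. It is positive
    on the union of the [S n], and at most 1 / |y| wherever |y| > 0 because every term is. *)
Lemma bounded_weight G (S : nat -> set T) : (forall n, bounded_on G (S n)) ->
  pr P (\bigcup_n S n) = 1 ->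
  exists w : T -> R, [/\ measurable_fun setT w, forall t, 0 <= w t <= 1,
    \forall t \ae P, 0 < w t & forall y, G y -> \forall t \ae P, w t * rn y t <= 1].
Proof.
move=> bS S1.
have mS n : measurable (S n) by case: (bS n).
have /choice[m0 hm0] (n : nat) := (bS n).2.
pose m n := Num.max 1 (m0 n).
have m1 n : 1 <= m n by rewrite le_max lexx.
have m00 n : 0 < m n by apply: lt_le_trans (m1 n).
pose h n t := \1_(S n) t / m n.
have h01 n t : 0 <= h n t <= 1.
  rewrite /h divr_ge0 ?(ltW (m00 n))//= ler_pdivrMr// mul1r; apply: le_trans (m1 n).
  by rewrite indicE; case: (_ \in _).
have ubh t : has_ubound (range (h ^~ t)).
  by exists 1 => _ [n _ <-]; have /andP[] := h01 n t.
exists (fun t => sups (h ^~ t) 0%N).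
have hle n t : h n t <= sups (h ^~ t) 0.
  apply: ub_le_sup; last by exists n.
  by exists 1 => _ [j _ <-]; have /andP[] := h01 j t.
have lesup t c : (forall n, h n t <= c) -> sups (h ^~ t) 0 <= c.
  by move=> hc; apply: sup_le_ub; [exists (h 0%N t), 0%N|move=> _ [n _ <-]; exact: hc].
split.
- apply: measurable_fun_sups => // n; apply: measurable_funM => //.
- move=> t; apply/andP; split; last by apply: lesup => n; have /andP[] := h01 n t.
  by apply: le_trans (hle 0%N t); have /andP[] := h01 0%N t.
- have mU : measurable (\bigcup_n S n) by exact: bigcupT_measurable.
  have : pr P (~` \bigcup_n S n) = 0.
    by have := pr_split P measurableT mU; rewrite setTI setTD S1 pr_setT; lra.
  move=> /(pr_ae0 (measurableC mU)); apply: filterS => t /contrapT[n _ Snt].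
  apply: lt_le_trans (hle n t); rewrite /h indicE mem_set//.
  by rewrite divr_gt0.
- move=> y Gy.
  have hb : \forall t \ae P, forall n, S n t -> rn y t <= m n.
    apply/ae_foralln => n; apply: filterS (hm0 n y Gy) => t h1 /h1 h2.
    by rewrite le_max h2 orbT.
  apply: filterS2 hb (rn_ge0 y) => t hb; rewrite le_eqVlt => /predU1P[<-|y0].
    by rewrite mulr0.
  rewrite -ler_pdivlMr// div1r; apply: lesup => n; rewrite /h.
  have [St|nSt] := pselect (S n t); last first.
    by rewrite indicE memNset// mul0r invr_ge0 ltW.
  by rewrite indicE mem_set// div1r lef_pV2 ?posrE//; exact: hb.
Qed.

Lemma L0cc_weight G : el_complete E -> L0_convexly_compact G -> G !=set0 ->
  exists w : T -> R, [/\ measurable_fun setT w, forall t, 0 <= w t <= 1,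
    \forall t \ae P, 0 < w t & forall y, G y -> \forall t \ae P, w t * rn y t <= 1].
Proof.
move=> cE ccG [g Gg].
have [|S [bS incS S1]] := L0cc_bounded_exhaustion cE (L0cc_translate g ccG).
  by rewrite /= add0r.
(* The bounds on [S n] concern the translate G - g; where |g| is bounded too they become bounds for
   [G]. *)
pose S' n := S n `&` [set t | rn g t < n%:R].
have mS n : measurable (S n) by case: (bS n).
apply: (@bounded_weight _ S').
  move=> n; split.
    by apply: measurableI => //; exact: measurable_sublevel.
  have [_ [M hM]] := bS n; exists (M + n%:R) => y Gy.
  have Gy' : [set z | G (z + g)] (y - g) by rewrite /= subrK.
  apply: filterS2 (hM _ Gy') (ler_rnD (y - g) g) => t h1 + [/h1 h2 /= h3].
  by rewrite subrK; lra.
rewrite (_ : \bigcup_n S' n = \bigcup_n S n)//; apply/seteqP; split.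
  by move=> t [n _ [Snt _]]; exists n.
move=> t [n _ Snt]; pose m := maxn n (Num.truncn (rn g t)).+1.
have incS' i j : (i <= j)%N -> S i `<=` S j.
  elim: j => [|j ih]; first by rewrite leqn0 => /eqP ->.
  rewrite leq_eqVlt => /predU1P[->//|/ih h]; exact: subset_trans h (incS j).
exists m => //; split; first exact: incS' (leq_maxl _ _) _ Snt.
rewrite /=; apply: lt_le_trans (truncnS_gt _) _.
by rewrite ler_nat leq_maxr.
Qed.

End compact.

(** * Hahn-Banach *)

Section hahn_banach.
Context (R : realType) (V : lmodType R) (S : set V).
Hypothesis S_add : forall x y, S x -> S y -> S (x + y).
Hypothesis S_scale : forall c x, S x -> S (c *: x).
Implicit Types (x y : V) (p q : V -> R).

(** All conditions are relative to the subspace [S], because the norm used later is finite only on a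
    subspace. For positive multiples an inequality suffices; [sublinearZ] recovers equality. *)
Definition sublinear p :=
  (forall x y, S x -> S y -> p (x + y) <= p x + p y) /\
  (forall c x, 0 < c -> S x -> p (c *: x) <= c * p x).

Let S_opp x : S x -> S (- x).
Proof. by move=> Sx; rewrite -scaleN1r; exact: S_scale. Qed.

Lemma sublinearZ p c x : sublinear p -> 0 < c -> S x -> p (c *: x) = c * p x.
Proof.
move=> [_ pZ] c0 Sx; apply/eqP; rewrite eq_le pZ//=.
have ci : 0 < c^-1 by rewrite invr_gt0.
have := pZ _ _ ci (S_scale c Sx); rewrite scalerA mulVf ?gt_eqF// scale1r.
by rewrite mulrC ler_pdivlMr// mulrC.
Qed.

Lemma sublinear0 p x : sublinear p -> S x -> p 0 = 0.
Proof.
move=> sp Sx; have S0 : S 0 by rewrite -(scale0r x); exact: S_scale.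
have := sublinearZ sp (ltr0n R 2) S0; rewrite scaler0; lra.
Qed.

Lemma sublinear_ge p x : sublinear p -> S x -> - p (- x) <= p x.
Proof.
move=> sp Sx; have := sp.1 _ _ Sx (S_opp Sx).
by rewrite subrr (sublinear0 sp Sx); lra.
Qed.

(** The pointwise infimum is finite since q x >= - q (- x) >= - p (- x), and subadditive since of
    two members of a chain the smaller can serve for both arguments. *)
Lemma inf_chain_sublinear (A : set (V -> R)) p : A !=set0 ->
  (forall q, A q -> sublinear q /\ forall x, S x -> q x <= p x) ->
  (forall q r, A q -> A r ->
     (forall x, S x -> q x <= r x) \/ (forall x, S x -> r x <= q x)) ->
  exists q0, [/\ sublinear q0, forall x, S x -> q0 x <= p x &
    forall q x, A q -> S x -> q0 x <= q x].
Proof.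
move=> [a Aa] hA tot.
pose q0 x := inf [set q x | q in A].
have ge q x : A q -> S x -> q0 x <= q x.
  move=> Aq Sx; apply: ge_inf; last by exists q.
  exists (- p (- x)) => _ [r Ar <-].
  have [sr rp] := hA _ Ar.
  by apply: le_trans (sublinear_ge sr Sx); rewrite lerN2; apply: rp; exact: S_opp.
have glb x r : (forall q, A q -> r <= q x) -> r <= q0 x.
  by move=> h; apply: lb_le_inf; [exists (a x), a|move=> _ [q Aq <-]; exact: h].
exists q0; split => //; last first.
  by move=> x Sx; apply: le_trans (ge _ _ Aa Sx) _; exact: (hA _ Aa).2.
split=> [x y Sx Sy|c x c0 Sx].
  rewrite -lerBlDr; apply: (glb _ _) => q Aq; rewrite lerBlDr -lerBlDl; apply: (glb _ _) => r Ar.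
  rewrite lerBlDl; have [h|h] := tot _ _ Aq Ar.
    apply: le_trans (ge _ _ Aq (S_add Sx Sy)) _.
    by apply: le_trans ((hA _ Aq).1.1 _ _ Sx Sy) _; rewrite lerD2l; exact: h.
  apply: le_trans (ge _ _ Ar (S_add Sx Sy)) _.
  by apply: le_trans ((hA _ Ar).1.1 _ _ Sx Sy) _; rewrite lerD2r; exact: h.
rewrite mulrC -ler_pdivrMr//; apply: (glb _ _) => q Aq; rewrite ler_pdivrMr// mulrC.
apply: le_trans (ge _ _ Aq (S_scale c Sx)) _.
exact: (hA _ Aq).1.2.
Qed.

(** For fixed y, the infimum over t >= 0 of q (x + t y) - t q y is sublinear in x and below q. By
    minimality it equals q, and t = 1 gives q x + q y <= q (x + y). *)
Lemma minimal_sublinear_additive q : sublinear q ->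
  (forall r, sublinear r -> (forall x, S x -> r x <= q x) ->
     forall x, S x -> q x <= r x) ->
  forall x y, S x -> S y -> q (x + y) = q x + q y.
Proof.
move=> sq minq x y Sx Sy; apply/eqP; rewrite eq_le sq.1//=.
pose B x := [set q (x + t *: y) - t * q y | t in [set t | 0 <= t]].
have lbB z : S z -> lbound (B z) (- q (- z)).
  move=> Sz _ [t /= t0 <-].
  have : q (t *: y) <= q (z + t *: y) + q (- z).
    rewrite [X in q X <= _](_ : _ = (z + t *: y) + (- z)); last first.
      by rewrite [RHS]addrC addKr.
    apply: sq.1; last exact: S_opp.
    by apply: S_add => //; exact: S_scale.
  have -> : q (t *: y) = t * q y.
    move: t0; rewrite le_eqVlt => /predU1P[<-|t0]; last exact: sublinearZ.
    by rewrite scale0r mul0r (sublinear0 sq Sx).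
  lra.
have ge z t : S z -> 0 <= t -> inf (B z) <= q (z + t *: y) - t * q y.
  by move=> Sz t0; apply: ge_inf; [exists (- q (- z)); exact: lbB|exists t].
have glb z r : (forall t, 0 <= t -> r <= q (z + t *: y) - t * q y) -> r <= inf (B z).
  move=> h; apply: lb_le_inf; last by move=> _ [t t0 <-]; exact: h.
  by exists (q (z + 0 *: y) - 0 * q y), 0 => /=.
have := minq (fun z => inf (B z)) _ _ _ Sx.
have -> : q x + q y <= q (x + y) = (q x <= q (x + 1 *: y) - 1 * q y).
  by rewrite scale1r mul1r lerBrDr.
move=> h; apply: le_trans (ge x 1 Sx ler01); apply: h; last first.
  by move=> z Sz; have := ge z 0 Sz (lexx 0); rewrite scale0r mul0r addr0 subr0.
split=> [u v Su Sv|c u c0 Su].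
  rewrite -lerBlDr; apply: (glb _ _) => t t0; rewrite lerBlDr -lerBlDl; apply: (glb _ _) => s s0.
  rewrite lerBlDl; apply: le_trans (ge _ _ (S_add Su Sv) (addr_ge0 t0 s0)) _.
  have St := S_add Su (S_scale t Sy); have Ss := S_add Sv (S_scale s Sy).
  have := sq.1 _ _ St Ss.
  by rewrite addrACA -scalerDl; lra.
rewrite mulrC -ler_pdivrMr//; apply: (glb _ _) => t t0; rewrite ler_pdivrMr//.
apply: le_trans (ge _ _ (S_scale c Su) (mulr_ge0 (ltW c0) t0)) _.
have := sq.2 _ _ c0 (S_add Su (S_scale t Sy)).
by rewrite scalerDr scalerA; lra.
Qed.

Theorem hahn_banach p : sublinear p -> exists f : V -> R,
  [/\ forall x y, S x -> S y -> f (x + y) = f x + f y,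
      forall c x, S x -> f (c *: x) = c * f x &
      forall x, S x -> f x <= p x].
Proof.
move=> sp.
pose Q := {q : V -> R | sublinear q /\ forall x, S x -> q x <= p x}.
(* The order is reversed: maximal for [ord] means pointwise minimal on [S]. *)
pose ord (a b : Q) := `[< forall x, S x -> sval b x <= sval a x >].
have Qp : sublinear p /\ forall x, S x -> p x <= p x by split.
have [|||[q [sq qp]] maxq] := @ZL_preorder Q (exist _ p Qp) ord.
- by move=> a; apply/asboolP.
- move=> a b c /asboolP ab /asboolP bc; apply/asboolP => x Sx.
  exact: le_trans (bc _ Sx) (ab _ Sx).
- move=> A totA; have [[a Aa]|A0] := pselect (A !=set0); last first.
    by exists (exist _ p Qp) => s As; exfalso; apply: A0; exists s.
  have [| | |q [sq qp qA]] := @inf_chain_sublinear [set sval a | a in A] p.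
  + by exists (sval a), a.
  + by move=> _ [b Ab <-]; exact: (svalP b).
  + move=> _ _ [b Ab <-] [c Ac <-].
    by have [/asboolP h|/asboolP h] := totA _ _ Ab Ac; [right|left].
  + exists (exist _ q (conj sq qp)) => s As; apply/asboolP => x Sx /=.
    by apply: qA => //; exists s.
have addq : forall x y, S x -> S y -> q (x + y) = q x + q y.
  apply: minimal_sublinear_additive => // r sr rq x Sx.
  have rp : sublinear r /\ forall x, S x -> r x <= p x.
    by split => // z Sz; apply: le_trans (rq _ Sz) (qp _ Sz).
  have qr : ord (exist _ q (conj sq qp)) (exist _ r rp).
    by apply/asboolP => z Sz; exact: rq.
  by have /asboolP/(_ _ Sx) := maxq _ qr.
exists q; split => // c x Sx.
have oppq y : S y -> q (- y) = - q y.
  move=> Sy; have := addq _ _ Sy (S_opp Sy).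
  by rewrite subrr (sublinear0 sq Sy); lra.
have [c0|c0|->] := ltgtP c 0; last by rewrite scale0r mul0r (sublinear0 sq Sx).
  rewrite -[c]opprK scaleNr oppq; last exact: S_scale.
  by rewrite (sublinearZ sq)// ?mulNr// oppr_gt0.
exact: sublinearZ.
Qed.

End hahn_banach.

(** * Quadratic variation of set functions *)

Section gsup.
Context (R : realType) (J : Type).
Implicit Types a : J -> R.

Definition gsup a : R := sup (range a).

Lemma gsup_ub a M j : (forall i, a i <= M) -> a j <= gsup a.
Proof.
move=> aM; apply: ub_le_sup; last by exists j.
by exists M => _ [i _ <-].
Qed.

Lemma gsup_le a M : inhabited J -> (forall i, a i <= M) -> gsup a <= M.
Proof.
by move=> [j] aM; apply: sup_le_ub; [exists (a j), j|move=> _ [i _ <-]].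
Qed.

End gsup.

Section setfun.
Context d (T : measurableType d) (R : realType) (P : probability T R).
Context (I : Type) (l : seq I).
Implicit Types (A B : set T) (t u v : I -> set T -> R) (c : R).

Definition meas_set := {A : set T | measurable A}.
Implicit Type s : seq meas_set.

(** Additivity is stated by cutting [A] along [B]; the second condition says that the density of
    [u i] is bounded by [c]. *)
Definition bounded_charge c u := forall i,
  (forall A B, measurable A -> measurable B -> u i A = u i (A `&` B) + u i (A `\` B)) /\
  (forall A, measurable A -> `|u i A| <= c * pr P A).

(* If u i A is the integral over A of g i, then the supremum [sqvar] below is the integral
   over A of the sum of the g i ^ 2, and [sqvar_on] its value on the partition generated by a
   list of events. The junk value of the quotient at pr A = 0 is harmless, since
   then u i A = 0. *)
Definition sqterm u A := \sum_(i <- l) u i A ^+ 2 / pr P A.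

Fixpoint sqvar_on s u A := if s is B :: s'
  then sqvar_on s' u (A `&` sval B) + sqvar_on s' u (A `\` sval B) else sqterm u A.

Let mI A (B : meas_set) : measurable A -> measurable (A `&` sval B).
Proof. by move=> mA; apply: measurableI => //; exact: svalP. Qed.
Let mD A (B : meas_set) : measurable A -> measurable (A `\` sval B).
Proof. by move=> mA; apply: measurableD => //; exact: svalP. Qed.

(** Cauchy-Schwarz: for positive p and q the defect is a multiple of (a q - b p)^2. It is what makes
    [sqvar_on] grow when the partition is refined. *)
Lemma sqr_div_split (p q a b : R) : 0 <= p -> 0 <= q ->
  (p = 0 -> a = 0) -> (q = 0 -> b = 0) ->
  (a + b) ^+ 2 / (p + q) <= a ^+ 2 / p + b ^+ 2 / q.
Proof.
move=> p0 q0 pa qb.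
have [p00|pn0] := eqVneq p 0.
  by rewrite p00 (pa p00) !add0r expr0n/= mul0r add0r.
have [q00|qn0] := eqVneq q 0.
  by rewrite q00 (qb q00) !addr0 expr0n/= mul0r addr0.
have {}p0 : 0 < p by rewrite lt_neqAle eq_sym pn0.
have {}q0 : 0 < q by rewrite lt_neqAle eq_sym qn0.
rewrite ler_pdivrMr ?addr_gt0// -subr_ge0.
have -> : (a ^+ 2 / p + b ^+ 2 / q) * (p + q) - (a + b) ^+ 2 =
   (a * q - b * p) ^+ 2 / (p * q) by field; rewrite pn0 qn0.
by rewrite divr_ge0 ?sqr_ge0// mulr_ge0// ltW.
Qed.

Lemma bounded_charge_null c u i A : bounded_charge c u -> measurable A -> pr P A = 0 -> u i A = 0.
Proof.
move=> su mA A0; have := (su i).2 _ mA; rewrite A0 mulr0 normr_le0.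
by move/eqP.
Qed.

Lemma sqterm_split c u A (B : meas_set) : bounded_charge c u -> measurable A ->
  sqterm u A <= sqterm u (A `&` sval B) + sqterm u (A `\` sval B).
Proof.
move=> su mA; rewrite /sqterm -big_split/=; apply: ler_sum => i _.
have mB : measurable (sval B) by exact: svalP.
rewrite ((su i).1 _ _ mA mB) (pr_split P mA mB).
apply: sqr_div_split; rewrite ?pr_ge0//.
- by apply: bounded_charge_null su _; exact: mI.
- by apply: bounded_charge_null su _; exact: mD.
Qed.

Lemma sqvar_on_ge0 s u A : 0 <= sqvar_on s u A.
Proof.
elim: s A => /= [A|B s ih A]; last by rewrite addr_ge0.
by apply: sumr_ge0 => i _; rewrite divr_ge0 ?sqr_ge0 ?pr_ge0.
Qed.

Lemma sqvar_on_cons c s u A (B : meas_set) : bounded_charge c u -> measurable A -> sqvar_on s u A <= sqvar_on (B :: s) u A.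
Proof.
move=> su; elim: s A => [A mA|C s ih A mA] /=; first exact: sqterm_split su _.
have := lerD (ih _ (mI C mA)) (ih _ (mD C mA)); move=> /le_trans; apply.
rewrite /= [leLHS]addrACA.
rewrite !setDE !(setIAC A (sval C)) !(setIAC A (~` sval C)).
by rewrite ?(setIAC A (sval C)).
Qed.

Lemma sqvar_on_catl c s s' u A : bounded_charge c u -> measurable A -> sqvar_on s u A <= sqvar_on (s' ++ s) u A.
Proof.
move=> su mA; elim: s' => //= B s' ih.
by apply: le_trans ih _; exact: (sqvar_on_cons _ B su).
Qed.

(** With [sqvar_on_catl], the concatenation of two lists acts as a common refinement of both. *)
Lemma sqvar_on_catr c s s' u A : bounded_charge c u -> measurable A -> sqvar_on s u A <= sqvar_on (s ++ s') u A.
Proof.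
move=> su; elim: s A => [|B s ih] A mA.
  by have := sqvar_on_catl [::] s' su mA; rewrite cats0.
by rewrite /= lerD// ih//; [exact: mI|exact: mD].
Qed.

Lemma sqvar_on_le c s u A : bounded_charge c u -> measurable A ->
  sqvar_on s u A <= (size l)%:R * c ^+ 2 * pr P A.
Proof.
move=> su; elim: s A => [A mA|B s ih A mA] /=.
  rewrite /sqterm -mulrA mulr_natl -sum1_size -sumrMnr; apply: ler_sum => i _.
  rewrite mulr1n; have := (su i).2 _ mA.
  have [A0|A0] := eqVneq (pr P A) 0; first by rewrite A0 invr0 !mulr0.
  have pA : 0 < pr P A by rewrite lt_neqAle eq_sym A0 pr_ge0.
  rewrite ler_pdivrMr// -mulrA -expr2 -exprMn -real_normK ?num_real//.
  by move=> h; rewrite lerXn2r// ?nnegrE//; exact: le_trans h.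
rewrite (pr_split P mA (svalP B)) mulrDr; apply: lerD; apply: ih; [exact: mI|exact: mD].
Qed.

Lemma sqvar_on_ext s u v A : measurable A ->
  (forall i B, measurable B -> u i B = v i B) -> sqvar_on s u A = sqvar_on s v A.
Proof.
move=> mA uv; elim: s A mA => [A mA|B s ih A mA] /=.
  by rewrite /sqterm; apply: eq_bigr => i _; rewrite uv.
by rewrite !ih//; [exact: mD|exact: mI].
Qed.

Lemma sqvar_on_parallelogram s u v A :
  sqvar_on s (fun i B => u i B + v i B) A + sqvar_on s (fun i B => u i B - v i B) A =
  2 * sqvar_on s u A + 2 * sqvar_on s v A.
Proof.
elim: s A => [A|B s ih A] /=; last by rewrite addrACA !ih; ring.
rewrite /sqterm !mulr_sumr -!big_split/=; apply: eq_bigr => i _; ring.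
Qed.

Lemma sqvar_on_scale s (a : R) u A : sqvar_on s (fun i B => a * u i B) A = a ^+ 2 * sqvar_on s u A.
Proof.
elim: s A => [A|B s ih A] /=; last by rewrite !ih mulrDr.
by rewrite /sqterm mulr_sumr; apply: eq_bigr => i _; rewrite exprMn mulrA.
Qed.

Lemma sqvar_on_convex s (a : R) u v A : 0 <= a <= 1 ->
  sqvar_on s (fun i B => (1 - a) * u i B + a * v i B) A <= (1 - a) * sqvar_on s u A + a * sqvar_on s v A.
Proof.
move=> /andP[a0 a1]; elim: s A => [A|B s ih A] /=; last first.
  by apply: le_trans (lerD (ih _) (ih _)) _; rewrite !mulrDr addrACA.
rewrite /sqterm !mulr_sumr -big_split/=; apply: ler_sum => i _.
rewrite !mulrA -mulrDl ler_wpM2r ?invr_ge0 ?pr_ge0//= -subr_ge0.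
have -> : (1 - a) * u i A * u i A + a * v i A * v i A - ((1 - a) * u i A + a * v i A) ^+ 2
  = a * (1 - a) * (u i A - v i A) ^+ 2 by ring.
by rewrite mulr_ge0 ?sqr_ge0// mulr_ge0// subr_ge0.
Qed.

Lemma bounded_charge_sub c c' u v : bounded_charge c u -> bounded_charge c' v -> bounded_charge (c + c') (fun i B => u i B - v i B).
Proof.
move=> su sv i; split=> [A B mA mB|A mA].
  by rewrite ((su i).1 _ _ mA mB) ((sv i).1 _ _ mA mB); ring.
by apply: le_trans (ler_normB _ _) _; rewrite mulrDl lerD ?(su i).2 ?(sv i).2.
Qed.

Lemma bounded_charge_scale c (a : R) u : bounded_charge c u -> bounded_charge (`|a| * c) (fun i B => a * u i B).
Proof.
move=> su i; split=> [A B mA mB|A mA]; first by rewrite ((su i).1 _ _ mA mB) mulrDr.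
by rewrite normrM -mulrA ler_wpM2l//; exact: (su i).2.
Qed.

Definition sqvar u A := gsup (fun s => sqvar_on s u A).

Lemma sqvar_on_le_sqvar c s u A : bounded_charge c u -> measurable A -> sqvar_on s u A <= sqvar u A.
Proof. move=> su mA.
apply: (@gsup_ub _ _ (fun s => sqvar_on s u A) ((size l)%:R * c ^+ 2 * pr P A)) => s'.
exact: sqvar_on_le. Qed.

Lemma sqvar_le u A M : (forall s, sqvar_on s u A <= M) -> sqvar u A <= M.
Proof. by move=> h; apply: gsup_le => //; exact: (inhabits [::]). Qed.

(** Lists chosen separately for the two pieces are merged into [B :: (s ++ s')], which refines [s]
    inside B and [s'] outside. *)
Lemma sqvar_split c u A B : bounded_charge c u -> measurable A -> measurable B ->
  sqvar u (A `&` B) + sqvar u (A `\` B) <= sqvar u A.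
Proof.
move=> su mA mB; have mAB := measurableI _ _ mA mB; have mAD := measurableD mA mB.
rewrite -lerBrDr; apply: sqvar_le => s; rewrite lerBrDr -lerBrDl; apply: sqvar_le => s'.
rewrite lerBrDl.
apply: le_trans (sqvar_on_le_sqvar ((exist _ B mB : meas_set) :: (s ++ s')) su mA).
by apply: lerD; [exact: sqvar_on_catr su mAB|exact: sqvar_on_catl su mAD].
Qed.

(** By the arithmetic-geometric inequality |x| <= r p + x^2 / (p r). The gain is that the bound is
    superadditive in A, which [close_to_L0_convex] requires of an error. *)
Lemma bounded_charge_le_sqvar c u A i (r : R) : bounded_charge c u -> measurable A -> 0 < r -> List.In i l ->
  `|u i A| <= r * pr P A + sqvar u A / r.
Proof.
move=> su mA r0 il; apply: (@le_trans _ _ (r * pr P A + u i A ^+ 2 / pr P A / r)).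
  have [A0|A0] := eqVneq (pr P A) 0.
    by rewrite (bounded_charge_null i su mA A0) normr0 A0 invr0 !mulr0 mul0r addr0.
  have pA : 0 < pr P A by rewrite lt_neqAle eq_sym A0 pr_ge0.
  rewrite -[u i A ^+ 2]real_normK ?num_real//; set x := `|_|.
  rewrite -subr_ge0.
  have -> : r * pr P A + x ^+ 2 / pr P A / r - x =
     ((r * pr P A - x / 2) ^+ 2 + 3 / 4 * x ^+ 2) / (r * pr P A).
    by field; rewrite A0 gt_eqF.
  by rewrite divr_ge0 ?(mulr_ge0 (ltW r0) (ltW pA))// addr_ge0 ?sqr_ge0// mulr_ge0// sqr_ge0.
rewrite lerD2l ler_pM2r ?invr_gt0//; apply: le_trans (sqvar_on_le_sqvar [::] su mA) => /=.
rewrite /sqterm; elim: (l) il => //= j l' ih [->|/ih h]; rewrite big_cons.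
  rewrite lerDl; apply: sumr_ge0 => j' _.
  by rewrite divr_ge0 ?sqr_ge0 ?pr_ge0.
by apply: le_trans h _; rewrite lerDr divr_ge0 ?sqr_ge0 ?pr_ge0.
Qed.

(* In a Hilbert space, a convex set is norm close to its weak limit points. Near a
   minimiser y of sqvar, moving towards a y' that is almost 0 on a fine partition s
   decreases the value of sqvar_on s, while the excess of finer values over sqvar_on s, a nonnegative
   quadratic form, is small at y. *)
Lemma small_sqvar (X : Type) (Y : set X) (tau : X -> I -> set T -> R) c : 
  (forall y, Y y -> bounded_charge c (tau y)) ->
  (forall y y' a, Y y -> Y y' -> 0 <= a <= 1 -> exists2 w, Y w &
    forall i A, measurable A -> tau w i A = (1 - a) * tau y i A + a * tau y' i A) ->
  (forall s (e : R), 0 < e -> exists2 y, Y y & sqvar_on s (tau y) setT <= e) ->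
  forall e : R, 0 < e -> exists2 y, Y y & sqvar (tau y) setT <= e.
Proof.
move=> sftau aff weak e e0; apply: contrapT => hN.
have {}hN y : Y y -> e <= sqvar (tau y) setT.
  by move=> Yy; rewrite leNgt; apply/negP => /ltW h; apply: hN; exists y.
have [y0 Yy0 _] := weak [::] 1 ltr01.
pose M := (size l)%:R * c ^+ 2 + e.
have M0 : 0 < M by rewrite ltr_wpDl// mulr_ge0// sqr_ge0.
have qM y s : Y y -> sqvar_on s (tau y) setT <= M.
  move=> Yy; apply: le_trans (sqvar_on_le s (sftau _ Yy) measurableT) _.
  by rewrite pr_setT mulr1 lerDl ltW.
pose r := inf [set sqvar (tau y) setT | y in Y].
have hl : has_lbound [set sqvar (tau y) setT | y in Y].
  by exists e => _ [y Yy <-]; exact: hN.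
have rle y : Y y -> r <= sqvar (tau y) setT by move=> Yy; apply: ge_inf => //; exists y.
have er : e <= r.
  by apply: lb_le_inf; [exists (sqvar (tau y0) setT), y0|move=> _ [y Yy <-]; exact: hN].
have r0 : 0 < r by exact: lt_le_trans er.
have rM : r <= M by apply: le_trans (rle _ Yy0) _; apply: sqvar_le => s; exact: qM.
(* With this step 2 a^2 M = a r / 4. Together with the errors 3 [eta] it stays below the decrease a
   r, so the value at [w] falls under the infimum [r]. *)
pose a := r / (8 * M).
have a0 : 0 < a by rewrite divr_gt0// mulr_gt0.
have aM : a * M = r / 8 by rewrite /a; field; rewrite gt_eqF.
have a1 : a <= 1 by rewrite /a ler_pdivrMr ?mulr_gt0// mul1r; lra.
pose eta := a * r / 16.
have eta0 : 0 < eta by rewrite divr_gt0// mulr_gt0.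
have [_ [y Yy <-] yr] : exists2 x, [set sqvar (tau y) setT | y in Y] x & x < r + eta.
  apply: inf_adherent => //; split => //.
  by exists (sqvar (tau y0) setT), y0.
have [s sy] : exists s, sqvar (tau y) setT - eta < sqvar_on s (tau y) setT.
  apply: contrapT => h.
  have : sqvar (tau y) setT <= sqvar (tau y) setT - eta.
    by apply: sqvar_le => s; rewrite leNgt; apply/negP => h'; apply: h; exists s.
  by lra.
have [y' Yy' sy'] := weak s _ eta0.
have a01 : 0 <= a <= 1 by rewrite ltW.
have [w Yw wE] := aff _ _ _ Yy Yy' a01.
suff : sqvar (tau w) setT <= (1 - a) * (r + eta) + a * eta + (2 * eta + 2 * a ^+ 2 * M).
  move=> /(le_trans (rle _ Yw)).
  have -> : 2 * a ^+ 2 * M = a * r / 4.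
    by transitivity (2 * a * (a * M)); [ring|rewrite aM; field].
  have ar : 0 < a * r by exact: mulr_gt0.
  rewrite /eta; nra.
apply: sqvar_le => s1.
apply: le_trans (sqvar_on_catl s1 s (sftau _ Yw) measurableT) _.
pose s' := s ++ s1.
have D0 u cu : bounded_charge cu u -> 0 <= sqvar_on s' u setT - sqvar_on s u setT.
  by move=> su; rewrite subr_ge0; exact: sqvar_on_catr su measurableT.
have suy := bounded_charge_scale (1 - a) (sftau _ Yy); have suy' := bounded_charge_scale a (sftau _ Yy').
(* The excess of [s'] over [s] is a nonnegative quadratic form; by the parallelogram law its value
   at a sum is at most twice the sum of its values. *)
have h1 := D0 _ _ (bounded_charge_sub suy suy').
have par x := sqvar_on_parallelogram x (fun i B => (1 - a) * tau y i B)
   (fun i B => a * tau y' i B) setT.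
have par1 := par s'; have par2 := par s.
rewrite !sqvar_on_scale in par1 par2.
have cvx := sqvar_on_convex s (tau y) (tau y') setT a01.
rewrite (sqvar_on_ext s' measurableT wE).
have Dy : sqvar_on s' (tau y) setT - sqvar_on s (tau y) setT <= eta.
  by have := sqvar_on_le_sqvar s' (sftau _ Yy) measurableT; lra.
have Dy' : sqvar_on s' (tau y') setT - sqvar_on s (tau y') setT <= M.
  by have := qM _ s' Yy'; have := sqvar_on_ge0 s (tau y') setT; lra.
have e1 : (1 - a) ^+ 2 * (sqvar_on s' (tau y) setT - sqvar_on s (tau y) setT) <= eta.
  apply: le_trans Dy; rewrite -[leRHS]mul1r ler_wpM2r//; first exact: D0 (sftau _ Yy).
  by rewrite expr_le1//; lra.
have e2 : a ^+ 2 * (sqvar_on s' (tau y') setT - sqvar_on s (tau y') setT) <= a ^+ 2 * M.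
  by rewrite ler_wpM2l// sqr_ge0.
have sy1 : sqvar_on s (tau y) setT <= r + eta.
  by have := sqvar_on_le_sqvar s (sftau _ Yy) measurableT; lra.
have e3 : (1 - a) * sqvar_on s (tau y) setT <= (1 - a) * (r + eta) by rewrite ler_wpM2l; lra.
have e4 : a * sqvar_on s (tau y') setT <= a * eta by rewrite ler_wpM2l; lra.
rewrite !mulrBr in e1 e2.
lra.
Qed.

(* th n is the sum over j >= n of 2^-j pr + 2^j sqvar (tau j), see bounded_charge_le_sqvar. *)
Lemma summable_dominated (tau : nat -> I -> set T -> R) c :
  (forall n, bounded_charge c (tau n)) -> (forall n, sqvar (tau n) setT <= 4^-1 ^+ n) ->
  exists th : nat -> set T -> R, [/\
    forall n A B, measurable A -> measurable B ->
      th n (A `&` B) + th n (A `\` B) <= th n A,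
    forall n A, measurable A -> th n.+1 A <= th n A,
    forall n i A, measurable A -> List.In i l -> `|tau n i A| <= th n A &
    forall n A, measurable A -> th n A <= 4 * 2^-1 ^+ n].
Proof.
move=> sftau Qtau.
pose g n A : R := 2^-1 ^+ n * pr P A + sqvar (tau n) A / 2^-1 ^+ n.
have p2 n : 0 < 2^-1 ^+ n :> R by rewrite exprn_gt0// invr_gt0.
have Q0 n A : measurable A -> 0 <= sqvar (tau n) A.
  by move=> mA; apply: le_trans (sqvar_on_le_sqvar [::] (sftau n) mA); exact: sqvar_on_ge0.
have g0 n A : measurable A -> 0 <= g n A.
  move=> mA; apply: addr_ge0; first by rewrite mulr_ge0 ?pr_ge0 ?ltW.
  by apply: divr_ge0; [exact: Q0|exact: ltW].
have gadd n A B : measurable A -> measurable B -> g n (A `&` B) + g n (A `\` B) <= g n A.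
  move=> mA mB; rewrite /g addrACA -mulrDr -mulrDl -pr_split// lerD2l.
  by rewrite ler_pM2r ?invr_gt0//; exact: sqvar_split (sftau n) mA mB.
have gle n A : measurable A -> g n A <= 2 * 2^-1 ^+ n.
  move=> mA; have QA : sqvar (tau n) A <= 4^-1 ^+ n.
    apply: le_trans (Qtau n); have := sqvar_split (sftau n) measurableT mA.
    rewrite setTI setTD; apply: le_trans; rewrite lerDl; apply: Q0.
    exact: measurableC.
  rewrite /g mulr_natl mulr2n lerD//.
    by rewrite -[leRHS]mulr1 ler_pM2l// pr_le1.
  rewrite ler_pdivrMr// -exprMn; apply: le_trans QA _.
  by rewrite (_ : 2^-1 * 2^-1 = 4^-1)//; lra.
pose S n A N := \sum_(n <= j < n + N) g j A.
have Sle n A N : measurable A -> S n A N <= 4 * 2^-1 ^+ n - 4 * 2^-1 ^+ (n + N).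
  move=> mA; rewrite /S; elim: N => [|N ih]; first by rewrite addn0 big_geq// subrr.
  rewrite addnS big_nat_recr/= ?leq_addr//.
  by have := gle (n + N)%N _ mA; rewrite exprS; lra.
have Sle' n A N : measurable A -> S n A N <= 4 * 2^-1 ^+ n.
  by move=> mA; apply: le_trans (Sle _ _ _ mA) _; have := p2 (n + N)%N; lra.
have Smono n A N N' : measurable A -> (N <= N')%N -> S n A N <= S n A N'.
  move=> mA NN; rewrite /S [leRHS](@big_cat_nat _ _ _ (n + N))//=; last 2 first.
  - exact: leq_addr.
  - by rewrite leq_add2l.
  by rewrite lerDl; apply: sumr_ge0 => j _; exact: g0.
have ub n A N : measurable A -> S n A N <= gsup (S n A).
  by move=> mA; apply: gsup_ub => N'; exact: Sle'.
have iN : inhabited nat by exact: (inhabits 0%N).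
exists (fun n A => gsup (S n A)); split.
- move=> n A B mA mB; have mAB := measurableI _ _ mA mB; have mAD := measurableD mA mB.
  rewrite -lerBrDr; apply: gsup_le => // N; rewrite lerBrDr -lerBrDl.
  apply: gsup_le => // N'; rewrite lerBrDl.
  apply: le_trans (ub n A (maxn N N') mA).
  apply: le_trans (lerD (Smono _ _ _ _ mAB (leq_maxl N N')) (Smono _ _ _ _ mAD (leq_maxr N N'))) _.
  by rewrite /S -big_split/=; apply: ler_sum => j _; exact: gadd.
- move=> n A mA; apply: gsup_le => // N; apply: le_trans (ub n A N.+1 mA).
  by rewrite /S addSnnS [leRHS]big_ltn ?lerDr ?g0// addnS ltnS leq_addr.
- move=> n i A mA il; apply: le_trans (ub n A 1%N mA).
  by rewrite /S addn1 big_nat1; exact: bounded_charge_le_sqvar (sftau n) mA (p2 n) il.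
- by move=> n A mA; apply: gsup_le => // N; exact: Sle'.
Qed.

End setfun.

(** * A weighted L1 norm *)

Section wnorm.
Context d (T : measurableType d) (R : realType) (P : probability T R).
Context (k : scalar_field) (E : rnModType P k) (w : T -> R).
Hypotheses (mw : measurable_fun setT w) (w01 : forall t, 0 <= w t <= 1).
Hypothesis wpos : \forall t \ae P, 0 < w t.
Implicit Types (x y z : E) (G : set E) (f : E -> R).

Let w0 t : 0 <= w t. Proof. by have /andP[] := w01 t. Qed.

(** The absolute value makes the integrand nonnegative everywhere, since [rn x] is so only a.e. *)
Definition wnorme x : \bar R := (\int[P]_t (w t * `|rn x t|)%:E)%E.
Definition wfin x := (wnorme x < +oo)%E.
Definition wnorm x : R := fine (wnorme x).

Let mwrn x : measurable_fun setT (fun t => w t * `|rn x t|).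
Proof. by apply: measurable_funM => //; apply: measurableT_comp => //; exact: measurable_rn. Qed.

Let wrn0 x t : 0 <= w t * `|rn x t|.
Proof. by rewrite mulr_ge0. Qed.

Lemma wnorme_ge0 x : (0 <= wnorme x)%E.
Proof. by apply: integral_ge0 => t _; rewrite lee_fin. Qed.

Lemma wnormE x : wfin x -> wnorme x = (wnorm x)%:E.
Proof. by move=> Vx; rewrite /wnorm fineK// ge0_fin_numE// wnorme_ge0. Qed.

Lemma wnorm_ge0 x : 0 <= wnorm x.
Proof. by apply: fine_ge0; exact: wnorme_ge0. Qed.

Lemma wnorme_le x (g : T -> R) : measurable_fun setT g -> (forall t, 0 <= g t) ->
  (\forall t \ae P, w t * rn x t <= g t) -> (wnorme x <= \int[P]_t (g t)%:E)%E.
Proof.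
move=> mg g0 h; apply: ae_ge0_le_integral => //.
- by move=> t _; rewrite lee_fin.
- exact/measurable_EFinP.
- by move=> t _; rewrite lee_fin.
- exact/measurable_EFinP.
- by apply: filterS2 h (rn_ge0 x) => t h1 h2 _; rewrite lee_fin ger0_norm.
Qed.

Lemma wnorme_add x y : (wnorme (x + y)%R <= wnorme x + wnorme y)%E.
Proof.
rewrite /wnorme -ge0_integralD//; last 4 first.
- by move=> t _; rewrite lee_fin.
- exact/measurable_EFinP.
- by move=> t _; rewrite lee_fin.
- exact/measurable_EFinP.
apply: (@wnorme_le _ (fun t => w t * `|rn x t| + w t * `|rn y t|)).
- exact: measurable_funD.
- by move=> t; rewrite addr_ge0.
- apply: filterS (ler_rnD x y) => t h; rewrite -mulrDr ler_wpM2l//.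
  by apply: le_trans h _; rewrite lerD// ler_norm.
Qed.

Lemma wnorme_scale_le c x : (wnorme (L0_real k c *: x)%R <= `|c|%R%:E * wnorme x)%E.
Proof.
rewrite /wnorme -ge0_integralZl_EFin//; last 2 first.
- by move=> t _; rewrite lee_fin.
- exact/measurable_EFinP.
under eq_integral do rewrite -EFinM.
apply: (@wnorme_le _ (fun t => `|c| * (w t * `|rn x t|))).
- exact: measurable_funM.
- by move=> t; rewrite mulr_ge0.
- apply: filterS (rn_rr c x) => t ->; rewrite mulrCA.
  by rewrite !ler_wpM2l// ler_norm.
Qed.

Lemma wfin_add x y : wfin x -> wfin y -> wfin (x + y).
Proof. by move=> Vx Vy; apply: le_lt_trans (wnorme_add x y) _; exact: lte_add_pinfty. Qed.

Lemma wfin_scale c x : wfin x -> wfin (L0_real k c *: x).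
Proof.
move=> Vx; apply: le_lt_trans (wnorme_scale_le c x) _.
by rewrite wnormE// -EFinM ltry.
Qed.

Lemma wfin_opp x : wfin x -> wfin (- x).
Proof. by move=> Vx; have := wfin_scale (-1) Vx; rewrite L0_realN L0_real1 scaleN1r. Qed.

Lemma wfin_sub x y : wfin x -> wfin y -> wfin (x - y).
Proof. by move=> Vx Vy; apply: wfin_add => //; exact: wfin_opp. Qed.

Lemma wfin_ind (A : set T) x : measurable A -> wfin x -> wfin (L0_ind k A *: x).
Proof.
move=> mA; apply: le_lt_trans; apply: wnorme_le => //.
apply: filterS (rn_ind x mA) => t ->; rewrite ler_wpM2l//.
rewrite indicE; case: (_ \in _); rewrite /= ?mul1r ?mul0r//; exact: ler_norm.
Qed.

Lemma wnorm_add x y : wfin x -> wfin y -> wnorm (x + y) <= wnorm x + wnorm y.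
Proof.
by move=> Vx Vy; have := wnorme_add x y; rewrite !wnormE//; exact: wfin_add.
Qed.

Lemma wnorm_scale_le c x : wfin x -> wnorm (L0_real k c *: x) <= `|c| * wnorm x.
Proof.
by move=> Vx; have := wnorme_scale_le c x; rewrite !wnormE//; exact: wfin_scale.
Qed.

Lemma wnorm_ind (A : set T) x : measurable A -> wfin x -> wnorm (L0_ind k A *: x) <= wnorm x.
Proof.
move=> mA Vx; rewrite -lee_fin -!wnormE//; last exact: wfin_ind.
apply: wnorme_le => //; apply: filterS (rn_ind x mA) => t ->; rewrite ler_wpM2l//.
rewrite indicE; case: (_ \in _); rewrite /= ?mul1r ?mul0r//; exact: ler_norm.
Qed.

Lemma wnorm_opp x : wnorm (- x) = wnorm x.
Proof. by rewrite /wnorm /wnorme rnN. Qed.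

Lemma wnorm0 : wnorm 0 = 0.
Proof.
apply/eqP; rewrite eq_le wnorm_ge0 andbT -lee_fin -wnormE; last first.
  rewrite /wfin; apply: (@le_lt_trans _ _ (\int[P]_t (cst 0 t)%:E)%E); last by rewrite integral0 ltry.
  by apply: wnorme_le => //; apply: filterS (rn0 E) => t ->; rewrite mulr0.
have -> : 0%:E = (\int[P]_t (cst 0 t)%:E)%E by rewrite integral0.
by apply: wnorme_le => //; apply: filterS (rn0 E) => t ->; rewrite mulr0.
Qed.

Lemma integral_cindic (A : set T) (c : R) : measurable A -> 0 <= c ->
  (\int[P]_t (c * \1_A t)%:E)%E = (c * pr P A)%:E.
Proof.
move=> mA c0; under eq_integral do rewrite EFinM.
have mi : measurable_fun setT (EFin \o \1_A : T -> \bar R).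
  by apply/measurable_EFinP; exact: measurable_indic.
rewrite ge0_integralZl_EFin// integral_indic// setIT EFinM; congr (_ * _)%E.
exact: prE.
Qed.

Lemma wnorm_le_pr (A : set T) x (c e : R) : measurable A -> 0 <= c -> 0 <= e ->
  (\forall t \ae P, w t * rn x t <= c * \1_A t + e) -> wfin x /\ wnorm x <= c * pr P A + e.
Proof.
move=> mA c0 e0 h.
have mi : measurable_fun setT (\1_A : T -> R) by exact: measurable_indic.
have Nc : (wnorme x <= (c * pr P A + e)%:E)%E.
  apply: (@le_trans _ _ (\int[P]_t (c * \1_A t + e)%:E)%E).
    apply: wnorme_le => //.
      by apply: measurable_funD => //; exact: measurable_funM.
    by move=> t; rewrite addr_ge0// mulr_ge0.
  under eq_integral do rewrite EFinD.
  have mci : measurable_fun setT (fun t => (c * \1_A t)%:E).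
    by apply/measurable_EFinP; exact: measurable_funM.
  rewrite ge0_integralD//; last by move=> t _; rewrite lee_fin mulr_ge0.
  rewrite integral_cindic// integral_cst//.
  apply: (@le_trans _ _ ((c * pr P A)%:E + e%:E * (pr P setT)%:E)%E).
    by rewrite -(prE P measurableT).
  by rewrite pr_setT mule1 EFinD.
have Vx : wfin x by apply: le_lt_trans Nc _; rewrite ltry.
by split => //; rewrite -lee_fin -wnormE.
Qed.

Lemma wnorm_ind_pr (A : set T) x : measurable A ->
  (\forall t \ae P, w t * rn x t <= 1) -> wfin x /\ wnorm (L0_ind k A *: x) <= pr P A.
Proof.
move=> mA h; split.
  have [] // := @wnorm_le_pr setT x 1 0 measurableT _ (lexx 0).
  by apply: filterS h => t; rewrite indicT mulr1 addr0.
rewrite -[leRHS]mul1r -[leRHS]addr0.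
apply: (proj2 (@wnorm_le_pr A _ 1 0 mA _ (lexx 0) _)) => //.
apply: filterS2 h (rn_ind x mA) => t + ->.
by rewrite indicE; case: (_ \in _); rewrite /= ?mul1r ?mul0r ?mulr0 addr0.
Qed.

(** The integrand is at most 2 on an event of probability below e / 4, and at most e / 2 elsewhere
    as w <= 1. The bound 2 is the one valid for differences of points of [G]. *)
Lemma wnorm_small_of_el_ball (e : R) : 0 < e -> exists eps lam : R, [/\ 0 < eps, 0 < lam &
  forall x, (\forall t \ae P, w t * rn x t <= 2) -> el_ball eps lam x -> wnorm x <= e].
Proof.
move=> e0; exists (e / 2), (e / 4); split; [by rewrite divr_gt0..|].
move=> x hx /el_ballE h.
have mt := measurable_rnorm_tail (e / 2) x.
have [//|||_ /le_trans] := @wnorm_le_pr _ x 2 (e / 2) mt.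
- by rewrite divr_ge0// ltW.
- apply: filterS2 hx (rn_ge0 x) => t h1 h2.
  have [h3|h3] := lerP (e / 2) (rn x t).
    rewrite indicE mem_set// mulr1; apply: le_trans h1 _.
    by rewrite lerDl divr_ge0// ltW.
  rewrite indicE memNset ?mulr0 ?add0r; last first.
    by move=> /=; apply/negP; rewrite -ltNge.
  by apply: le_trans (ltW h3); rewrite ler_piMl//; have /andP[] := w01 t.
- by apply; lra.
Qed.

(** As w > 0 a.e., it exceeds some 1/(n+1) off an event of probability below lam / 2; there Markov's
    inequality controls |x|. *)
Lemma el_ball_of_wnorm_small (eps lam : R) : 0 < eps -> 0 < lam -> exists2 e : R, 0 < e &
  forall x, wfin x -> wnorm x < e -> el_ball eps lam x.
Proof.
move=> eps0 lam0; have lam20 : 0 < lam / 2 by rewrite divr_gt0.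
pose W n := [set t | w t <= n.+1%:R^-1].
have mW n : measurable (W n).
  rewrite -[W n]setTI; apply: measurable_fun_le => //.
have [||n hn] := @pr_cvg0 _ _ _ P W mW _ _ _ lam20.
- move=> m n mn t /=; rewrite /W/= => /le_trans; apply.
  by rewrite lef_pV2 ?posrE// ler_nat.
- apply: ae_pr0; first exact: bigcapT_measurable.
  apply: filterS wpos => t wt h.
  have [M _ /(_ M (leqnn M))] := near_infty_natSinv_lt (PosNum wt).
  by rewrite /= ltNge => /negP; apply; exact: h.
pose c := n.+1%:R^-1 * eps : R.
have n0 : 0 < n.+1%:R^-1 :> R by rewrite invr_gt0.
have c0 : 0 < c by rewrite mulr_gt0.
exists (c * (lam / 2)); first by rewrite mulr_gt0.
move=> x Vx Nx.
pose B := [set t | c <= w t * `|rn x t|].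
have mB : measurable B by rewrite -[B]setTI; apply: measurable_fun_le.
have PB : pr P B < lam / 2.
  rewrite -(ltr_pM2l c0); apply: le_lt_trans Nx; rewrite -lee_fin -wnormE// -integral_cindic//; last exact: ltW.
  apply: ge0_le_integral => //.
  - by move=> t _; rewrite lee_fin mulr_ge0// ltW.
  - by apply/measurable_EFinP; apply: measurable_funM.
  - by apply/measurable_EFinP.
  - move=> t _; rewrite lee_fin indicE.
    have [Bt|nBt] := pselect (B t); first by rewrite mem_set// mulr1.
    by rewrite memNset// mulr0.
apply: (@el_ball_ae _ _ _ _ _ _ _ _ (W n `|` B)); first exact: measurableU.
  by apply: le_lt_trans (prU_le P (mW n) mB) _; rewrite [ltRHS]splitr ltrD.
apply: filterS (rn_ge0 x) => t h0 /not_orP[/negP + /negP].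
rewrite -!ltNge ger0_norm// => h1 h2; rewrite ltNge; apply/negP => h3.
suff : c <= w t * rn x t by rewrite leNgt h2.
by apply: ler_pM => //; exact: ltW.
Qed.

(** Real-linear even when K is complex, which is all that separating convex sets demands. *)
Definition functional f := [/\ forall x y, wfin x -> wfin y -> f (x + y) = f x + f y,
  forall c x, wfin x -> f (L0_real k c *: x) = c * f x & forall x, wfin x -> f x <= wnorm x].

Lemma functionalN f x : functional f -> wfin x -> f (- x) = - f x.
Proof.
by move=> [_ fZ _] Vx; have := fZ (- 1) x Vx; rewrite L0_realN L0_real1 scaleN1r mulN1r.
Qed.

Lemma functionalB f x y : functional f -> wfin x -> wfin y -> f (x - y) = f x - f y.
Proof.
move=> ff Vx Vy; have [fD _ _] := ff; rewrite fD//; last exact: wfin_opp.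
by rewrite functionalN.
Qed.

Lemma functional_le f x : functional f -> wfin x -> `|f x| <= wnorm x.
Proof.
move=> ff Vx; have [_ _ fN] := ff; rewrite ler_norml fN// andbT.
by rewrite lerNl -functionalN// -[leRHS]wnorm_opp; apply: fN; exact: wfin_opp.
Qed.

End wnorm.

(** * Separation by a dominated real functional *)

Section real_space.
Context d (T : measurableType d) (R : realType) (P : probability T R).
Context (k : scalar_field) (E : rnModType P k).

Definition real_space : Type := E.

HB.instance Definition _ := GRing.Zmodule.on real_space.

Definition real_scale (c : R) (x : real_space) : real_space := L0_real k c *: (x : E).

Let scaleA a b v : real_scale a (real_scale b v) = real_scale (a * b) v.
Proof. by rewrite /real_scale scalerA L0_realM. Qed.
Let scale1 : left_id 1 real_scale.
Proof. by move=> x; rewrite /real_scale L0_real1 scale1r. Qed.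
Let scaleDr : right_distributive real_scale +%R.
Proof. by move=> a x y; rewrite /real_scale scalerDr. Qed.
Let scaleDl v : {morph real_scale^~ v : a b / a + b}.
Proof. by move=> a b; rewrite /real_scale L0_realD scalerDl. Qed.

HB.instance Definition _ := GRing.Zmodule_isLmodule.Build R real_space
  scaleA scale1 scaleDr scaleDl.

End real_space.

Section separation.
Context d (T : measurableType d) (R : realType) (P : probability T R).
Context (k : scalar_field) (E : rnModType P k) (w : T -> R).
Hypotheses (mw : measurable_fun setT w) (w01 : forall t, 0 <= w t <= 1).
Implicit Types (x y z : E) (C : set E).

Local Notation wfin := (@wfin _ _ _ P k E w).
Local Notation wnorm := (@wnorm _ _ _ P k E w).

(** Hahn-Banach is applied to p y, the infimum over t >= 0 and c in [C] of |y + t (c - x)| - t dlt.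
    It is finite because |c - x| >= dlt, it is below the norm, and p (x - c) <= - dlt by taking t =
    1. *)
Lemma separation C x (dlt : R) : C `<=` wfin -> rconvex C -> C !=set0 -> wfin x ->
  0 < dlt -> (forall c, C c -> dlt <= wnorm (c - x)) ->
  exists2 f, functional w f & forall c, C c -> f x + dlt <= f c.
Proof.
move=> CV cC [c0 Cc0] Vx d0 hC.
have Vs c y : wfin y -> wfin (L0_real k c *: y) by exact: wfin_scale.
have Va y z : wfin y -> wfin z -> wfin (y + z) by exact: wfin_add.
have VB y z : wfin y -> wfin z -> wfin (y - z) by exact: wfin_sub.
pose B y := [set r | exists (t : R) c, [/\ 0 <= t, C c &
   r = wnorm (y + L0_real k t *: (c - x)) - t * dlt]].
pose p y := inf (B y).
have Vc c : C c -> wfin (c - x) by move=> Cc; apply: VB => //; exact: CV.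
have lbB y : wfin y -> lbound (B y) (- wnorm y).
  move=> Vy _ [t [c [t0 Cc ->]]].
  have h1 := hC _ Cc.
  have h2 : t * wnorm (c - x) <= wnorm (y + L0_real k t *: (c - x)) + wnorm y.
    have Vt : wfin (L0_real k t *: (c - x)) by apply: Vs; exact: Vc.
    have h : t * wnorm (c - x) <= wnorm (L0_real k t *: (c - x)).
      move: t0; rewrite le_eqVlt => /predU1P[<-|t0]; first by rewrite mul0r wnorm_ge0.
      rewrite -ler_pdivlMl//; have := wnorm_scale_le mw w01 t^-1 Vt.
      rewrite scalerA -L0_realM mulVf ?gt_eqF// L0_real1 scale1r ger0_norm// invr_ge0.
      exact: ltW.
    apply: le_trans h _; rewrite -(wnorm_opp w y).
    rewrite [X in wnorm X <= _](_ : _ = (y + L0_real k t *: (c - x)) + (- y)); last first.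
      by rewrite [RHS]addrC addKr.
    by apply: wnorm_add => //; [exact: Va|exact: wfin_opp].
  have := ler_wpM2l t0 h1; lra.
have ge y t c : wfin y -> 0 <= t -> C c -> p y <= wnorm (y + L0_real k t *: (c - x)) - t * dlt.
  by move=> Vy t0 Cc; apply: ge_inf; [exists (- wnorm y); exact: lbB|exists t, c].
have glb y r : (forall t c, 0 <= t -> C c -> r <= wnorm (y + L0_real k t *: (c - x)) - t * dlt) ->
    r <= p y.
  move=> h; apply: lb_le_inf; last by move=> _ [t [c [t0 Cc ->]]]; exact: h.
  by exists (wnorm (y + L0_real k 0 *: (c0 - x)) - 0 * dlt), 0, c0.
have pN y : wfin y -> p y <= wnorm y.
  by move=> Vy; have := ge y 0 c0 Vy (lexx 0) Cc0; rewrite L0_real0 scale0r addr0 mul0r subr0.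
have [|||f [fD fZ fp]] := @hahn_banach R (real_space E) wfin _ _ p.
- exact: Va.
- exact: Vs.
- split=> [y z Vy Vz|c y cp Vy].
    rewrite -lerBlDr; apply: (glb _ _) => t c t0 Cc; rewrite lerBlDr -lerBlDl.
    apply: (glb _ _) => s e s0 Ce; rewrite lerBlDl.
    have Vyt : wfin (y + L0_real k t *: (c - x)) by apply: Va => //; apply: Vs; exact: Vc.
    have Vzs : wfin (z + L0_real k s *: (e - x)) by apply: Va => //; apply: Vs; exact: Vc.
    have /= := wnorm_add mw w01 Vyt Vzs.
    rewrite addrACA.
    have [ts|ts] := eqVneq (t + s) 0.
      have t00 : t = 0 by lra.
      have s00 : s = 0 by lra.
      rewrite t00 s00 L0_real0 !scale0r !addr0 !mul0r !subr0; apply: le_trans.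
      by apply: pN; exact: Va.
    have ts0 : 0 < t + s by rewrite lt_neqAle eq_sym ts addr_ge0.
    (* By convexity of [C], t (c - x) + s (e - x) is (t + s) times the difference of a point of [C]
       and [x]. *)
    pose a := t / (t + s).
    have a0 : 0 <= a by rewrite divr_ge0// ltW.
    have a1 : a <= 1 by rewrite ler_pdivrMr// mul1r; lra.
    have := ge _ _ _ (Va _ _ Vy Vz) (ltW ts0) (cC _ _ _ a0 a1 Cc Ce).
    have -> : L0_real k (t + s) *: (L0_real k a *: c + L0_real k (1 - a) *: e - x) =
        L0_real k t *: (c - x) + L0_real k s *: (e - x).
      rewrite !scalerBr addrACA -opprD -scalerDl -L0_realD; congr (_ - _).
      rewrite scalerDr !scalerA -!L0_realM; congr (L0_real k _ *: _ + L0_real k _ *: _).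
        by rewrite /a; field.
      by rewrite /a; field.
    rewrite mulrDl /=; lra.
  rewrite mulrC -ler_pdivrMr//; apply: (glb _ _) => t e t0 Ce; rewrite ler_pdivrMr//.
  apply: le_trans (ge _ _ _ (Vs c _ Vy) (mulr_ge0 (ltW cp) t0) Ce) _.
  have Vye : wfin (y + L0_real k t *: (e - x)) by apply: Va => //; apply: Vs; exact: Vc.
  have := wnorm_scale_le mw w01 c Vye.
  by rewrite ger0_norm ?(ltW cp)// scalerDr scalerA -L0_realM; lra.
have ff : functional w f.
  split; [exact: fD|exact: fZ|].
  by move=> y Vy; apply: le_trans (fp _ Vy) _; exact: pN.
exists f => // c Cc.
have Vxc : wfin (x - c) by apply: VB => //; exact: CV.
have := fp _ Vxc; rewrite (functionalB mw w01 ff Vx (CV _ Cc)).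
have := ge _ 1 c Vxc ler01 Cc.
rewrite L0_real1 scale1r addrA subrK subrr wnorm0// mul1r; lra.
Qed.

End separation.

(** * Limits along an ultrafilter *)

Section ultralimit.
Context (R : realType) (X : Type) (U : set_system X).
Hypothesis UU : UltraFilter U.

(** The limit is the supremum of the r with r <= h on a member of [U]. If h < sup + e failed to hold
    on a member, its negation would, and sup + e would be such an r. *)
Lemma ultralimit (h : X -> R) (M : R) : U [set x | `|h x| <= M] ->
  exists v, forall e, 0 < e -> U [set x | `|h x - v| < e].
Proof.
move=> hM.
pose S := [set r | U [set x | r <= h x]].
have SM r : S r -> r <= M.
  move=> Sr; have [x [/= h1 h2]] := filter_ex (filterI Sr hM).
  by apply: le_trans h1 _; apply: le_trans h2; exact: ler_norm.
have S0 : S (- M).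
  by apply: filterS hM => x /=; rewrite ler_norml => /andP[].
have hs : has_sup S by split; [exists (- M)|exists M => r; exact: SM].
exists (sup S) => e e0.
have [r Sr re] := sup_adherent e0 hs.
have h2 : U [set x | h x < sup S + e].
  have [hl|hl] := in_ultra_setVsetC [set x | h x < sup S + e] UU => //.
  have : S (sup S + e) by apply: filterS hl => x /= /negP; rewrite -leNgt.
  by move=> /(ub_le_sup hs.2); rewrite gerDl leNgt e0.
apply: filterS2 Sr h2 => x /= h3 h4.
rewrite ltr_norml; apply/andP; split; lra.
Qed.

End ultralimit.

(** * From L0-convex compactness to convex compactness *)

Section convex_compactness.
Context d (T : measurableType d) (R : realType) (P : probability T R).
Context (k : scalar_field) (E : rnModType P k) (w : T -> R) (G : set E).
Hypotheses (mw : measurable_fun setT w) (w01 : forall t, 0 <= w t <= 1).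
Hypothesis wpos : \forall t \ae P, 0 < w t.
Hypothesis wG : forall y, G y -> \forall t \ae P, w t * rn y t <= 1.
Hypotheses (clG : el_closed G) (cG : L0_convex G).
Implicit Types (x y z : E).

Let F := {f : E -> R | functional w f}.
Implicit Type f : F.

Let GV y : G y -> wfin w y.
Proof. by move=> Gy; have [] := wnorm_ind_pr mw w01 measurableT (wG Gy). Qed.

Let w0 t : 0 <= w t. Proof. by have /andP[] := w01 t. Qed.

Lemma mass_le f y A : measurable A -> G y -> `|sval f (L0_ind k A *: y)| <= pr P A.
Proof.
move=> mA Gy; have ff := svalP f.
apply: le_trans (functional_le mw w01 ff (wfin_ind mw w01 mA (GV Gy))) _.
by have [] := wnorm_ind_pr mw w01 mA (wG Gy).
Qed.

Lemma mass_split f y A B : measurable A -> measurable B -> wfin w y ->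
  sval f (L0_ind k A *: y) = sval f (L0_ind k (A `&` B) *: y) + sval f (L0_ind k (A `\` B) *: y).
Proof.
move=> mA mB Vy; have [fD _ _] := svalP f.
rewrite -fD; last 2 first.
- by apply: wfin_ind => //; exact: measurableI.
- by apply: wfin_ind => //; exact: measurableD.
by rewrite -scalerDl -L0_ind_split.
Qed.

Lemma mass_bounded_charge y : G y -> bounded_charge P 1 (fun f A => sval f (L0_ind k A *: y)).
Proof.
move=> Gy f; split=> [A B mA mB|A mA]; first exact: mass_split (GV Gy).
by rewrite mul1r; exact: mass_le.
Qed.

Lemma mass_mix f y y' a A : measurable A -> wfin w y -> wfin w y' ->
  sval f (L0_ind k A *: (L0_real k (1 - a) *: y + L0_real k a *: y')) =
  (1 - a) * sval f (L0_ind k A *: y) + a * sval f (L0_ind k A *: y').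
Proof.
move=> mA Vy Vy'; have [fD fZ _] := svalP f.
have VA := wfin_ind mw w01 mA Vy; have VA' := wfin_ind mw w01 mA Vy'.
rewrite scalerDr !scalerA ![L0_ind k A * _]mulrC -!scalerA fD; last 2 first.
- exact: wfin_scale.
- exact: wfin_scale.
by rewrite !fZ.
Qed.

Lemma mass_glue f x y A B : measurable A -> measurable B -> wfin w x -> wfin w y ->
  sval f (L0_ind k A *: (L0_ind k B *: x + L0_ind k (~` B) *: y)) =
  sval f (L0_ind k (A `&` B) *: x) + sval f (L0_ind k (A `\` B) *: y).
Proof.
move=> mA mB Vx Vy; have [fD _ _] := svalP f.
have mC := measurableC mB.
rewrite scalerDr !scalerA -!L0_indI// -setDE fD//; apply: wfin_ind => //.
  exact: measurableI.
exact: measurableD.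
Qed.

(** The estimate is uniform in [f] and [A]: indicators do not increase the weighted norm, and it
    dominates every [f]. *)
Lemma mass_continuous (e : R) : 0 < e -> exists eps lam : R, [/\ 0 < eps, 0 < lam &
  forall x y, G x -> G y -> el_ball eps lam (y - x) -> forall f A, measurable A ->
    `|sval f (L0_ind k A *: x) - sval f (L0_ind k A *: y)| <= e].
Proof.
move=> e0; have [eps [lam [eps0 lam0 h]]] := wnorm_small_of_el_ball E mw w01 e0.
exists eps, lam; split => // x y Gx Gy xy f A mA.
have Vx := GV Gx; have Vy := GV Gy; have Vyx := wfin_sub mw w01 Vy Vx.
rewrite distrC -(functionalB mw w01 (svalP f)); [|exact: wfin_ind..].
rewrite -scalerBr.
apply: le_trans (functional_le mw w01 (svalP f) (wfin_ind mw w01 mA Vyx)) _.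
apply: le_trans (wnorm_ind mw w01 mA Vyx) _; apply: h xy.
apply: filterS3 (wG Gx) (wG Gy) (ler_rnD y (- x)) => t h1 h2; rewrite rnN => h3.
by have := ler_wpM2l (w0 t) h3; lra.
Qed.

Section weak_limit.
Context (nu : F -> set T -> R).
Hypothesis bounded_charge_nu : bounded_charge P 1 nu.

Definition defect y : F -> set T -> R := fun f A => sval f (L0_ind k A *: y) - nu f A.

Lemma bounded_charge_defect y : G y -> bounded_charge P (1 + 1) (defect y).
Proof. by move=> Gy; exact: bounded_charge_sub (mass_bounded_charge Gy) bounded_charge_nu. Qed.

Definition close_to (L : F -> Prop) (th : set T -> R) : set E :=
  [set z | G z /\ forall f A, L f -> measurable A -> `|defect z f A| <= th A].

Lemma close_to_closed L th : el_closed (close_to L th).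
Proof.
apply/el_closedP => x hx.
have Gx : G x.
  apply: (el_closedP G).1 clG _ _ => e l e0 l0.
  by have [y [Gy _] yx] := hx _ _ e0 l0; exists y.
split => // f A Lf mA; apply/ler_addgt0Pr => e e0.
have [eps [lam [eps0 lam0 h]]] := mass_continuous e0.
have [y [Gy hy] yx] := hx _ _ eps0 lam0.
have := h _ _ Gx Gy yx f A mA; have := hy f A Lf mA; rewrite /defect => h1 h2.
rewrite [X in `|X|](_ : _ = (sval f (L0_ind k A *: y) - nu f A) +
  (sval f (L0_ind k A *: x) - sval f (L0_ind k A *: y))); last by lra.
by apply: le_trans (ler_normD _ _) _; rewrite lerD.
Qed.

(** After gluing along B, the defect on A is the defect of [x] on the part inside B plus that of [y]
    on the part outside; superadditivity of [th] absorbs the two bounds. *)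
Lemma close_to_L0_convex (L : F -> Prop) th :
  (forall A B, measurable A -> measurable B -> th (A `&` B) + th (A `\` B) <= th A) ->
  L0_convex (close_to L th).
Proof.
move=> hth; apply: closed_gluing_L0_convex; first exact: close_to_closed.
- move=> x y c c0 c1 [Gx hx] [Gy hy]; split; first exact: L0_convex_rconvex.
  move=> f A Lf mA; rewrite /defect.
  have := mass_mix f (1 - c) mA (GV Gx) (GV Gy).
  have -> : 1 - (1 - c) = c by ring.
  move=> ->.
  have h1 := hx f A Lf mA; have h2 := hy f A Lf mA.
  have c10 : 0 <= 1 - c by lra.
  have := ler_wpM2l c0 h1; have := ler_wpM2l c10 h2.
  move=> h3 h4.
  rewrite [X in `|X|](_ : _ = c * defect x f A + (1 - c) * defect y f A); last first.
    by rewrite /defect; ring.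
  apply: le_trans (ler_normD _ _) _; rewrite !normrM (ger0_norm c0) (ger0_norm c10).
  by lra.
- move=> x y B mB [Gx hx] [Gy hy]; split; first exact: L0_convex_gluing.
  move=> f A Lf mA; have mI := measurableI _ _ mA mB; have mD := measurableD mA mB.
  rewrite /defect (mass_glue f mA mB (GV Gx) (GV Gy)) ((bounded_charge_nu f).1 _ _ mA mB).
  apply: le_trans (hth _ _ mA mB).
  rewrite opprD addrACA; apply: le_trans (ler_normD _ _) _.
  by rewrite lerD//; [exact: hx|exact: hy].
Qed.

Hypothesis ccG : L0_convexly_compact G.

(* Along a sequence y n with summable defects, the sets [close_to] decrease; a common
   point has zero defect. *)
Lemma attained (l : seq F) :
  (forall s (e : R), 0 < e -> exists2 y, G y & sqvar_on P l s (defect y) setT <= e) ->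
  exists2 z, G z & forall f A, List.In f l -> measurable A ->
    sval f (L0_ind k A *: z) = nu f A.
Proof.
move=> weak.
have small : forall e : R, 0 < e -> exists2 y, G y & sqvar P l (defect y) setT <= e.
  apply: (@small_sqvar _ _ _ _ _ _ _ G defect (1 + 1)) => //.
    by move=> y Gy; exact: bounded_charge_defect.
  move=> y y' a Gy Gy' /andP[a0 a1].
  exists (L0_real k (1 - a) *: y + L0_real k a *: y').
    have h0 : 0 <= 1 - a by lra.
    have h1 : 1 - a <= 1 by lra.
    have := L0_convex_rconvex cG h0 h1 Gy Gy'.
    by have -> : 1 - (1 - a) = a by ring.
  move=> f A mA; rewrite /defect (mass_mix f a mA (GV Gy) (GV Gy')); ring.
have /choice[y hy] (n : nat) : exists y, G y /\ sqvar P l (defect y) setT <= 4^-1 ^+ n.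
  have [|y Gy Qy] := small (4^-1 ^+ n); last by exists y.
  by rewrite exprn_gt0// invr_gt0.
have Gy n : G (y n) := (hy n).1.
have [th [th_add th_dec th_y th_le]] := @summable_dominated _ _ _ P _ l
  (fun n => defect (y n)) _ (fun n => bounded_charge_defect (Gy n)) (fun n => (hy n).2).
pose D n := close_to (fun f => List.In f l) (th n).
have [|||z Dz] := @L0cc_nested _ _ _ _ _ _ G D ccG.
- move=> n; split; [exact: close_to_closed|by apply: close_to_L0_convex; exact: th_add|].
  by move=> z [].
- by move=> n; exists (y n); split => // f A lf mA; exact: th_y.
- move=> n z [Gz hz]; split => // f A lf mA.
  by apply: le_trans (hz f A lf mA) _; exact: th_dec.
exists z; first exact: (Dz 0%N).1.
move=> f A lf mA; apply/eqP; rewrite -subr_eq0 -normr_le0.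
apply/ler_addgt0Pr => e e0; rewrite add0r.
have [n hn] := pow2_lt (ler0n R 4) e0.
apply: le_trans (ltW hn); apply: le_trans (th_le n A mA).
exact: (Dz n).2.
Qed.

End weak_limit.

Section ultrafilter.
Context (U : set_system E).
Hypotheses (UU : UltraFilter U) (UG : U G).

Lemma weak_limit : exists nu : F -> set T -> R, bounded_charge P 1 nu /\
  forall f A e, measurable A -> 0 < e -> U [set y | `|sval f (L0_ind k A *: y) - nu f A| < e].
Proof.
have /choice[nu hnu] (p : F * meas_set T) : exists v, forall e, 0 < e ->
    U [set y | `|sval p.1 (L0_ind k (sval p.2) *: y) - v| < e].
  apply: (ultralimit UU (M := pr P (sval p.2))); apply: filterS UG => y Gy /=.
  by apply: mass_le => //; exact: (svalP p.2).
(* The limits were chosen for measurable sets only; the value 0 elsewhere is a default. *)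
pose nu' f A := if pselect (measurable A) is left mA then nu (f, exist _ A mA) else 0.
have hnu' f A e : measurable A -> 0 < e ->
    U [set y | `|sval f (L0_ind k A *: y) - nu' f A| < e].
  by move=> mA e0; rewrite /nu'; case: pselect => // mA'; exact: (hnu (f, exist _ A mA')).
exists nu'; split => // f; split=> [A B mA mB|A mA].
  apply/eqP; rewrite -subr_eq0 -normr_le0; apply/ler_addgt0Pr => e e0; rewrite add0r.
  have e30 : 0 < e / 3 by rewrite divr_gt0.
  have mI := measurableI _ _ mA mB; have mD := measurableD mA mB.
  have [y [Gy [h1 [h2 h3]]]] := filter_ex (filterI UG (filterI (hnu' f _ _ mA e30)
    (filterI (hnu' f _ _ mI e30) (hnu' f _ _ mD e30)))).
  move: h1 h2 h3; rewrite /= (mass_split f mA mB (GV Gy)) !ltr_norml ler_norml.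
  by move=> /andP[? ?] /andP[? ?] /andP[? ?]; apply/andP; split; lra.
apply/ler_addgt0Pr => e e0; rewrite mul1r.
have [y [Gy h1]] := filter_ex (filterI UG (hnu' f _ _ mA e0)).
have := mass_le f mA Gy; move: h1; rewrite /= ltr_norml !ler_norml.
by move=> /andP[? ?] /andP[? ?]; apply/andP; split; lra.
Qed.

(** Only finitely many events and functionals enter [sqvar_on], and each defect tends to 0 along
    [U]. *)
Lemma sqvar_on_defect_small (nu : F -> set T -> R) (l : seq F) s (e : R) :
  (forall f A e, measurable A -> 0 < e -> U [set y | `|sval f (L0_ind k A *: y) - nu f A| < e]) ->
  0 < e -> U [set y | sqvar_on P l s (defect nu y) setT < e].
Proof.
move=> hnu; have := @measurableT _ T; move: setT => A mA.
elim: s A mA e => [|B s ih] A mA e e0 /=; last first.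
  have e20 : 0 < e / 2 by rewrite divr_gt0.
  have mB : measurable (sval B) by exact: svalP.
  apply: filterS2 (ih _ (measurableI _ _ mA mB) _ e20) (ih _ (measurableD mA mB) _ e20).
  by move=> y /= h1 h2; rewrite [e]splitr ltrD.
rewrite /sqterm; elim: l e e0 => [|f l ihl] e e0.
  by apply: filterS UG => y _ /=; rewrite big_nil.
have e20 : 0 < e / 2 by rewrite divr_gt0.
suff h : U [set y | defect nu y f A ^+ 2 / pr P A < e / 2].
  by apply: filterS2 h (ihl _ e20) => y /= h1 h2; rewrite big_cons [e]splitr ltrD.
have [A0|A0] := eqVneq (pr P A) 0.
  by apply: filterS UG => y _ /=; rewrite A0 invr0 mulr0.
have pA : 0 < pr P A by rewrite lt_neqAle eq_sym A0 pr_ge0.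
(* The bound 1 ensures that the square of the defect is at most its absolute value. *)
have c0 : 0 < Num.min 1 (e / 2 * pr P A) by rewrite lt_min ltr01 mulr_gt0.
apply: filterS (hnu f A _ mA c0) => y /=; rewrite lt_min -/(defect nu y f A) => /andP[h1 h2].
rewrite ltr_pdivrMr//; apply: le_lt_trans h2.
by rewrite -real_normK ?num_real// expr2 ler_piMl// ltW.
Qed.

End ultrafilter.

Hypothesis ccG : L0_convexly_compact G.

Lemma ultrafilter_L0cc (U : set_system E) : UltraFilter U -> U G ->
  exists2 x, G x & forall C, rconvex C -> el_closed C -> C `<=` G -> U C -> C x.
Proof.
move=> UU UG; have [nu [bounded_charge_nu hnu]] := weak_limit UU UG.
pose H f := close_to nu (eq f) (fun=> 0).
have f0 : functional w (fun _ : E => 0 : R).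
  split=> [x y _ _|c x _|x _]; rewrite ?addr0 ?mulr0//; exact: wnorm_ge0.
(* The zero functional is a default in the choice below, and [H F0] shows that the common point is
   in [G]. *)
pose F0 : F := exist (fun g : E -> R => functional w g) _ f0.
have [_ _ hcc] := ccG.
(* The family is indexed by the sets [H f] themselves, so a functional is chosen anew for each
   member of a finite subfamily. *)
have [||x hx] := hcc (set E) (range H) id.
- move=> _ [f _ <-]; split.
  + exact: close_to_closed.
  + by apply: close_to_L0_convex => // A B _ _; rewrite addr0.
  + by move=> z [].
- move=> J JD.
  have /choice[phi hphi] (K : set E) : exists f, range H K -> H f = K.
    by have [[f _ fK]|nK] := pselect (range H K); [exists f|exists F0].
  pose l := map phi (finmap.enum_fset J).
  have [|z Gz hz] := attained bounded_charge_nu ccG (l := l).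
    move=> s e e0.
    have [y [Gy /ltW hy]] := filter_ex (filterI UG (sqvar_on_defect_small UU UG l s hnu e0)).
    by exists y.
  exists z => K KJ /=; have KD : range H K by apply/set_mem; exact: JD.
  rewrite -(hphi K KD); split => // f A <- mA.
  rewrite /defect hz ?subrr ?normr0//.
  rewrite /l; elim: (finmap.enum_fset J) (KJ : K \in finmap.enum_fset J) => //= a s ih.
  by rewrite inE => /predU1P[->|/ih]; [left|right].
have xH f A : measurable A -> sval f (L0_ind k A *: x) = nu f A.
  move=> mA; have [Gx /(_ f A erefl mA)] : H f x by apply: hx; exists f.
  by rewrite normr_le0 subr_eq0 => /eqP.
have Gx : G x by have [] : H F0 x by apply: hx; exists F0.
exists x => // C cC clC CG UC.
apply: contrapT => nCx.
have [e [l [e0 l0 hel]]] : exists e l : R, [/\ 0 < e, 0 < l &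
    forall y, C y -> ~ el_ball e l (y - x)].
  apply: contrapT => h; apply: nCx; apply: (el_closedP C).1 clC _ _ => e l e0 l0.
  apply: contrapT => h1; apply: h; exists e, l; split => // y Cy yx.
  by apply: h1; exists y.
have [dlt d0 hd] := el_ball_of_wnorm_small E mw w01 wpos e0 l0.
have [||||| f ff fC] := @separation _ _ _ _ _ _ w mw w01 C x dlt _ cC.
- by move=> y /CG; exact: GV.
- exact: (filter_ex UC).
- exact: GV.
- by [].
- move=> c Cc; rewrite leNgt; apply/negP => h; apply: (hel _ Cc); apply: hd h.
  by apply: wfin_sub => //; apply: GV => //; exact: CG.
have [y [Cy]] := filter_ex (filterI UC (hnu (exist _ f ff) setT dlt measurableT d0)).
rewrite /= -xH//= !L0_indT !scale1r ltr_norml => /andP[_ h1].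
by have := fC _ Cy; lra.
Qed.

End convex_compactness.

(** * Equivalence of the two compactness notions *)

Theorem mainTheorem2 (d : measure_display) (T : measurableType d)
    (R : realType) (P : probability T R) (k : scalar_field)
    (E : rnModType P k) (G : set E)
    (E_complete : el_complete E)
    (G_neq0 : G !=set0)
    (G_closed : el_closed G)
    (G_convex : L0_convex G) :
  convexly_compact (G : set (el_space E)) <-> L0_convexly_compact G.
Proof.
split=> [[_ _ ccG]|ccG].
  split => // I D f hf; apply: ccG => i Di; have [clf cf fG] := hf i Di; split => //.
  exact: (rconvex_convex_set (L0_convex_rconvex cf)).
split => //; first exact: (rconvex_convex_set (L0_convex_rconvex G_convex)).
move=> I D f hf fin.
(* The intersection of the empty family is the whole space. For a nonempty one, a member of the
   family puts [G] in the ultrafilter. *)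
have [D0|D0] := pselect (D !=set0); last first.
  exists (0 : E) => i Di.
  by case: D0; exists i.
have [w [mw w01 wpos wG]] := L0cc_weight E_complete ccG G_neq0.
have FF := finI_filter fin.
have [U [UU FU]] := ultraFilterLemma FF.
have Uf i : D i -> U (f i).
  by move=> Di; apply: FU; exists (f i) => //; exact: finI_from1.
have UG : U G.
  have [i Di] := D0; apply: filterS (Uf i Di); by have [] := hf i Di.
have [x Gx hx] := ultrafilter_L0cc mw w01 wpos wG G_closed G_convex ccG UU UG.
exists x => i Di; have [clf cf fG] := hf i Di.
by apply: hx => //; [exact: convex_set_rconvex|exact: Uf].
Qed.
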